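(* For any decay exponent $\alpha\in(3/2,\infty]$, any inverse temperature $\beta>0$ and any disorder strength $\lambda>0$, if $\phi_N$ is distributed according to the annealed distribution $\mathbb P^{\mathrm{ann}}_{N,\alpha,\lambda,\beta}$, then $$\frac{\phi_N(0)}{\sqrt{\mathbb E\bigl[E^\eta_{N,\alpha,\lambda,\beta}[\phi(0)^2]\bigr]}}\ \overset{\mathcal L}{\underset{N\to\infty}{\longrightarrow}}\ \mathcal N(0,1),$$ where the convergence is in distribution.
   Context: Disorder: $\eta=(\eta_x)_{x\in\mathbb Z}$ is a collection of i.i.d. real random variables with $\mathbb E[\eta_x]=0$ and $\mathbb E[\eta_x^2]=1$; $\mathbb P$ is the disorder law and $\mathbb E$ its expectation. Model: $\Lambda_N:=\{-N,\dots,N\}$, $\Omega_N:=\{\phi:\mathbb Z\to\mathbb Z\mid \phi(x)=0\text{ for all }x\notin\Lambda_N\}$. For $\alpha\in(1,\infty)$ and $\phi\in\Omega_N$, $\mathcal H^0_{N,\alpha}(\phi):=\frac12\sum_{\{x,y\}\subset\mathbb Z,\,x\ne y}\frac{(\phi(x)-\phi(y))^2}{|x-y|^\alpha}$ (sum over unordered pairs), and for $\alpha=\infty$, $\mathcal H^0_{N,\infty}(\phi):=\frac12\sum_{\{x,y\}\subset\mathbb Z,\,|x-y|=1}(\phi(x)-\phi(y))^2$. Set $\mathcal H^\eta_{N,\alpha,\lambda}(\phi):=\mathcal H^0_{N,\alpha}(\phi)-\lambda\sum_{x\in\Lambda_N}\eta_x\phi(x)$. The disordered Gibbs measure is the probability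 measure on $\Omega_N$ given by $\mu^\eta_{N,\alpha,\lambda,\beta}(\phi):=\exp(-\beta\mathcal H^\eta_{N,\alpha,\lambda}(\phi))/Z$, where $Z$ is the normalising sum over $\Omega_N$, and $E^\eta_{N,\alpha,\lambda,\beta}$ is its expectation. The annealed distribution is $\mathbb P^{\mathrm{ann}}_{N,\alpha,\lambda,\beta}(d\eta,d\phi):=\mathbb P(d\eta)\,\mu^\eta_{N,\alpha,\lambda,\beta}(d\phi)$; $\phi_N$ denotes the $\phi$-component. *)

(* Defs.v *)
From HB Require Import structures.
From mathcomp Require Import all_boot all_order all_algebra.
From mathcomp Require Import finmap.
From mathcomp Require Import all_classical all_reals all_analysis.
From mathcomp Require Import measurable_realfun.

Set Implicit Arguments.
Unset Strict Implicit.
Unset Printing Implicit Defensive.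

Import Order.TTheory GRing.Theory Num.Theory.
Import numFieldNormedType.Exports.

Local Open Scope classical_set_scope.
Local Open Scope ring_scope.

Section Disorder.
Context d (T : measurableType d) (R : realType) (P : probability T R).

Definition mutually_independent (I : choiceType) (X : I -> {RV P >-> R}) :=
  forall (J : {fset I}) (A : I -> set R), (forall i, measurable (A i)) ->
    P (\bigcap_(i in [set` J]) (X i @^-1` A i)) =
    (\prod_(i <- J) P (X i @^-1` A i))%E.

Definition identically_distributed (I : Type) (X : I -> {RV P >-> R}) :=
  forall (i j : I) (A : set R), measurable A ->
    distribution P (X i) A = distribution P (X j) A.

End Disorder.

(* The random variables [X n] may live on different probability spaces; the
   convergence is that of distribution functions at every continuity point of
   the limiting one. *)
Definition cvg_in_distribution (R : realType) (d : nat -> measure_display)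
    (T : forall n, measurableType (d n)) (P : forall n, probability (T n) R)
    (X : forall n, {RV (P n) >-> R})
    (nu : probability (measurableTypeR R) R) : Prop :=
  forall r : R, {for r, continuous (fun s : R => nu `]-oo, s]%classic)} ->
    cdf (X n) r @[n --> \oo] --> nu `]-oo, r]%classic.

Section Configurations.
Variable N : nat.

Definition Lambda : set int := [set x | - (N%:Z) <= x <= N%:Z].

Lemma finite_Lambda : finite_set Lambda.
Proof.
apply: (@sub_finite_set _ _
    [set` [seq i%:Z - N%:Z | i <- iota 0 N.*2.+1]]) => [x /andP[x1 x2]|].
  have xN0 : 0 <= x + N%:Z by rewrite -lerBlDr sub0r.
  apply/mapP; exists (absz (x + N%:Z)); last by rewrite gez0_abs// addrK.
  rewrite mem_iota/= add0n ltnS -lez_nat gez0_abs//.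
  by rewrite -addnn PoszD lerD2r.
exact: finite_seq.
Qed.

Definition Omega_set : set (int -> int) :=
  [set phi | forall x, ~ Lambda x -> phi x = 0].

Definition Omega : Type := set_type Omega_set.

HB.instance Definition _ := Choice.on Omega.

Definition height (phi : Omega) (x : int) : int := \val phi x.

Lemma Omega_set0 : (fun=> 0) \in Omega_set.
Proof. by rewrite inE. Qed.

HB.instance Definition _ :=
  isPointed.Build Omega (exist _ (fun=> 0) Omega_set0).

HB.instance Definition _ := @isMeasurable.Build default_measure_display
  Omega discrete_measurable discrete_measurable0
  discrete_measurableC discrete_measurableU.

Definition Omega_code (phi : Omega) : nat :=
  choice.pickle [seq height phi (i%:Z - N%:Z) | i <- iota 0 N.*2.+1].

Lemma Omega_code_inj : injective Omega_code.
Proof.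
move=> phi psi /(pcan_inj choice.pickleK) /eq_in_map e.
apply: val_inj; apply/funext => x.
have [Lx|nLx] := pselect (Lambda x); last first.
  by have := valP phi; have := valP psi; rewrite !inE => -> // ->.
have /andP[x1 x2] := Lx.
have xN0 : 0 <= x + N%:Z by rewrite -lerBlDr sub0r.
have := e (absz (x + N%:Z)); rewrite /height gez0_abs// addrK; apply.
rewrite mem_iota/= add0n ltnS -lez_nat gez0_abs//.
by rewrite -addnn PoszD lerD2r.
Qed.

End Configurations.

Section Gibbs.
Context (R : realType) (N : nat) (alpha : \bar R) (lambda beta : R).

(* Unordered pairs of distinct integers are encoded as pairs [p] such that
   [p.1 < p.2]. When [1 < a] the sum is finite because [phi] has finite
   support, so that [fine] does not lose anything; the value at [-oo] is
   irrelevant. *)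
Definition H0 (phi : Omega N) : R :=
  let sq_diff (p : int * int) : R :=
    ((height phi p.1 - height phi p.2) ^+ 2)%:~R in
  2^-1 * match alpha with
  | a%:E => fine (\esum_(p in [set p : int * int | p.1 < p.2])
                    (sq_diff p / ((p.2 - p.1)%:~R `^ a))%:E)
  | +oo%E => fine (\esum_(p in [set p : int * int | p.2 - p.1 = 1])
                    (sq_diff p)%:E)
  | -oo%E => 0
  end.

Definition hamiltonian (h : int -> R) (phi : Omega N) : R :=
  H0 phi - lambda * \sum_(x \in Lambda N) h x * (height phi x)%:~R.

Definition boltzmann (h : int -> R) (A : set (Omega N)) : \bar R :=
  \esum_(phi in A) (expR (- beta * hamiltonian h phi))%:E.

Section boltzmann_measure.
Variable h : int -> R.

Let boltzmann0 : boltzmann h set0 = 0%E.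
Proof. exact: esum_set0. Qed.

Let boltzmann_ge0 A : (0 <= boltzmann h A)%E.
Proof. by apply: esum_ge0 => phi _; rewrite lee_fin expR_ge0. Qed.

Let boltzmann_sigma_additive : semi_sigma_additive (boltzmann h).
Proof.
move=> F _ tF _; rewrite [X in _ --> X]nneseries_sum_bigcup//.
apply: is_cvg_nneseries => n _ _; exact: boltzmann_ge0.
Qed.

HB.instance Definition _ := isMeasure.Build _ _ _ (boltzmann h)
  boltzmann0 boltzmann_ge0 boltzmann_sigma_additive.

End boltzmann_measure.

(* [mnormalize] divides by the partition function
   [boltzmann h setT]; its default [\d_point] is only used when the latter is
   infinite, which does not occur if [1 < alpha] and [0 < beta]. *)
Definition gibbs (h : int -> R) : probability (Omega N) R :=
  mnormalize (boltzmann h) (dirac point).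

Section gibbs_kernel.
Context d (T : measurableType d) (P : probability T R)
  (eta : int -> {RV P >-> R}).

Definition boltzmann_ker (w : T) : {measure set (Omega N) -> \bar R} :=
  boltzmann (fun x => eta x w).

Definition gibbs_ker (w : T) : {measure set (Omega N) -> \bar R} :=
  gibbs (fun x => eta x w).

Let measurable_boltzmann_ker U :
  measurable U -> measurable_fun [set: T] (boltzmann_ker ^~ U).
Proof.
move=> _; rewrite /boltzmann_ker/= /boltzmann.
pose f w phi := (expR (- beta * hamiltonian (fun x => eta x w) phi))%:E.
pose g := @Omega_code N.
have gK : cancel g (pinv setT g).
  by move=> phi; apply: pinvKV; rewrite ?inE// => ? ? _ _; exact: Omega_code_inj.
rewrite [X in measurable_fun _ X](_ : _ = (fun w => \sum_(n <oo | n \in g @` U)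
    f w (pinv setT g n))%E); last first.
  apply/funext => w; rewrite nneseries_esum; last first.
    by move=> n _; rewrite lee_fin expR_ge0.
  rewrite (_ : [set x | x \in _] = g @` U); last first.
    by apply/seteqP; split => x /=; rewrite inE.
  rewrite esum_image; last by move=> ? ? _ _; exact: Omega_code_inj.
  by apply: eq_esum => phi _; rewrite gK.
apply: ge0_emeasurable_sum => [n w _ _|n _]; first by rewrite lee_fin expR_ge0.
apply/measurable_EFinP; apply: measurableT_comp => //.
apply: measurable_funM => //; rewrite /hamiltonian; apply: measurable_funB => //.
apply: measurable_funM => //.
under eq_fun do rewrite (fsbig_finite _ _ (finite_Lambda N)).
by apply: measurable_sum => x; apply: measurable_funM.
Qed.

HB.instance Definition _ := isKernel.Build _ _ _ _ _ boltzmann_ker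
  measurable_boltzmann_ker.

HB.instance Definition _ := ProbabilityKernel.copy gibbs_ker
  (knormalize boltzmann_ker (dirac point)).

(* The joint law of the disorder (carried by [T]) and of the field:
   [P(dw) * gibbs_ker w (dphi)]. *)
Definition annealed (A : set (T * Omega N)) : \bar R :=
  \int[P]_w gibbs_ker w (xsection A w).

Let annealed0 : annealed set0 = 0%E.
Proof.
by rewrite /annealed integral0_eq// => w _; rewrite xsection0 measure0.
Qed.

Let annealed_ge0 A : (0 <= annealed A)%E.
Proof. by apply: integral_ge0 => w _; exact: measure_ge0. Qed.

Let annealed_sigma_additive : semi_sigma_additive annealed.
Proof.
move=> F mF tF mUF; rewrite /annealed [X in _ --> X](_ : _ =
    (\sum_(n <oo) \int[P]_w gibbs_ker w (xsection (F n) w))%E).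
  by apply: is_cvg_nneseries => n _ _; exact: annealed_ge0.
rewrite -integral_nneseries//; last first.
  by move=> n; apply: measurable_fun_xsection_finite_kernel; rewrite inE.
apply: eq_integral => w _; rewrite xsection_bigcup measure_bigcup//.
- by apply: eq_eseriesl => n; rewrite in_setT.
- by apply: trivIset_xsection.
Qed.

HB.instance Definition _ := isMeasure.Build _ _ _ annealed
  annealed0 annealed_ge0 annealed_sigma_additive.

Let annealed1 : annealed setT = 1%E.
Proof.
rewrite /annealed -(@probability_setT _ _ _ P) -[RHS]mul1e -integral_cst//.
apply: eq_integral => w _; rewrite (_ : xsection setT w = setT) ?prob_kernel//.
by apply/seteqP; split => // phi _; rewrite /xsection/= in_setT.
Qed.

HB.instance Definition _ := Measure_isProbability.Build _ _ _ annealed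
  annealed1.

End gibbs_kernel.
End Gibbs.

Arguments annealed {R} N alpha lambda beta {d T P} eta A.

Section Field.
Context (R : realType) (N : nat) (d : measure_display) (T : measurableType d).

Definition scaled_field (s : R) (x : int) (p : T * Omega N) : R :=
  (height p.2 x)%:~R / s.

Let measurable_scaled_field s x : measurable_fun setT (scaled_field s x).
Proof.
rewrite (_ : scaled_field s x =
  (fun phi : Omega N => (height phi x)%:~R / s) \o snd)//.
by apply: measurableT_comp => // _ B _; rewrite setTI.
Qed.

HB.instance Definition _ s x :=
  isMeasurableFun.Build _ _ _ _ (scaled_field s x)
    (measurable_scaled_field s x).

End Field.

Arguments scaled_field {R N d T} s x p.

(* Main.v *)
(* On [Lambda N] the Hamiltonian is half a Toeplitz quadratic form [A] minus
   [lambda (eta, phi)]. Let [g] be the Green function, [A g = delta_0]. By a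
   comparison principle [g] is nonnegative, even and decreasing away from [0],
   so [g = \sum_l c_l 1_(B_l)] with [c_l >= 0] and [B_l] the box of radius [l].
   Hence, with [u := lambda (g, eta)],
     phi(0) - u = (A phi - lambda eta, g) = \sum_l c_l X_l,
   where [X_l := (A phi - lambda eta, 1_(B_l))]. Invariance of the counting
   measure under [phi -> phi +- 1_(B_l)] gives
   [E exp (+- beta X_l) = exp (beta P_l / 2)] with [P_l := (1_(B_l), A 1_(B_l))],
   whatever the disorder. Thus the thermal fluctuation [E (phi(0) - u)^2] is at
   most a constant times [(\sum_l c_l P_l)^2], uniformly in [eta]. Summability
   of [J k * sqrt k], which is where [3/2 < alpha] enters, makes both this bound
   and [g(0)^2] negligible with respect to the squared l2 norm of [g]. So
   [phi(0)] is asymptotically the weighted sum [u], whose weights satisfy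
   Lindeberg's condition; the central limit theorem is obtained by replacing
   the summands one by one in a solution of the heat equation. *)

Require Import Defs.
From HB Require Import structures.
From mathcomp Require Import all_boot all_order all_algebra.
From mathcomp Require Import finmap.
From mathcomp Require Import all_classical all_reals all_analysis.
From mathcomp Require Import measurable_realfun.
From mathcomp Require Import ring lra zify.

Set Implicit Arguments.
Unset Strict Implicit.
Unset Printing Implicit Defensive.

Import Order.TTheory GRing.Theory Num.Theory.
Import numFieldNormedType.Exports.

Local Open Scope classical_set_scope.
Local Open Scope ring_scope.

(** * Toeplitz forms with long-range interactions *)

(** The obstacle is that heights are integers. For a real-valued field, shifting [phi] by multiples
    of [g] would give the law of [phi(0) - u] exactly, with variance [g(0) / beta]; here only
    integer shifts preserve the counting measure. Indicators of boxes are such shifts, and the price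
    is that [(\sum_l c_l P_l)^2] replaces [g(0)]. The square root of [k] comes from Cauchy-Schwarz.
    Up to a tail term, [\sum_l c_l P_l] is at most four times the sum over [k] of [J k] times the
    sum of the first [k] values of [g] from its peak. That inner sum is at most [sqrt k] times the
    l2 norm of [g], and also at most [k * g(0)]. The second bound serves for boundedly many [k], the
    first for the summable tail; so everything rests on [g(0)] being small compared with the l2
    norm. Since the thermal bound is uniform in the disorder, it passes to the annealed law by
    integration. It also shows that the annealed second moment is asymptotic to the variance of [u],
    so the normalisation needs no separate analysis. Only second moments of the disorder are
    available, hence a Lindeberg argument with truncation. *)

(** Test [M w >= 0] against the negative part [v] of [w]. Since [v + w] is the positive part,
    [v k * (v j + w j)] vanishes for [j = k] and is nonnegative otherwise, where [M k j <= 0]; hence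
    the form of [v] is nonpositive and [v = 0]. *)
Lemma mmatrix_comparison (R : realDomainType) (I : finType) (M : I -> I -> R)
    (w : I -> R) :
  (forall i j, i != j -> M i j <= 0) ->
  (forall v : I -> R, (forall i, 0 <= v i) ->
    \sum_i \sum_j M i j * (v i * v j) <= 0 -> forall i, v i = 0) ->
  (forall i, 0 <= \sum_j M i j * w j) -> forall i, 0 <= w i.
Proof.
move=> Moff Mpos Mw i.
pose v j := Num.max (- w j) 0.
have v0 j : 0 <= v j by rewrite /v le_max lexx orbT.
have /(_ i) : forall i, v i = 0.
  apply: Mpos => //.
  apply: (@le_trans _ _ (\sum_i - (v i * \sum_j M i j * w j))); last first.
    by apply: sumr_le0 => j _; rewrite oppr_le0 mulr_ge0.
  apply: ler_sum => k _; rewrite mulr_sumr -sumrN; apply: ler_sum => j _.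
  have vw : 0 <= v j + w j by rewrite -lerBlDr sub0r /v le_max lexx.
  suff : M k j * (v k * (v j + w j)) <= 0.
    rewrite -[in X in X -> _]oppr_ge0 -[in X in _ -> X]subr_ge0.
    by congr (is_true (_ <= _)); ring.
  have [->|kj] := eqVneq k j.
    suff -> : v j * (v j + w j) = 0 by rewrite mulr0.
    rewrite /v; case: (leP 0 (w j)) => w0.
      by rewrite max_r ?oppr_le0// mul0r.
    by rewrite max_l ?oppr_ge0 ?ltW// addNr mulr0.
  have := Moff _ _ kj; have := v0 k => vk Mk.
  by rewrite mulr_le0_ge0// mulr_ge0.
by rewrite -oppr_le0 => <-; rewrite /v le_max lexx.
Qed.

Lemma big_nat_widen0 (R : nmodType) (F : nat -> R) (m n : nat) :
  (m <= n)%N -> (forall i, (m <= i < n)%N -> F i = 0) ->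
  \sum_(0 <= i < n) F i = \sum_(0 <= i < m) F i.
Proof.
move=> mn F0; rewrite (@big_cat_nat _ _ _ m)//= [X in _ + X]big_nat_cond.
by rewrite [X in _ + X]big1 ?addr0// => i /andP[/F0].
Qed.

(** Lagrange's identity: twice the difference of the two sides is the double sum of
    [c i * c j * (x i * y j - x j * y i) ^+ 2]. *)
Lemma cauchy_schwarz_weighted (R : realFieldType) (I : Type) (r : seq I)
    (c x y : I -> R) : (forall i, 0 <= c i) ->
  (\sum_(i <- r) c i * (x i * y i)) ^+ 2 <=
  (\sum_(i <- r) c i * x i ^+ 2) * (\sum_(i <- r) c i * y i ^+ 2).
Proof.
move=> c0; pose sxy := \sum_(i <- r) c i * (x i * y i).
have dbl (f g : I -> R) :
    (\sum_(i <- r) f i) * (\sum_(i <- r) g i) =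
    \sum_(i <- r) \sum_(j <- r) f i * g j.
  by rewrite mulr_suml; apply: eq_bigr => i _; rewrite mulr_sumr.
suff : 0 <= \sum_(i <- r) \sum_(j <- r) c i * c j * (x i * y j - x j * y i) ^+ 2.
  have -> : \sum_(i <- r) \sum_(j <- r)
        c i * c j * (x i * y j - x j * y i) ^+ 2 =
      \sum_(i <- r) \sum_(j <- r) ((c i * x i ^+ 2) * (c j * y j ^+ 2) +
        (c i * y i ^+ 2) * (c j * x j ^+ 2) -
        ((c i * (x i * y i)) * (c j * (x j * y j))) *+ 2).
    by apply: eq_bigr => i _; apply: eq_bigr => j _; ring.
  under eq_bigr do rewrite sumrB big_split/= sumrMnl.
  rewrite sumrB big_split/= sumrMnl -!dbl -/sxy; lra.
apply: sumr_ge0 => i _; apply: sumr_ge0 => j _.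
by rewrite mulr_ge0 ?sqr_ge0// mulr_ge0.
Qed.

Lemma sqr_sum_le (R : realFieldType) (I : Type) (r : seq I) (x : I -> R) :
  (\sum_(i <- r) x i) ^+ 2 <= (size r)%:R * \sum_(i <- r) x i ^+ 2.
Proof.
have := @cauchy_schwarz_weighted R I r (fun=> 1) (fun=> 1) x (fun=> ler01).
under eq_bigr do rewrite !mul1r.
under [X in _ <= X * _]eq_bigr do rewrite mul1r expr1n.
under [X in _ <= _ * X]eq_bigr do rewrite mul1r.
by rewrite big_const_seq count_predT iter_addr_0.
Qed.

Section Toeplitz.
Context (R : realFieldType) (J : nat -> R) (D : R).
Hypotheses (J_ge0 : forall k, 0 <= J k)
  (J_noninc : forall k l, (0 < k <= l)%N -> J l <= J k)
  (J1 : J 1 = 1)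
  (D_ge : forall K, \sum_(1 <= k < K) J k *+ 2 <= D).

Definition toeplitz (k : nat) : R := if k == 0%N then D else - J k.

Lemma toeplitzS k : toeplitz k.+1 = - J k.+1. Proof. by []. Qed.

(* twice the sum of squared differences at distance [k] of the extension by
   zero of [F] *)
Definition autocorr (n : nat) (F : nat -> R) (k : nat) : R :=
  \sum_(0 <= i < n) F i ^+ 2 - \sum_(0 <= i < n) F i * F (i + k)%N.

(** The last sum comes from the pairs whose left end lies before [0], where the extension vanishes;
    pairs that leave on the right are in the first sum already. *)
Lemma autocorrE n F k : (forall i, (n <= i)%N -> F i = 0) ->
  autocorr n F k *+ 2 = \sum_(0 <= i < n) (F i - F (i + k)%N) ^+ 2 +
    \sum_(0 <= i < k) F i ^+ 2.
Proof.
move=> F0.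
have -> : \sum_(0 <= i < k) F i ^+ 2 =
  \sum_(0 <= i < n) F i ^+ 2 - \sum_(0 <= i < n) F (i + k)%N ^+ 2.
  apply/eqP; rewrite eq_sym subr_eq; apply/eqP.
  have -> : \sum_(0 <= i < n) F (i + k)%N ^+ 2 = \sum_(k <= i < k + n) F i ^+ 2.
    by rewrite -{2}[k]add0n big_addn addKn.
  rewrite -big_cat_nat//= ?leq_addr//.
  rewrite [RHS](@big_nat_widen0 _ _ n) ?leq_addl// => i /andP[ni _].
  by rewrite F0// expr0n.
under [X in _ = X + _]eq_bigr do rewrite sqrrB.
rewrite /autocorr big_split/= sumrB sumrMnl; ring.
Qed.

Lemma autocorr_ge0 n F k : (forall i, (n <= i)%N -> F i = 0) ->
  0 <= autocorr n F k.
Proof.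
move=> F0; rewrite -(pmulrn_lge0 _ (isT : (0 < 2)%N)) autocorrE//.
by rewrite addr_ge0// sumr_ge0// => i _; rewrite sqr_ge0.
Qed.

Definition toeplitz_form (n : nat) (F G : nat -> R) : R :=
  \sum_(0 <= i < n) \sum_(0 <= j < n) toeplitz `|i - j|%N * (F i * G j).

Lemma sum_upper n (F : nat -> R) (i : nat) : (i < n)%N ->
  (forall i, (n <= i)%N -> F i = 0) -> forall K, (n <= K)%N ->
  \sum_(i.+1 <= j < n) J (j - i) * F j = \sum_(1 <= k < K) J k * F (i + k)%N.
Proof.
move=> iN F0 K nK.
transitivity (\sum_(1 <= k < n - i) J k * F (i + k)%N).
  rewrite -addn1 addnC big_addn; apply: eq_bigr => k _.
  by rewrite addnK addnC.
rewrite [RHS](@big_cat_nat _ _ _ (n - i))//= ?subn_gt0// ?(leq_trans (leq_subr _ _))//.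
rewrite [X in _ + X]big_nat_cond [X in _ + X]big1 ?addr0// => k.
by move=> /andP[/andP[+ _] _]; rewrite leq_subLR => /F0 ->; rewrite mulr0.
Qed.

(** Pairs are grouped by their distance. At distance [K >= n] or more a site of the support can only
    meet the zero extension, so these pairs contribute a multiple of the squared norm; the excess of
    [D] over the partial sum stands for them. *)
Lemma toeplitz_formE n F K : (n <= K)%N -> (forall i, (n <= i)%N -> F i = 0) ->
  toeplitz_form n F F = \sum_(1 <= k < K) J k * (autocorr n F k *+ 2) +
   (D - \sum_(1 <= k < K) J k *+ 2) * \sum_(0 <= i < n) F i ^+ 2.
Proof.
move=> nK F0.
have up : \sum_(0 <= i < n) \sum_(i.+1 <= j < n) J (j - i)%N * (F i * F j) =
  \sum_(1 <= k < K) J k * \sum_(0 <= i < n) F i * F (i + k)%N.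
  rewrite big_nat; under eq_bigr => i /andP[_ iN].
    under eq_bigr do rewrite mulrCA.
    rewrite -mulr_sumr (sum_upper iN F0 nK).
    over.
  rewrite -big_nat.
  under eq_bigr do rewrite mulr_sumr.
  rewrite exchange_big/=; apply: eq_bigr => k _; rewrite mulr_sumr.
  by apply: eq_bigr => i _; rewrite mulrCA.
have low : \sum_(0 <= i < n) \sum_(0 <= j < i) J (i - j)%N * (F i * F j) =
  \sum_(0 <= i < n) \sum_(i.+1 <= j < n) J (j - i)%N * (F i * F j).
  transitivity (\sum_(0 <= i < n) \sum_(0 <= j < n | (j < i)%N)
      J (i - j)%N * (F i * F j)).
    rewrite big_nat [RHS]big_nat; apply: eq_bigr => i /andP[_ iN].
    by rewrite (big_nat_widen _ _ n)// ltnW.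
  rewrite (exchange_big_dep_nat xpredT)//=.
  apply: eq_bigr => i _; rewrite [RHS](big_nat_widenl _ 0)//=.
  by apply: eq_big => [j|j _]; rewrite ?andbT// (mulrC (F j)).
have split i : (i < n)%N ->
  \sum_(0 <= j < n) toeplitz `|i - j|%N * (F i * F j) = D * F i ^+ 2
   - \sum_(0 <= j < i) J (i - j)%N * (F i * F j)
   - \sum_(i.+1 <= j < n) J (j - i)%N * (F i * F j).
  move=> iN; rewrite (@big_cat_nat _ _ _ i)//= 1?ltnW//.
  rewrite [X in _ + X]big_ltn// distnn {2}/toeplitz eqxx -expr2.
  rewrite addrCA addrA; congr (_ + _ + _).
    rewrite -sumrN [LHS]big_nat [RHS]big_nat.
    apply: eq_bigr => j /andP[_ ji]; rewrite distnEl 1?ltnW//.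
    by rewrite /toeplitz subn_eq0 leqNgt ji mulNr.
  rewrite -sumrN [LHS]big_nat [RHS]big_nat.
  apply: eq_bigr => j /andP[ij _]; rewrite distnEr 1?ltnW//.
  by rewrite /toeplitz subn_eq0 leqNgt ij mulNr.
rewrite /toeplitz_form big_nat (eq_bigr _ (fun i Hi => split i (andP Hi).2)) -big_nat.
rewrite !sumrB -mulr_sumr low up.
have -> : \sum_(1 <= k < K) J k * (autocorr n F k *+ 2) =
  (\sum_(1 <= k < K) J k *+ 2) * (\sum_(0 <= i < n) F i ^+ 2) -
  (\sum_(1 <= k < K) J k * \sum_(0 <= i < n) F i * F (i + k)%N) *+ 2.
  rewrite mulr_suml -sumrMnl -sumrB; apply: eq_bigr => k _.
  by rewrite /autocorr; ring.
ring.
Qed.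

(** Only the distance [1] is kept, where [J] is [1]. Coercivity, definiteness and the regularity of
    the Green function all come from this nearest-neighbour bound. The cut-off [n.+2] keeps the term
    [k = 1] even for [n = 0]. *)
Lemma toeplitz_form_gradient n (F : nat -> R) :
  (forall i, (n <= i)%N -> F i = 0) ->
  \sum_(0 <= i < n) (F i - F i.+1) ^+ 2 <= toeplitz_form n F F.
Proof.
move=> F0; rewrite (@toeplitz_formE n F n.+2)//; last by rewrite ltnW.
apply: (@le_trans _ _ (\sum_(1 <= k < n.+2) J k * (autocorr n F k *+ 2))).
  rewrite [leRHS]big_ltn// J1 mul1r autocorrE// -addrA.
  under [X in _ <= X + _]eq_bigr do rewrite addn1.
  rewrite lerDl addr_ge0//; apply: sumr_ge0 => i _; first by rewrite sqr_ge0.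
  by rewrite mulr_ge0// mulrn_wge0// autocorr_ge0.
by rewrite lerDl mulr_ge0 ?subr_ge0//; apply: sumr_ge0 => i _; exact: sqr_ge0.
Qed.

Lemma toeplitz_form_ge0 n (F : nat -> R) :
  (forall i, (n <= i)%N -> F i = 0) -> 0 <= toeplitz_form n F F.
Proof.
move=> F0; apply: le_trans (toeplitz_form_gradient F0).
by apply: sumr_ge0 => i _; exact: sqr_ge0.
Qed.

(** A Poincare inequality: [F] vanishes at [n], so each value is a sum of at most [n] increments. *)
Lemma toeplitz_form_coercive n (F : nat -> R) :
  (forall i, (n <= i)%N -> F i = 0) ->
  \sum_(0 <= i < n) F i ^+ 2 <= n%:R ^+ 2 * toeplitz_form n F F.
Proof.
move=> F0; have Q1 := toeplitz_form_gradient F0.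
apply: (@le_trans _ _ (\sum_(0 <= i < n) n%:R * toeplitz_form n F F)); last first.
  by rewrite sumr_const_nat subn0 -(mulr_natl (_ * _)) expr2 mulrA.
rewrite big_nat [leRHS]big_nat; apply: ler_sum => i /andP[_ iN].
have -> : F i = \sum_(i <= j < n) (F j - F j.+1).
  transitivity (- (F n - F i)); first by rewrite (F0 n)// sub0r opprK.
  rewrite -telescope_sumr 1?ltnW// -sumrN.
  by apply: eq_bigr => j _; rewrite opprB.
apply: le_trans (sqr_sum_le _ _) _.
apply: ler_pM => //.
- by apply: sumr_ge0 => j _; rewrite sqr_ge0.
- by rewrite ler_nat size_iota leq_subr.
apply: le_trans Q1; rewrite [leRHS](@big_cat_nat _ _ _ i)//= 1?ltnW// lerDr.
by apply: sumr_ge0 => j _; rewrite sqr_ge0.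
Qed.

Lemma toeplitz_form_definite n (F : nat -> R) : (forall i, (n <= i)%N -> F i = 0) ->
  toeplitz_form n F F <= 0 -> forall i, F i = 0.
Proof.
move=> F0 Qle i; have [/F0//|iN] := leqP n i.
have : F i ^+ 2 <= 0.
  apply: (@le_trans _ _ (\sum_(0 <= i < n) F i ^+ 2)).
    rewrite big_mkord (bigD1 (Ordinal iN))//= lerDl sumr_ge0// => j _.
    exact: sqr_ge0.
  apply: le_trans (toeplitz_form_coercive F0) _.
  by rewrite mulr_ge0_le0// sqr_ge0.
by rewrite le_eqVlt ltNge sqr_ge0 orbF sqrf_eq0 => /eqP.
Qed.

Definition toeplitz_op (n : nat) (F : nat -> R) (i : nat) : R :=
  \sum_(0 <= j < n) toeplitz `|i - j|%N * F j.

Lemma toeplitz_op_form n F G :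
  toeplitz_form n F G = \sum_(0 <= i < n) F i * toeplitz_op n G i.
Proof.
apply: eq_bigr => i _; rewrite mulr_sumr; apply: eq_bigr => j _; ring.
Qed.

Lemma toeplitz_formC n F G : toeplitz_form n F G = toeplitz_form n G F.
Proof.
rewrite /toeplitz_form exchange_big/=; apply: eq_bigr => i _.
by apply: eq_bigr => j _; rewrite distnC (mulrC (F _)).
Qed.

Lemma toeplitz_op_inj n (F : nat -> R) : (forall i, (n <= i)%N -> F i = 0) ->
  (forall i, (i < n)%N -> toeplitz_op n F i = 0) -> forall i, F i = 0.
Proof.
move=> F0 opF; apply: (toeplitz_form_definite F0).
rewrite toeplitz_op_form big_nat big1// => i /andP[_ iN].
by rewrite opF// mulr0.
Qed.

(** A definite form has an invertible matrix. Row vectors act from the left, which agrees with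
    [toeplitz_op] because the matrix is symmetric. *)
Lemma toeplitz_op_surj n (f : nat -> R) : exists g : nat -> R,
  (forall i, (n <= i)%N -> g i = 0) /\
  (forall i, (i < n)%N -> toeplitz_op n g i = f i).
Proof.
pose A := \matrix_(i < n, j < n) toeplitz `|i - j|%N.
have Au : A \in unitmx.
  rewrite -row_free_unit; apply: inj_row_free => v vA.
  pose F i : R := if insub i is Some j then v ord0 j else 0.
  have Fv (j : 'I_n) : F j = v ord0 j.
    by rewrite /F (_ : insub _ = Some j)// (valK j).
  apply/rowP => j; rewrite mxE -Fv; apply: (@toeplitz_op_inj n) => i.
    by rewrite leqNgt => iN; rewrite /F insubN.
  move=> iN; have /rowP/(_ (Ordinal iN)) := vA; rewrite !mxE => <-.
  rewrite /toeplitz_op big_mkord; apply: eq_bigr => k _.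
  by rewrite !mxE Fv mulrC/= distnC.
pose w := (\row_(j < n) f j) *m invmx A.
pose F i : R := if insub i is Some j then w ord0 j else 0.
have Fv (j : 'I_n) : F j = w ord0 j.
  by rewrite /F (_ : insub _ = Some j)// (valK j).
exists F; split => i; first by rewrite leqNgt => iN; rewrite /F insubN.
move=> iN; have /rowP/(_ (Ordinal iN)) : w *m A = \row_(j < n) f j.
  by rewrite mulmxKV.
rewrite !mxE/= => <-; rewrite /toeplitz_op big_mkord; apply: eq_bigr => k _.
by rewrite Fv [A _ _]mxE mulrC/= distnC.
Qed.

End Toeplitz.

(** * The Green function of a symmetric interval *)

Lemma natr_true (R : pzSemiRingType) (b : bool) : b -> b%:R = 1 :> R.
Proof. by move=> ->. Qed.

Lemma natr_false (R : pzSemiRingType) (b : bool) : ~~ b -> b%:R = 0 :> R.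
Proof. by move=> /negbTE ->. Qed.

Section Green.
Context (R : realFieldType) (J : nat -> R) (D : R).
Hypotheses (J_ge0 : forall k, 0 <= J k)
  (J_noninc : forall k l, (0 < k <= l)%N -> J l <= J k)
  (J1 : J 1 = 1)
  (D_ge : forall K, \sum_(1 <= k < K) J k *+ 2 <= D).
Local Notation matA := (toeplitz J D).
Local Notation opA := (toeplitz_op J D).
Local Notation formA := (toeplitz_form J D).

Variables (N : nat) (g : nat -> R).
Local Notation n := N.*2.+1.
Hypothesis g_out : forall i, (n <= i)%N -> g i = 0.
Hypothesis g_green : forall i, (i < n)%N -> opA n g i = (i == N)%:R.

Lemma toeplitz_offdiag_le0 (i j : nat) : (i != j)%N -> matA `|i - j|%N <= 0.
Proof. by move=> ij; rewrite /toeplitz distn_eq0 (negbTE ij) oppr_le0. Qed.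

Lemma green_ge0 i : 0 <= g i.
Proof.
have [/g_out->//|iN] := leqP n i.
pose M (i j : 'I_n) := matA `|i - j|%N.
apply: (@mmatrix_comparison _ _ M (fun j : 'I_n => g j) _ _ _ (Ordinal iN)).
- by move=> k j kj; exact: toeplitz_offdiag_le0.
- move=> v v0 Mv j.
  pose F i : R := if insub i is Some j then v j else 0.
  have Fv (k : 'I_n) : F k = v k by rewrite /F (_ : insub _ = Some k)// (valK k).
  rewrite -Fv; apply: (toeplitz_form_definite J_ge0 J1 D_ge (n:=n)) => //.
    by move=> k; rewrite leqNgt => kn; rewrite /F insubN.
  rewrite /toeplitz_form big_mkord; under eq_bigr do rewrite big_mkord.
  by under eq_bigr do under eq_bigr do rewrite !Fv.
- move=> k; have := g_green (ltn_ord k).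
  by rewrite /toeplitz_op big_mkord => ->; rewrite ler0n.
Qed.

(** A Toeplitz operator commutes with the reversal of the interval and the source sits at its
    centre, so the antisymmetric part of [g] is in the kernel. *)
Lemma green_sym i : (i <= N.*2)%N -> g (N.*2 - i)%N = g i.
Proof.
move=> iN; pose h i := if (i < n)%N then g i - g (N.*2 - i)%N else 0.
suff : h i = 0 by rewrite /h ltnS iN => /eqP; rewrite subr_eq0 => /eqP.
apply: (toeplitz_op_inj J_ge0 J1 D_ge (n := n)) => // [k|k kn].
  by rewrite leqNgt /h => /negbTE ->.
have -> : opA n h k = opA n g k - opA n g (N.*2 - k).
  rewrite [X in _ - X]/toeplitz_op [X in _ - X]big_nat_rev -sumrB.
  rewrite [LHS]big_nat [RHS]big_nat; apply: eq_bigr => j /andP[_ jn].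
  rewrite /h jn mulrBr add0n subSS; congr (_ - matA _ * _); lia.
rewrite !g_green//; last by lia.
by apply/eqP; rewrite subr_eq0; apply/eqP; congr (_%:R); lia.
Qed.

(** Under the reflection about [N + t + 1/2], the first [t.*2.+1] indices have their mirror image
    beyond [N.*2]; the remaining ones form the mirror pairs [N + t - j], [N + t + j.+1]. *)
Lemma sum_reflect (F : nat -> R) (t : nat) : (t < N)%N ->
  \sum_(0 <= y < n) F y = \sum_(0 <= y < t.*2.+1) F y +
   (\sum_(0 <= j < N - t) F (N + t - j)%N +
    \sum_(0 <= j < N - t) F (N + t + j.+1)%N).
Proof.
move=> tN.
rewrite (@big_cat_nat _ _ _ t.*2.+1)//=; last by lia.
congr (_ + _); rewrite (@big_cat_nat _ _ _ (N + t).+1)//=; [|lia|lia].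
congr (_ + _).
  rewrite -[X in index_iota X _]add0n big_addn.
  rewrite (_ : (N + t).+1 - t.*2.+1 = N - t)%N; last by lia.
  rewrite big_nat_rev big_nat [RHS]big_nat.
  by apply: eq_bigr => j jN; congr F; lia.
rewrite -[X in index_iota X _]add0n big_addn.
rewrite (_ : n - (N + t).+1 = N - t)%N; last by lia.
by apply: eq_bigr => j _; congr F; lia.
Qed.

(* Comparison principle for [g - g o s] where [s] is the reflection about
   [N + t + 1/2]: the kernel [matA |i - j| - matA (i + j + 1)] of the
   reflected problem has nonpositive off-diagonal entries since [J] is
   nonincreasing. *)
Lemma green_noninc_lt t : (t < N)%N -> g (N + t).+1 <= g (N + t)%N.
Proof.
move=> tN; have m0 : (0 < N - t)%N by rewrite subn_gt0.
pose M (i j : 'I_(N - t)) := matA `|i - j|%N - matA (i + j).+1.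
pose w (j : 'I_(N - t)) := g (N + t - j)%N - g (N + t + j.+1)%N.
suff /(_ (Ordinal m0)) : forall j, 0 <= w j.
  by rewrite /w /= subn0 addn1 subr_ge0.
apply: (@mmatrix_comparison _ _ M).
- move=> i j; rewrite -(inj_eq val_inj) /= => ij.
  rewrite /M toeplitzS /toeplitz distn_eq0 (negbTE ij) opprK.
  rewrite [leLHS]addrC subr_le0 J_noninc// lt0n distn_eq0 ij/=; lia.
- move=> v v0 Mv j.
  pose F i : R := if insub i is Some j then v j else 0.
  have Fv (k : 'I_(N - t)) : F k = v k.
    by rewrite /F (_ : insub _ = Some k)// (valK k).
  rewrite -Fv; apply: (toeplitz_form_definite J_ge0 J1 D_ge (n:=(N - t)%N)) => //.
    by move=> k; rewrite leqNgt => kn; rewrite /F insubN.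
  (* The reflected kernel exceeds the Toeplitz one by [J (i + j).+1 >= 0], so on nonnegative vectors
     it inherits definiteness. *)
  apply: le_trans Mv.
  rewrite /toeplitz_form big_mkord; apply: ler_sum => i _.
  rewrite big_mkord; apply: ler_sum => k _; rewrite !Fv ler_wpM2r ?mulr_ge0//.
  by rewrite /M toeplitzS opprK lerDl.
- move=> i; have iN := ltn_ord i.
  have i1 : (N + t - i < n)%N by lia.
  have i2 : (N + t + i.+1 < n)%N by lia.
  have := g_green i1; have := g_green i2.
  rewrite [_ == N](_ : _ = false); last by apply/negP; lia.
  rewrite /toeplitz_op !(sum_reflect _ tN) => e2 e1.
  (* Difference of the Green equations at two mirror sites; the one on the right carries no source.
     Mirror pairs assemble into [M]. Each unpaired [y] is closer to [N + t - i] than to its mirror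
     image, so its coefficient is nonpositive. *)
  have -> : \sum_j M i j * w j = (N + t - i == N)%N%:R -
     \sum_(0 <= y < t.*2.+1) (matA `|N + t - i - y|%N -
       matA `|N + t + i.+1 - y|%N) * g y.
    under [X in _ = _ - X]eq_bigr do rewrite mulrBl.
    rewrite sumrB.
    suff : \sum_j M i j * w j =
        (\sum_(0 <= j < N - t) matA `|N + t - i - (N + t - j)%N|%N *
           g (N + t - j)%N +
         \sum_(0 <= j < N - t) matA `|N + t - i - (N + t + j.+1)%N|%N *
           g (N + t + j.+1)%N) -
        (\sum_(0 <= j < N - t) matA `|N + t + i.+1 - (N + t - j)%N|%N *
           g (N + t - j)%N +
         \sum_(0 <= j < N - t) matA `|N + t + i.+1 - (N + t + j.+1)%N|%N *
           g (N + t + j.+1)%N).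
      by move: e1 e2; rewrite mulr0n; lra.
    transitivity (\sum_(0 <= j < N - t) (matA `|i - j|%N - matA (i + j).+1)
      * (g (N + t - j)%N - g (N + t + j.+1)%N)).
      by rewrite big_mkord.
    rewrite -!big_split/= -sumrB big_nat [RHS]big_nat.
    apply: eq_bigr => j /andP[_ jN].
    rewrite (_ : `|N + t - i - (N + t - j)%N|%N = `|i - j|%N); last by lia.
    rewrite (_ : `|N + t + i.+1 - (N + t + j.+1)%N|%N = `|i - j|%N); last by lia.
    rewrite (_ : `|N + t - i - (N + t + j.+1)%N|%N = (i + j).+1%N); last by lia.
    rewrite (_ : `|N + t + i.+1 - (N + t - j)%N|%N = (i + j).+1%N); last by lia.
    ring.
  rewrite addr_ge0 ?ler0n// oppr_ge0 big_nat; apply: sumr_le0 => y /andP[_ yt].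
  rewrite mulr_le0_ge0 ?green_ge0// /toeplitz.
  rewrite ifF; last by apply/negP; lia.
  rewrite ifF; last by apply/negP; lia.
  by rewrite opprK [leLHS]addrC subr_le0 J_noninc//; lia.
Qed.

Lemma green_noninc t s : (t <= s)%N -> g (N + s)%N <= g (N + t)%N.
Proof.
elim: s => [|s IH]; first by rewrite leqn0 => /eqP ->.
rewrite leq_eqVlt => /predU1P[->//|]; rewrite ltnS => /IH; apply: le_trans.
rewrite addnS; have [/green_noninc_lt//|Ns] := ltnP s N.
by rewrite g_out ?green_ge0//; lia.
Qed.


Definition box (l i : nat) : R := (N - l <= i <= N + l)%N%:R.

Definition perimeter (l : nat) : R := formA n (box l) (box l).

Definition jump (l : nat) : R := g (N + l)%N - g (N + l).+1.

Lemma jump_ge0 l : 0 <= jump l.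
Proof. by rewrite /jump subr_ge0 -addnS green_noninc. Qed.

Lemma sum_jump t : \sum_(t <= l < N.+1) jump l = g (N + t)%N.
Proof.
have [tN|Nt] := leqP t N; last by rewrite big_geq// g_out//; lia.
have := telescope_sumr (fun l => - g (N + l)%N) (leqW tN).
rewrite g_out ?oppr0 ?add0r ?opprK; last by lia.
by move=> <-; apply: eq_bigr => l _; rewrite /jump addnS opprK addrC.
Qed.

Lemma green_layers i : (i < n)%N -> g i = \sum_(0 <= l < N.+1) jump l * box l i.
Proof.
move=> iN; pose t := `|N - i|%N.
have -> : g i = g (N + t)%N.
  have [Ni|iN'] := leqP N i; first by congr g; rewrite /t; lia.
  by rewrite -green_sym; [congr g; rewrite /t|]; lia.
rewrite -sum_jump [RHS](@big_cat_nat _ _ _ t)//=; last by rewrite /t; lia.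
rewrite [X in _ = X + _]big_nat [X in _ = X + _]big1 ?add0r; last first.
  move=> l /andP[_ lt]; rewrite /box (_ : (_ <= _ <= _)%N = false) ?mulr0//.
  by apply/negP; rewrite /t in lt; lia.
rewrite big_nat [RHS]big_nat; apply: eq_bigr => l /andP[tl _].
by rewrite /box (_ : (_ <= _ <= _)%N = true) ?mulr1//; rewrite /t in tl; lia.
Qed.

(** The box is enumerated from its right end: [s] is the distance to that end, so a shift by [k] to
    the right leaves the box exactly when [s < k]. *)
Lemma sum_box l (X : nat -> R) : (l <= N)%N ->
  \sum_(0 <= i < n) box l i * X i = \sum_(0 <= s < l.*2.+1) X (N + l - s)%N.
Proof.
move=> lN; rewrite (@big_cat_nat _ _ _ (N - l))//=; last by lia.
rewrite [X in X + _]big_nat [X in X + _]big1 ?add0r; last first.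
  by move=> i iN; rewrite /box natr_false ?mul0r//; lia.
rewrite (@big_cat_nat _ _ _ (N + l).+1)//=; [|lia|lia].
rewrite [X in _ + X]big_nat [X in _ + X]big1 ?addr0; last first.
  by move=> i iN; rewrite /box natr_false ?mul0r//; lia.
rewrite -[(N - l)%N]add0n big_addn (_ : (N + l).+1 - (N - l) = l.*2.+1)%N; last lia.
rewrite big_nat_rev big_nat [RHS]big_nat; apply: eq_bigr => s sl.
by rewrite /box natr_true ?mul1r; [congr X|]; lia.
Qed.

Lemma box_out l i : (l <= N)%N -> (n <= i)%N -> box l i = 0.
Proof. by move=> lN ni; rewrite /box natr_false//; lia. Qed.

(** The left side is the number of sites at distance less than [k] from the right end, at most twice
    the number of those in the right half. Counting over [s <= l] is what lets the later sum over
    [l] produce values of [g]. *)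
Lemma autocorr_box l k : (l <= N)%N ->
  autocorr n (box l) k <= (\sum_(0 <= s < l.+1) (s < k)%N%:R) *+ 2.
Proof.
move=> lN; have -> : autocorr n (box l) k = \sum_(0 <= s < l.*2.+1) (s < k)%N%:R.
  rewrite /autocorr -sumrB.
  under eq_bigr do rewrite expr2 -mulrBr.
  rewrite (sum_box (fun i => box l i - box l (i + k)%N))// big_nat [RHS]big_nat.
  apply: eq_bigr => s sl; rewrite /box natr_true; last by lia.
  have [sk|ks] := ltnP s k; first by rewrite natr_false ?subr0//; lia.
  by rewrite natr_true ?subrr//; lia.
rewrite (@big_cat_nat _ _ _ l.+1)//=; last by lia.
rewrite mulr2n lerD2l -[X in index_iota X l.*2.+1]add0n big_addn.
rewrite (_ : l.*2.+1 - l.+1 = l)%N; last by lia.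
rewrite [leRHS]big_nat_recr//= -[leLHS]addr0 lerD ?ler0n//.
by apply: ler_sum => s _; rewrite ler_nat; lia.
Qed.

(** The jump at the right end of the box already costs [1]. This lower bound later absorbs an
    additive constant of the thermal estimate into the perimeter. *)
Lemma perimeter_ge1 l : (l <= N)%N -> 1 <= perimeter l.
Proof.
move=> lN; apply: le_trans (toeplitz_form_gradient J_ge0 J1 D_ge _); last first.
  by move=> i; exact: box_out.
rewrite big_mkord (bigD1 (Ordinal (_ : N + l < n)%N))//=; first by lia.
move=> ?; rewrite /box natr_true; last by lia.
rewrite natr_false; last by lia.
rewrite subr0 expr1n lerDl; apply: sumr_ge0 => i _; exact: sqr_ge0.
Qed.

Definition green_sum (k : nat) : R := \sum_(0 <= t < k) g (N + t)%N.

(** Exchange the sums: the jumps at levels [l >= s] add up to [g (N + s)]. *)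
Lemma sum_jump_count k :
  \sum_(0 <= l < N.+1) jump l * \sum_(0 <= s < l.+1) (s < k)%N%:R <=
  green_sum k.
Proof.
have -> : \sum_(0 <= l < N.+1) jump l * \sum_(0 <= s < l.+1) (s < k)%N%:R =
    \sum_(0 <= s < N.+1) (s < k)%N%:R * g (N + s)%N.
  transitivity (\sum_(0 <= l < N.+1) \sum_(0 <= s < N.+1 | (s < l.+1)%N)
      (s < k)%N%:R * jump l).
    rewrite big_nat [RHS]big_nat; apply: eq_bigr => l /andP[_ lN].
    rewrite -(big_nat_widen 0 l.+1 N.+1 xpredT)// mulr_sumr.
    by apply: eq_bigr => s _; rewrite mulrC.
  rewrite (exchange_big_dep_nat xpredT)//=.
  apply: eq_bigr => s _; rewrite -mulr_sumr -sum_jump; congr (_ * _).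
  by rewrite [RHS](big_nat_widenl _ 0)//.
have kN : (minn k N.+1 <= N.+1)%N by exact: geq_minr.
rewrite (@big_nat_widen0 _ _ _ _ kN); last first.
  by move=> s /andP[ks sN]; rewrite natr_false ?mul0r//; lia.
rewrite /green_sum (@big_cat_nat _ _ _ (minn k N.+1) 0 k)//= ?geq_minl//.
rewrite -[leLHS]addr0 lerD//; last first.
  by apply: sumr_ge0 => s _; exact: green_ge0.
by apply: ler_sum_nat => s sk;
  rewrite natr_true ?mul1r//; lia.
Qed.

Definition total_perimeter : R := \sum_(0 <= l < N.+1) jump l * perimeter l.

Lemma total_perimeter_le : total_perimeter <=
  (\sum_(1 <= k < n) J k * green_sum k) *+ 4 +
  (D - \sum_(1 <= k < n) J k *+ 2) * green_sum N.+1 *+ 2.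
Proof.
have D0 : 0 <= D - \sum_(1 <= k < n) J k *+ 2 by rewrite subr_ge0.
(* The count over [s < N.+1] is simply [l.+1], written so that [sum_jump_count] handles both terms.
   The factor 4 arises because [autocorr] enters doubled and is at most twice a count; the factor 2
   because a box has at most [2 * l.+1] sites. *)
apply: (@le_trans _ _ (\sum_(0 <= l < N.+1) jump l * (
   (\sum_(1 <= k < n) J k * \sum_(0 <= s < l.+1) (s < k)%N%:R) *+ 4 +
   (D - \sum_(1 <= k < n) J k *+ 2) *
     (\sum_(0 <= s < l.+1) (s < N.+1)%N%:R) *+ 2))).
  apply: ler_sum_nat => l /andP[_ lN].
  apply: ler_wpM2l; first exact: jump_ge0.
  rewrite /perimeter (toeplitz_formE J D (leqnn n)); last first.
    by move=> i; exact: box_out.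
  apply: lerD.
    rewrite -sumrMnl; apply: ler_sum => k _.
    rewrite -mulrnAr; apply: ler_wpM2l => //.
    by rewrite (mulrnA _ 2 2) lerMn2r/= autocorr_box.
  rewrite -mulrnAr; apply: ler_wpM2l => //.
  under eq_bigr do rewrite expr2.
  rewrite sum_box// (eq_big_nat _ _ (F2 := fun=> 1)); last first.
    by move=> s sl; rewrite /box natr_true//; lia.
  rewrite [X in _ <= X *+ _](eq_big_nat _ _ (F2 := fun=> 1)); last first.
    by move=> s sl; rewrite natr_true//; lia.
  by rewrite !sumr_const_nat !subn0 -mulrnA ler_nat; lia.
under eq_bigr do rewrite mulrDr mulrnAr mulr_sumr mulrnAr.
rewrite big_split/= !sumrMnl; apply: lerD; rewrite lerMn2r/=.
  rewrite exchange_big/=; apply: ler_sum => k _.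
  under eq_bigr do rewrite mulrCA.
  by rewrite -mulr_sumr ler_wpM2l// sum_jump_count.
under eq_bigr do rewrite mulrCA.
by rewrite -mulr_sumr ler_wpM2l ?sum_jump_count// -sumrMnl.
Qed.

Definition green_sqr : R := \sum_(0 <= i < n) g i ^+ 2.

Lemma green_sqr_ge0 : 0 <= green_sqr.
Proof. by apply: sumr_ge0 => i _; exact: sqr_ge0. Qed.

Lemma green_sum_le_mul k : green_sum k <= k%:R * g N.
Proof.
rewrite mulr_natl -[k in leRHS]subn0 -sumr_const_nat; apply: ler_sum => t _.
by have := @green_noninc 0 t isT; rewrite addn0.
Qed.

Lemma green_sqr_ge k : \sum_(0 <= t < k) g (N + t)%N ^+ 2 <= green_sqr.
Proof.
rewrite /green_sqr (@big_cat_nat _ _ _ N 0 n)//=; last by lia.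
rewrite -[leLHS]add0r lerD//; first by apply: sumr_ge0 => i _; exact: sqr_ge0.
rewrite -[X in index_iota X n]add0n big_addn (_ : n - N = N.+1)%N; last by lia.
have -> : \sum_(0 <= t < k) g (N + t)%N ^+ 2 =
    \sum_(0 <= t < minn k N.+1) g (N + t)%N ^+ 2.
  apply: big_nat_widen0 => [|t /andP[kt tk]]; first exact: geq_minl.
  by rewrite g_out ?expr0n//; lia.
rewrite (@big_cat_nat _ _ _ (minn k N.+1) 0 N.+1)//= ?geq_minr//.
under [X in _ <= X + _]eq_bigr do rewrite addnC.
by rewrite lerDl; apply: sumr_ge0 => i _; exact: sqr_ge0.
Qed.

Lemma green_sum_sqr k : green_sum k ^+ 2 <= k%:R * green_sqr.
Proof.
apply: le_trans (sqr_sum_le _ _) _; rewrite size_iota subn0 ler_wpM2l//.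
exact: green_sqr_ge.
Qed.

Lemma green_form : formA n g g = g N.
Proof.
rewrite toeplitz_op_form big_mkord (bigD1 (Ordinal (_ : N < n)%N))//=.
  by lia.
move=> Nn; rewrite g_green// eqxx mulr1 big1 ?addr0// => i iN.
by rewrite g_green// (_ : (i == N :> nat) = false) ?mulr0//; exact/negbTE.
Qed.

(** The energy of [g] equals its peak [g N] and dominates the squared increments, so Cauchy-Schwarz
    over [t] steps applies. Consequently [g] stays above half its peak over a distance of order
    [g N]. *)
Lemma green_drop t : (g N - g (N + t)%N) ^+ 2 <= t%:R * g N.
Proof.
have gN : 0 <= g N by exact: green_ge0.
have -> : g N - g (N + t)%N = \sum_(N <= i < N + t) (g i - g i.+1).
  rewrite -[LHS]opprB -telescope_sumr ?leq_addr// -sumrN.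
  by apply: eq_bigr => i _; rewrite opprB.
apply: le_trans (sqr_sum_le _ _) _; rewrite size_iota addKn ler_wpM2l//.
rewrite -green_form.
apply: le_trans (toeplitz_form_gradient J_ge0 J1 D_ge g_out).
have [tN|Nt] := leqP (N + t)%N n.
  rewrite [leRHS](@big_cat_nat _ _ _ N 0 n)//= ?(leq_trans (leq_addr _ _) tN)//.
  rewrite [X in _ + X](@big_cat_nat _ _ _ (N + t))//= ?leq_addr//.
  rewrite -[leLHS]add0r lerD// ?lerDl; by apply: sumr_ge0 => i _; exact: sqr_ge0.
rewrite [leRHS](@big_cat_nat _ _ _ N 0 n)//=; last by lia.
rewrite (@big_cat_nat _ _ _ n N)//=; [|lia|lia].
rewrite [X in _ + X]big_nat [X in _ + X]big1 ?addr0; last first.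
  by move=> i /andP[ni _]; rewrite !g_out ?subrr ?expr0n//; lia.
by rewrite lerDr; apply: sumr_ge0 => i _; exact: sqr_ge0.
Qed.


(** Value, at the peak of a tent of height [h] on the whole line, of the Toeplitz operator applied
    to that tent. *)
Definition tent_bound (h : nat) : R :=
  D * h%:R - (\sum_(1 <= k < h) J k * (h - k)%N%:R) *+ 2.

Lemma tent_bound_le h L : (h <= L)%N -> tent_bound h <= tent_bound L.
Proof.
elim: L => [|L IH]; first by rewrite leqn0 => /eqP ->.
rewrite leq_eqVlt => /predU1P[->//|]; rewrite ltnS => /IH/le_trans; apply.
case: L {IH} => [|L]; first by rewrite /tent_bound !big_geq// !mul0rn !subr0
  ler_wpM2l ?ler_nat//; have := D_ge 0; rewrite big_geq ?mul0rn.
rewrite -subr_ge0.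
suff -> : tent_bound L.+2 - tent_bound L.+1 =
    D - \sum_(1 <= k < L.+2) J k *+ 2 by rewrite subr_ge0.
rewrite /tent_bound.
rewrite [in RHS](big_nat_recr L.+1)//= [in LHS](big_nat_recr L.+1)//=.
rewrite subSnn mulr1.
have -> : \sum_(1 <= k < L.+1) J k * (L.+2 - k)%N%:R =
    \sum_(1 <= k < L.+1) J k * (L.+1 - k)%N%:R + \sum_(1 <= k < L.+1) J k.
  rewrite -big_split/= big_nat [RHS]big_nat; apply: eq_bigr => k /andP[_ kL].
  by rewrite subSn 1?ltnW// -natr1 mulrDr mulr1.
rewrite sumrMnl -[L.+2%:R]natr1; ring.
Qed.

Definition tent (L i : nat) : R := (L - `|i - N|)%N%:R.

(** A tent has slope at most one: around a point where its height is [h], its value at distance [k]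
    is at least [h - k], so a tent of height [h] peaked there lies below it. Off the support only
    nonpositive terms remain. *)
Lemma tent_op L x : (L <= N)%N -> (x < n)%N ->
  opA n (tent L) x <= (`|x - N| < L)%N%:R * tent_bound L.
Proof.
move=> LN xn; pose h := (L - `|x - N|)%N.
have T0 i : 0 <= tent L i by rewrite ler0n.
have op : opA n (tent L) x = D * h%:R -
    (\sum_(0 <= y < x) J (x - y)%N * tent L y +
     \sum_(x.+1 <= y < n) J (y - x)%N * tent L y).
  rewrite /toeplitz_op (@big_cat_nat _ _ _ x)//= 1?ltnW//.
  rewrite [X in _ + X]big_ltn// distnn {2}/toeplitz eqxx addrCA opprD.
  congr (_ + (_ + _)); rewrite -sumrN big_nat [RHS]big_nat; apply: eq_bigr => y yx.
    by rewrite /toeplitz ifN ?mulNr; [congr (- (J _ * _))|]; lia.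
  by rewrite /toeplitz ifN ?mulNr; [congr (- (J _ * _))|]; lia.
rewrite op; have [xL|Lx] := ltnP; last first.
  rewrite /h (_ : L - _ = 0)%N; last by lia.
  rewrite mulr0 mul0r sub0r oppr_le0 addr_ge0//;
    by apply: sumr_ge0 => y _; rewrite mulr_ge0.
rewrite mul1r; apply: le_trans (@tent_bound_le h L _); last by rewrite /h; lia.
rewrite /tent_bound lerD2l lerN2 mulr2n; apply: lerD.
  rewrite [leRHS](@big_cat_nat _ _ _ (x.+1 - h))//=; last by rewrite /h; lia.
  rewrite -[leLHS]add0r lerD//; first by apply: sumr_ge0 => y _; rewrite mulr_ge0.
  rewrite -[X in index_iota X x]add0n big_addn big_nat_rev/=.
  rewrite -[X in index_iota X h]add0n big_addn.
  rewrite (_ : x - (x.+1 - h) = h - 1)%N; last by rewrite /h; lia.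
  apply: ler_sum_nat => k kh.
  rewrite (_ : 1 + h - (k + 1).+1 = x - (k + (x.+1 - h)))%N; last first.
    by rewrite /h in kh *; lia.
  by rewrite ler_wpM2l// ler_nat; rewrite /h in kh *; lia.
rewrite [leRHS](@big_cat_nat _ _ _ (x + h))//=; [|rewrite /h; lia|rewrite /h; lia].
rewrite -[leLHS]addr0 lerD//; last by apply: sumr_ge0 => y _; rewrite mulr_ge0.
rewrite -[X in index_iota X (x + h)]add0n big_addn.
rewrite -[X in index_iota X h]add0n big_addn.
rewrite (_ : x + h - x.+1 = h - 1)%N; last by lia.
apply: ler_sum_nat => k kh.
rewrite (_ : k + x.+1 - x = k + 1)%N; last by lia.
by rewrite ler_wpM2l// ler_nat; rewrite /h in kh *; lia.
Qed.

(* Testing the Green function against a tent of height [L]. *)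
Lemma green_sqr_lower L : (0 < L <= N)%N ->
  L%:R <= tent_bound L ^+ 2 * green_sqr *+ 2.
Proof.
move=> /andP[L0 LN].
have form : formA n g (tent L) = L%:R.
  rewrite toeplitz_formC toeplitz_op_form.
  rewrite big_mkord (bigD1 (Ordinal (_ : N < n)%N))//=; first by lia.
  move=> Nn; rewrite g_green// eqxx mulr1 big1 ?addr0.
    by rewrite /tent distnn subn0.
  move=> i iN.
  by rewrite g_green// (_ : (i == N :> nat) = false) ?mulr0//; exact/negbTE.
have tb0 : 0 <= tent_bound L.
  by rewrite -[leLHS](_ : tent_bound 0 = 0) ?tent_bound_le// /tent_bound
    big_geq// mulr0 mul0rn subr0.
(* The mass of [g] under the tent. The factor [1] is the second function of the weighted
   Cauchy-Schwarz inequality; the support has fewer than [L.*2] sites, and one factor [L] cancels at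
   the end. *)
pose S := \sum_(0 <= x < n) (`|x - N| < L)%N%:R * (g x * 1).
have LS : L%:R <= tent_bound L * S.
  rewrite -form toeplitz_op_form /S mulr_sumr.
  apply: ler_sum_nat => x /andP[_ xn].
  have -> : tent_bound L * ((`|x - N| < L)%N%:R * (g x * 1)) =
    g x * ((`|x - N| < L)%N%:R * tent_bound L) by ring.
  by rewrite ler_wpM2l ?green_ge0// tent_op.
have S2 : S ^+ 2 <= green_sqr * (L.*2)%:R.
  apply: le_trans (cauchy_schwarz_weighted _ _ _ _) _ => [i|].
    by rewrite ler0n.
  apply: ler_pM; do ?[by apply: sumr_ge0 => i _; rewrite mulr_ge0 ?sqr_ge0].
    by apply: ler_sum => i _; case: ltnP => _; rewrite ?mul1r// mul0r sqr_ge0.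
  have -> : \sum_(0 <= i < n) (`|i - N| < L)%N%:R * 1 ^+ 2 =
      \sum_(0 <= i < n) box L.-1 i * 1.
    apply: eq_bigr => i _; rewrite expr1n /box; congr (_%:R * _).
    by congr nat_of_bool; lia.
  rewrite (sum_box (fun=> 1)); last by lia.
  by rewrite sumr_const_nat subn0 ler_nat; lia.
have : L%:R ^+ 2 <= tent_bound L ^+ 2 * (green_sqr * (L.*2)%:R).
  apply: le_trans (_ : (tent_bound L * S) ^+ 2 <= _).
    by rewrite lerXn2r ?nnegrE ?ler0n// (le_trans _ LS).
  by rewrite exprMn ler_wpM2l ?sqr_ge0.
have Lp : 0 < L%:R :> R by rewrite ltr0n.
rewrite -muln2 natrM expr2.
rewrite (_ : _ ^+ 2 * _ = tent_bound L ^+ 2 * green_sqr *+ 2 * L%:R); last by ring.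
by rewrite ler_pM2r.
Qed.

End Green.

(** * Negligibility of the peak and of the total perimeter of the Green function *)

Section GreenAsymptotics.
Context (R : realType) (J : nat -> R) (D Q : R).
Hypotheses (J_ge0 : forall k, 0 <= J k)
  (J_noninc : forall k l, (0 < k <= l)%N -> J l <= J k)
  (J1 : J 1 = 1)
  (D_ge : forall K, \sum_(1 <= k < K) J k *+ 2 <= D)
  (D_le : forall e : R, 0 < e -> exists K, D - \sum_(1 <= k < K) J k *+ 2 <= e)
  (Q_ge : forall K, \sum_(1 <= k < K) J k * Num.sqrt k%:R <= Q)
  (Q_le : forall e : R, 0 < e ->
     exists K, Q - \sum_(1 <= k < K) J k * Num.sqrt k%:R <= e).

Definition sqrt_tail (K : nat) : R :=
  Q - \sum_(1 <= k < K) J k * Num.sqrt k%:R.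

Lemma sqrt_tail_ge0 K : 0 <= sqrt_tail K.
Proof. by rewrite subr_ge0. Qed.

Lemma sqrt_tail_split K L : (0 < K <= L)%N ->
  sqrt_tail K = \sum_(K <= k < L) J k * Num.sqrt k%:R + sqrt_tail L.
Proof.
move=> /andP[K0 KL]; rewrite /sqrt_tail (@big_cat_nat _ _ _ K 1 L)//=; lra.
Qed.

(** For [k >= K] one has [sqrt K <= sqrt k]. The tail of [D] is first cut at a far [L], leaving a
    remainder of size [e]. *)
Lemma toeplitz_tail_le K : (0 < K)%N ->
  (D - \sum_(1 <= k < K) J k *+ 2) * Num.sqrt K%:R <= sqrt_tail K *+ 2.
Proof.
move=> K0; apply/ler_addgt0Pr => e e0.
have sK : 0 < Num.sqrt K%:R :> R by rewrite sqrtr_gt0 ltr0n.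
have [L0 HL0] := D_le (divr_gt0 e0 sK).
pose L := maxn L0 K.
have HL : D - \sum_(1 <= k < L) J k *+ 2 <= e / Num.sqrt K%:R.
  apply: le_trans HL0; rewrite lerD2l lerN2.
  have [L00|L01] := posnP L0.
    by rewrite L00 big_geq//; apply: sumr_ge0 => k _; rewrite mulrn_wge0.
  rewrite [leRHS](@big_cat_nat _ _ _ L0)//= ?leq_maxl// lerDl.
  by apply: sumr_ge0 => k _; rewrite mulrn_wge0.
have KL : (K <= L)%N by rewrite leq_maxr.
rewrite (sqrt_tail_split (L := L)) ?K0// mulrnDl.
have -> : D - \sum_(1 <= k < K) J k *+ 2 =
  \sum_(K <= k < L) J k *+ 2 + (D - \sum_(1 <= k < L) J k *+ 2).
  rewrite [in RHS](@big_cat_nat _ _ _ K 1 L)//=; lra.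
rewrite mulrDl addrAC -[leRHS]addrA; apply: lerD; last first.
  apply: le_trans (_ : e <= _); last by rewrite lerDl mulrn_wge0// sqrt_tail_ge0.
  by rewrite -ler_pdivlMr.
rewrite -sumrMnl mulr_suml; apply: ler_sum_nat => k /andP[Kk _].
by rewrite mulrnAl lerMn2r/= ler_wpM2l// ler_wsqrtr// ler_nat.
Qed.

(** Distances below [K] give a constant; between [K] and [L], [k <= sqrt L * sqrt k]; beyond [L],
    [toeplitz_tail_le] applies. Thus [tent_bound L] is a constant plus a small multiple of
    [sqrt L]. *)
Lemma tent_bound_sqrt K L : (0 < K <= L)%N ->
  tent_bound J D L <= (\sum_(1 <= k < K) J k * k%:R) *+ 2 +
    Num.sqrt L%:R * sqrt_tail K *+ 2.
Proof.
move=> /andP[K0 KL]; have L0 : (0 < L)%N := leq_trans K0 KL.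
have -> : tent_bound J D L = (\sum_(1 <= k < L) J k * k%:R) *+ 2 +
    (D - \sum_(1 <= k < L) J k *+ 2) * L%:R.
  rewrite /tent_bound mulrBl sumrMnl.
  have -> : \sum_(1 <= k < L) J k * (L - k)%N%:R =
      (\sum_(1 <= k < L) J k) * L%:R - \sum_(1 <= k < L) J k * k%:R.
    rewrite mulr_suml -sumrB big_nat [RHS]big_nat; apply: eq_bigr => k kL.
    by rewrite natrB ?mulrBr//; lia.
  ring.
rewrite (@big_cat_nat _ _ _ K 1 L)//= mulrnDl -addrA lerD2l.
rewrite (sqrt_tail_split (L := L)) ?K0// mulrDr mulrnDl; apply: lerD.
  rewrite lerMn2r/= mulr_sumr; apply: ler_sum_nat => k /andP[_ kL].
  rewrite mulrCA ler_wpM2l// -[leLHS](@sqr_sqrtr _ k%:R)// expr2.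
  by rewrite ler_wpM2r ?sqrtr_ge0// ler_wsqrtr// ler_nat ltnW.
rewrite -[in leLHS](@sqr_sqrtr _ L%:R)// expr2 mulrA mulrC -mulrnAr.
by rewrite ler_wpM2l ?sqrtr_ge0// toeplitz_tail_le.
Qed.

Lemma sqrt_tail_small (e : R) : 0 < e -> exists K, (0 < K)%N /\ sqrt_tail K <= e.
Proof.
move=> /Q_le[[|K] HK]; last by exists K.+1.
by exists 1%N; split=> //; apply: le_trans HK; rewrite /sqrt_tail !big_geq.
Qed.

Lemma tent_bound_small (e : R) : 0 < e -> exists L0, (0 < L0)%N /\ forall L,
  (L0 <= L)%N -> tent_bound J D L ^+ 2 <= e * L%:R.
Proof.
move=> e0; have s0 : 0 < Num.sqrt e / 4 by rewrite divr_gt0// sqrtr_gt0.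
have [K [K0 HK]] := sqrt_tail_small s0.
pose C := (\sum_(1 <= k < K) J k * k%:R) *+ 2.
have C0 : 0 <= C by rewrite mulrn_wge0//; apply: sumr_ge0 => k _; rewrite mulr_ge0.
(* For [L >= m] the constant [C] takes at most half of [sqrt (e * L)]; the choice of [K] leaves the
   other half to the tail. *)
pose m := Num.Def.archi_bound (C ^+ 2 * 4 / e).
exists (K + m)%N; split => [|L mL]; first by rewrite addn_gt0 K0.
have mL' : C ^+ 2 * 4 <= e * L%:R.
  rewrite [leRHS]mulrC -ler_pdivrMr// (le_trans (ltW (archi_boundP _)))//.
    by apply: divr_ge0; [rewrite mulr_ge0 ?sqr_ge0|exact: ltW].
  by rewrite ler_nat (leq_trans _ mL)// leq_addl.
have KL : (K <= L)%N by rewrite (leq_trans _ mL)// leq_addr.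
have eL : 0 <= e * L%:R by rewrite mulr_ge0// ltW.
rewrite -[leRHS](sqr_sqrtr eL) lerXn2r ?nnegrE ?sqrtr_ge0//.
  rewrite -[leLHS](_ : tent_bound J D 0 = 0) ?tent_bound_le//.
  by rewrite /tent_bound big_geq// mulr0 mul0rn subr0.
apply: le_trans (tent_bound_sqrt (K := K) _) _; first by rewrite K0 KL.
rewrite -/C.
have CL : C *+ 2 <= Num.sqrt (e * L%:R).
  have C2 : 0 <= C *+ 2 by rewrite mulrn_wge0.
  rewrite -(ger0_norm C2) -sqrtr_sqr ler_wsqrtr//; apply: le_trans mL'.
  by rewrite le_eqVlt; apply/orP; left; apply/eqP; ring.
have : Num.sqrt L%:R * sqrt_tail K *+ 4 <= Num.sqrt (e * L%:R).
  rewrite sqrtrM ?(ltW e0)// [leRHS]mulrC -mulrnAr ler_wpM2l ?sqrtr_ge0//.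
  by rewrite -mulr_natr -ler_pdivlMr.
lra.
Qed.

Lemma green_asymptotics (e : R) : 0 < e -> exists N0, forall N g, (N0 <= N)%N ->
  (forall i, (N.*2.+1 <= i)%N -> g i = 0) ->
  (forall i, (i < N.*2.+1)%N ->
    toeplitz_op J D N.*2.+1 g i = (i == N)%:R) ->
  total_perimeter J D N g ^+ 2 <= e * green_sqr N g /\
  g N ^+ 2 <= e * green_sqr N g.
Proof.
(* Dichotomy on the peak. If [g N >= 4 K], then [green_drop] keeps [g] above [g N / 2] on [K] sites,
   so the squared norm is at least [K * g N ^+ 2 / 4]. Otherwise the peak is bounded, while the tent
   estimate makes the squared norm large. *)
have diag (e' : R) : 0 < e' -> exists N0, forall N g, (N0 <= N)%N ->
    (forall i, (N.*2.+1 <= i)%N -> g i = 0) ->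
    (forall i, (i < N.*2.+1)%N ->
      toeplitz_op J D N.*2.+1 g i = (i == N)%:R) ->
    g N ^+ 2 <= e' * green_sqr N g.
  move=> e0; pose K := (Num.Def.archi_bound (4 / e')).+1.
  have HK : 4 <= e' * K%:R.
    rewrite [leRHS]mulrC -ler_pdivrMr// (le_trans (ltW (archi_boundP _)))//.
      by rewrite divr_ge0 ?ltW.
    by rewrite ler_nat.
  (* With [L = N] in [green_sqr_lower], this value makes [e'] times the squared norm at least
     [16 K ^+ 2], the bound on the squared peak in the second case. *)
  have e1 : 0 < e' / (32 * K%:R ^+ 2) by rewrite divr_gt0// mulr_gt0// exprn_gt0.
  have [L0 [L00 HL0]] := tent_bound_small e1.
  exists (K + L0)%N => N g N0N g0 gG.
  have gN0 : 0 <= g N by exact: (green_ge0 J_ge0 J1 D_ge g0 gG).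
  have [gK|Kg] := leP (K%:R *+ 4) (g N).
    have gt t : (t < K)%N -> g N ^+ 2 / 4 <= g (N + t)%N ^+ 2.
      move=> tK.
      have := green_drop J_ge0 J1 D_ge g0 gG t.
      have := green_ge0 J_ge0 J1 D_ge g0 gG (N + t).
      have : t%:R <= K%:R :> R by rewrite ler_nat ltnW.
      move: (g N) (g (N + t)%N) (t%:R) gK gN0 => a b u; rewrite -mulr_natr.
      move: (K%:R) => k ka a0 uk b0 dab.
      have : u * a <= a ^+ 2 / 4 by nra.
      move=> /(le_trans dab) {}dab.
      suff : a / 2 <= b by nra.
      by rewrite leNgt; apply/negP => bb; nra.
    have : K%:R * (g N ^+ 2 / 4) <= green_sqr N g.
      apply: le_trans (green_sqr_ge g0 K).
      rewrite mulr_natl -[K in leLHS]subn0 -sumr_const_nat.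
      by apply: ler_sum_nat => t /gt.
    move=> /(ler_wpM2l (ltW e0)); apply: le_trans.
    have := sqr_ge0 (g N); move: (g N ^+ 2) => a a0.
    by rewrite mulrA; nra.
  apply: (@le_trans _ _ (K%:R ^+ 2 *+ 16)).
    rewrite -(mulr_natr (_ ^+ 2)) (_ : 16 = 4 ^+ 2); last by ring.
    by rewrite -exprMn lerXn2r ?nnegrE ?mulr_ge0// mulr_natr ltW.
  have N0 : (0 < N <= N)%N by rewrite leqnn andbT (leq_trans _ N0N)// addn_gt0 L00 orbT.
  have Np : 0 < N%:R :> R by rewrite ltr0n; case/andP: N0.
  have := green_sqr_lower J_ge0 J1 D_ge g0 gG N0.
  have LN : (L0 <= N)%N by rewrite (leq_trans _ N0N)// leq_addl.
  move=> /le_trans-/(_ (e' / (32 * K%:R ^+ 2) * N%:R * green_sqr N g *+ 2)).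
  rewrite lerMn2r/= ler_wpM2r ?green_sqr_ge0 ?HL0// => /(_ isT).
  rewrite mulrAC -mulrnAl -[leLHS]mul1r ler_pM2r//.
  have K2 : 0 < K%:R ^+ 2 :> R by rewrite exprn_gt0.
  move: (green_sqr N g) => G H.
  have {H} := ler_wpM2l (mulr_ge0 (ler0n R 16) (ltW K2)) H.
  rewrite mulr1 mulrC mulr_natr => /le_trans; apply.
  by rewrite le_eqVlt; apply/orP; left; apply/eqP; field; rewrite gt_eqF.
move=> e0.
(* Distances below [K] are bounded by [k * g N], larger ones by [sqrt k] times the norm. Each group,
   after the factor 4 of [total_perimeter_le], may use half of [sqrt e] times the norm: hence 8 here
   and its square 64 below. [C + 1] rather than [C] avoids a zero denominator. *)
have s0 : 0 < Num.sqrt e / 8 by rewrite divr_gt0// sqrtr_gt0.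
have [K [K0 HK]] := sqrt_tail_small s0.
pose C := \sum_(1 <= k < K) J k * k%:R.
have C0 : 0 <= C by apply: sumr_ge0 => k _; rewrite mulr_ge0.
have C1 : 1 <= 64 * (C + 1) ^+ 2.
  by nra.
have e1 : 0 < e / (64 * (C + 1) ^+ 2).
  by rewrite divr_gt0// (lt_le_trans _ C1).
have [N0 HN0] := diag _ e1.
exists (K + N0)%N => N g NN g0 gG.
have NN0 : (N0 <= N)%N by rewrite (leq_trans _ NN)// leq_addl.
have NK : (K <= N)%N by rewrite (leq_trans _ NN)// leq_addr.
have gN := HN0 _ _ NN0 g0 gG.
have gN0 : 0 <= g N by exact: (green_ge0 J_ge0 J1 D_ge g0 gG).
have G0 := green_sqr_ge0 N g.
split; last first.
  apply: (le_trans gN); rewrite ler_wpM2r//.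
  by rewrite ler_pdivrMr ?(lt_le_trans _ C1)// ler_peMr// ltW.
pose s := Num.sqrt (green_sqr N g).
have s_ge0 : 0 <= s by exact: sqrtr_ge0.
have ss : s ^+ 2 = green_sqr N g by rewrite sqr_sqrtr.
have green_sum_s k : green_sum N g k <= Num.sqrt k%:R * s.
  have gs0 : 0 <= green_sum N g k.
    by apply: sumr_ge0 => i _; exact: (green_ge0 J_ge0 J1 D_ge g0 gG).
  rewrite -(ger0_norm gs0) -sqrtr_sqr /s -sqrtrM// ler_wsqrtr//.
  exact: (green_sum_sqr g0).
have gNs : g N <= Num.sqrt e * s / (8 * (C + 1)).
  have C80 : 0 <= 8 * (C + 1) by rewrite mulr_ge0// addr_ge0.
  have r0 : 0 <= Num.sqrt e * s / (8 * (C + 1)).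
    by rewrite divr_ge0// mulr_ge0// sqrtr_ge0.
  rewrite -ler_sqr ?nnegrE// (le_trans gN)// expr_div_n !exprMn ss.
  rewrite sqr_sqrtr ?(ltW e0)// le_eqVlt; apply/orP; left; apply/eqP.
  by field; rewrite gt_eqF// ltr_wpDl.
have D0 K' : 0 <= D - \sum_(1 <= k < K') J k *+ 2 by rewrite subr_ge0.
have T0 : 0 <= total_perimeter J D N g.
  rewrite /total_perimeter big_nat; apply: sumr_ge0 => l /andP[_ lN]; rewrite mulr_ge0//.
    exact: (jump_ge0 J_ge0 J_noninc J1 D_ge g0 gG).
  apply: (toeplitz_form_ge0 J_ge0 J1 D_ge) => i; exact: box_out.
have Ts : total_perimeter J D N g <= Num.sqrt e * s.
  have Nn : (N.+1 <= N.*2.+1)%N by rewrite ltnS -addnn leq_addr.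
  have KN : (K <= N.*2.+1)%N by rewrite (leq_trans NK)// ltnW.
  have n0 : (0 < N.*2.+1)%N by [].
  apply: le_trans (total_perimeter_le J_ge0 J_noninc J1 D_ge g0 gG) _.
  move: (N.*2.+1) n0 Nn KN => n n0 Nn KN.
  have t1 : \sum_(1 <= k < n) J k * green_sum N g k <=
      C * g N + s * \sum_(K <= k < n) J k * Num.sqrt k%:R.
    rewrite (@big_cat_nat _ _ _ K)//=.
    rewrite mulr_sumr mulr_suml; apply: lerD; apply: ler_sum => k _.
      by rewrite -mulrA ler_wpM2l// (green_sum_le_mul J_ge0 J_noninc J1 D_ge g0 gG).
    by rewrite mulrCA ler_wpM2l// mulrC.
  have t2 : (D - \sum_(1 <= k < n) J k *+ 2) * green_sum N g N.+1 <=
      s * sqrt_tail n *+ 2.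
    apply: (@le_trans _ _ ((D - \sum_(1 <= k < n) J k *+ 2) *
        (Num.sqrt n%:R * s))).
      rewrite ler_wpM2l// (le_trans (green_sum_s _))// ler_wpM2r//.
      by rewrite ler_wsqrtr// ler_nat.
    by rewrite mulrA mulrC -mulrnAr ler_wpM2l// toeplitz_tail_le.
  have := @sqrt_tail_split K n; rewrite K0 KN => /(_ isT).
  have : C * g N <= Num.sqrt e * s / 8.
    have := ler_wpM2l C0 gNs; move/le_trans; apply.
    have CC : C / (C + 1) <= 1 by rewrite ler_pdivrMr; lra.
    have es0 : 0 <= Num.sqrt e * s / 8 by rewrite divr_ge0// mulr_ge0// sqrtr_ge0.
    have := ler_wpM2r es0 CC; rewrite mul1r; apply: le_trans.
    by rewrite le_eqVlt; apply/orP; left; apply/eqP; field; lra.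
  have : s * sqrt_tail K <= Num.sqrt e * s / 8.
    by rewrite mulrAC mulrC ler_wpM2r.
  rewrite -(mulr_natr (_ * _)) in t2.
  move: (\sum_(K <= k < _) _) t1 => X t1 b1 b2 b3; rewrite b3 in b1.
  lra.
by rewrite -ss -[e in leRHS]sqr_sqrtr ?(ltW e0)// -exprMn lerXn2r// nnegrE
  mulr_ge0 ?sqrtr_ge0.
Qed.

End GreenAsymptotics.

(** * A central limit theorem for weighted sums *)

Section Taylor.
Context {R : realType}.

Lemma is_derive_continuous (f : R -> R) (x d : R) :
  is_derive x (1 : R) f d -> {for x, continuous f}.
Proof. by move=> [fd _]; apply/differentiable_continuous/derivable1_diffP. Qed.

Lemma derive_le_itv (h dh : R -> R) (u v B : R) : u <= v ->
  (forall t, u <= t <= v -> is_derive t (1 : R) h (dh t)) ->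
  (forall t, u <= t <= v -> `|dh t| <= B) -> `|h v - h u| <= B * (v - u).
Proof.
move=> uv hd dB.
have [t tuv|t|c cuv ->] := @MVT_segment R h dh u v uv.
- apply: hd; move: tuv; rewrite in_itv/= => /andP[ut tv].
  by rewrite !ltW.
- apply: derivable_within_continuous => {}t tuv.
  have : u <= t <= v by move: tuv; rewrite in_itv.
  by move=> /hd[].
rewrite normrM (ger0_norm (_ : 0 <= v - u)) ?subr_ge0// ler_wpM2r ?subr_ge0//.
by apply: dB; move: cuv; rewrite in_itv.
Qed.

Lemma derive_le (h dh : R -> R) (a B y : R) :
  (forall t, is_derive t (1 : R) h (dh t)) ->
  (forall t, `|t| <= a -> `|dh t| <= B) -> `|y| <= a ->
  `|h y - h 0| <= B * `|y|.
Proof.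
move=> hd dB ya; have [y0|y0] := leP 0 y.
  rewrite (_ : `|y| = y - 0); last by rewrite subr0 ger0_norm.
  apply: (derive_le_itv y0) => // t /andP[t0 ty].
  by apply: dB; apply: le_trans ya; rewrite !ger0_norm.
rewrite distrC (_ : `|y| = 0 - y); last by rewrite sub0r ltr0_norm.
apply: (derive_le_itv (ltW y0)) => // t /andP[t0 ty].
by apply: dB; apply: le_trans ya; rewrite !ler0_norm ?lerN2// ltW.
Qed.

(** The mean value inequality applied twice, to the remainder and to its derivative. Assuming a
    bound on the oscillation of [f2] serves both a bounded and a Lipschitz [f2]. *)
Lemma taylor2_le (f f1 f2 : R -> R) (x y B : R) :
  (forall t, is_derive t (1 : R) f (f1 t)) ->
  (forall t, is_derive t (1 : R) f1 (f2 t)) ->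
  (forall t, `|t| <= `|y| -> `|f2 (x + t) - f2 x| <= B) ->
  `|f (x + y) - f x - y * f1 x - y ^+ 2 / 2 * f2 x| <= B * y ^+ 2.
Proof.
move=> fd f1d fB.
have sh (g g' : R -> R) t : (forall t, is_derive t (1 : R) g (g' t)) ->
    is_derive t (1 : R) (fun t => g (x + t)) (g' (x + t)).
  move=> gd; have gt := gd (x + t).
  have st : is_derive t (1 : R) (fun t : R => x + t) 1.
    by apply: is_derive_eq; ring.
  by have := is_derive1_comp gt st; rewrite mulr1; apply.
pose h1 t := f1 (x + t) - f1 x - t * f2 x.
pose h t := f (x + t) - f x - t * f1 x - t ^+ 2 / 2 * f2 x.
have h1d t : is_derive t (1 : R) h1 (f2 (x + t) - f2 x).
  have s := sh _ _ t f1d.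
  apply: is_derive_eq; rewrite /GRing.scale/=; ring.
have hd t : is_derive t (1 : R) h (h1 t).
  have s := sh _ _ t fd.
  apply: is_derive_eq; rewrite /h1 /GRing.scale/=. by field.
have h10 : h1 0 = 0 by rewrite /h1 addr0; ring.
have h00 : h 0 = 0 by rewrite /h addr0; ring.
have B0 : 0 <= B.
  by apply: le_trans (fB 0 _); rewrite ?normr0.
suff : `|h y - h 0| <= B * `|y| * `|y|.
  by rewrite h00 subr0 -mulrA -expr2 real_normK ?num_real.
apply: (derive_le (a := `|y|) hd) => // t ty.
rewrite -[h1 t]subr0 -h10; apply: le_trans (_ : B * `|t| <= _); last first.
  by rewrite ler_wpM2l.
apply: (derive_le (a := `|t|) h1d) => // u ut; exact: fB (le_trans ut ty).
Qed.

End Taylor.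

(** * The Gaussian distribution function and the heat equation *)

Section Heat.
Context {R : realType}.
Local Notation gauss := (@normal_pdf R 0 1).

Definition gauss_cdf (x : R) : R := fine (normal_prob (0 : R) 1 `]-oo, x]).

Lemma gaussE (x : R) :
  gauss x = normal_peak 1 * expR (- (x ^+ 2 / 2)).
Proof.
by rewrite normal_pdfE ?oner_neq0// /normal_fun subr0 expr1n mulNr.
Qed.

Lemma gauss_cdf_ge0 x : 0 <= gauss_cdf x.
Proof. by apply: fine_ge0. Qed.

Lemma gauss_cdf_le1 x : gauss_cdf x <= 1.
Proof.
rewrite -lee_fin /gauss_cdf fineK ?fin_num_measure//.
by apply: probability_le1.
Qed.

Lemma gauss_cdfE x : normal_prob (0 : R) 1 `]-oo, x] = (gauss_cdf x)%:E.
Proof. by rewrite /gauss_cdf fineK ?fin_num_measure. Qed.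

Lemma is_derive_gauss_cdf (x : R) : is_derive x (1 : R) gauss_cdf (gauss x).
Proof.
have xx1 : x < x + 1 by rewrite ltrDl.
have i : lebesgue_measure.-integrable [set` `]-oo, x + 1]] (EFin \o gauss).
  by apply: (integrableS _ _ (@subsetT _ _)) => //; exact: integrable_normal_pdf.
have c : {for x, continuous gauss}.
  by apply: continuous_normal_pdf; rewrite oner_neq0.
have [d e] := continuous_FTC1 xx1 i (ltNyr _) c.
split; first exact: d.
by rewrite -e derive1E.
Qed.

Lemma is_derive_gauss (x : R) : is_derive x (1 : R) gauss (- (x * gauss x)).
Proof.
have -> : gauss = fun x => normal_peak 1 * expR (- (x ^+ 2 / 2)).
  by apply/funext => y; exact: gaussE.
by apply: is_derive_eq; rewrite /GRing.scale/=; field.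
Qed.

(** With [u = z ^+ 2], the exponential of [u / 2] is at least [(1 + u / 4) ^+ 2], hence at least
    [(1 + u ^+ 2) / 16]. *)
Lemma gauss_poly_le (z : R) : (1 + z ^+ 4) * gauss z <= 16 * normal_peak 1.
Proof.
rewrite gaussE mulrCA [leRHS]mulrC ler_wpM2l ?normal_peak_ge0//.
rewrite expRN ler_pdivrMr ?expR_gt0//.
have e : 1 + z ^+ 2 / 4 <= expR (z ^+ 2 / 4) by exact: expR_ge1Dx.
have -> : z ^+ 2 / 2 = z ^+ 2 / 4 + z ^+ 2 / 4 by field.
rewrite expRD; have := sqr_ge0 z; move: (expR _) e => E.
rewrite (_ : z ^+ 4 = z ^+ 2 * z ^+ 2); last by ring.
by move: (z ^+ 2) => u; nra.
Qed.

(** Covers the polynomial factors of [heat2], [heat3] and, after division by 4, of [heat_ss]. *)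
Lemma gauss_poly_bound (z a b : R) : `|a| <= 1 -> `|b| <= 1 ->
  `|(a * z + b * z ^+ 3) * gauss z| <= 32 * normal_peak 1 /\
  `|(a + b * z ^+ 2) * gauss z| <= 32 * normal_peak 1.
Proof.
move=> a1 b1; have g0 := normal_pdf_ge0 0 1 z.
have G := gauss_poly_le z.
split; rewrite normrM (ger0_norm g0).
  apply: (@le_trans _ _ ((2 * (1 + z ^+ 4)) * gauss z)); last by lra.
  rewrite ler_wpM2r// (le_trans (ler_normD _ _))// (normrM a) (normrM b) (normrX 3).
  move: `|a| `|b| a1 b1 (normr_ge0 a) (normr_ge0 b) => {}a {}b a1 b1 a0 b0.
  rewrite -[z ^+ 4](_ : `|z| ^+ 4 = _); last first.
    by rewrite -normrX ger0_norm// exprn_even_ge0.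
  move: `|z| (normr_ge0 z) => u u0.
  have h1 : u <= 1 + u ^+ 4.
    have := sqr_ge0 (u - 1); have := sqr_ge0 (u ^+ 2 - 1).
    rewrite (_ : u ^+ 4 = u ^+ 2 * u ^+ 2); last by ring.
    have := sqr_ge0 (u ^+ 2); nra.
  have h3 : u ^+ 3 <= 1 + u ^+ 4.
    rewrite (_ : u ^+ 4 = u * u ^+ 3); last by ring.
    have u3 : 0 <= u ^+ 3 by exact: exprn_ge0.
    have [u1|/ltW u1] := leP u 1; last by nra.
    have : u ^+ 3 <= 1 by exact: exprn_ile1.
    by nra.
  have u3 : 0 <= u ^+ 3 by exact: exprn_ge0.
  by nra.
apply: (@le_trans _ _ ((2 * (1 + z ^+ 4)) * gauss z)); last by lra.
rewrite ler_wpM2r// (le_trans (ler_normD _ _))// (normrM b) (normrX 2).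
move: `|a| `|b| a1 b1 (normr_ge0 a) (normr_ge0 b) => {}a {}b a1 b1 a0 b0.
rewrite -[z ^+ 4](_ : `|z| ^+ 4 = _); last first.
  by rewrite -normrX ger0_norm// exprn_even_ge0.
move: `|z| (normr_ge0 z) => u u0.
rewrite (_ : u ^+ 4 = u ^+ 2 * u ^+ 2); last by ring.
have := sqr_ge0 u; move: (u ^+ 2) => v v0; nra.
Qed.

(* An explicit solution of the heat equation [d/ds heat = 1/2 d^2/dx^2 heat]. *)
Definition heat (r s x : R) : R := gauss_cdf ((r - x) / Num.sqrt s).
Definition heat1 (r s x : R) : R :=
  - (gauss ((r - x) / Num.sqrt s) / Num.sqrt s).
Definition heat2 (r s x : R) : R :=
  - ((r - x) / Num.sqrt s * gauss ((r - x) / Num.sqrt s) / s).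
Definition heat3 (r s x : R) : R := let z := (r - x) / Num.sqrt s in
  (1 - z ^+ 2) * gauss z / (s * Num.sqrt s).
Definition heat_ss (r s x : R) : R := let z := (r - x) / Num.sqrt s in
  (3 * z - z ^+ 3) * gauss z / (4 * s ^+ 2).

Lemma is_derive_heat_arg (r s x : R) : is_derive x (1 : R)
  (fun x : R => (r - x) / Num.sqrt s) (- (Num.sqrt s)^-1).
Proof. by apply: is_derive_eq; rewrite /GRing.scale/=; ring. Qed.

Lemma is_derive_heat_arg_time (r s x : R) : 0 < s -> is_derive s (1 : R)
  (fun s : R => (r - x) / Num.sqrt s) (- ((r - x) / Num.sqrt s / (2 * s))).
Proof.
move=> s0; have q0 : Num.sqrt s != 0 by rewrite gt_eqF// sqrtr_gt0.
have ds := is_derive1_sqrt s0.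
have dV := is_deriveV q0 ds.
have dM := is_deriveM (is_derive_cst (r - x) s (1 : R)) dV.
apply: (@is_derive_eq _ _ _ _ _ _ _ _ dM).
have -> : 2 * s = 2 * Num.sqrt s ^+ 2 by rewrite sqr_sqrtr// ltW.
by rewrite /GRing.scale/= mulr0 addr0; field.
Qed.

Lemma is_derive_heat (r s x : R) : 0 < s ->
  is_derive x (1 : R) (heat r s) (heat1 r s x).
Proof.
move=> s0; have dz := is_derive_heat_arg r s x.
have dG := is_derive_gauss_cdf ((r - x) / Num.sqrt s).
have := @is_derive1_comp R gauss_cdf (fun x : R => (r - x) / Num.sqrt s)
  x _ _ dG dz.
by rewrite mulrN; apply.
Qed.

Lemma is_derive_heat1 (r s x : R) : 0 < s ->
  is_derive x (1 : R) (heat1 r s) (heat2 r s x).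
Proof.
move=> s0; have q0 : Num.sqrt s != 0 by rewrite gt_eqF// sqrtr_gt0.
have dz := is_derive_heat_arg r s x.
have dG := is_derive_gauss ((r - x) / Num.sqrt s).
have dC := @is_derive1_comp R gauss (fun x : R => (r - x) / Num.sqrt s) x _ _ dG dz.
have dM := is_deriveN (is_deriveM dC (is_derive_cst (Num.sqrt s)^-1 x (1 : R))).
apply: (@is_derive_eq _ _ _ _ _ _ _ _ dM).
have sV : s^-1 = (Num.sqrt s)^-1 * (Num.sqrt s)^-1.
  by rewrite -invfM -expr2 sqr_sqrtr// ltW.
by rewrite /heat2 sV /GRing.scale/= mulr0 add0r; field.
Qed.

Lemma is_derive_heat2 (r s x : R) : 0 < s ->
  is_derive x (1 : R) (heat2 r s) (heat3 r s x).
Proof.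
move=> s0; have q0 : Num.sqrt s != 0 by rewrite gt_eqF// sqrtr_gt0.
have dz := is_derive_heat_arg r s x.
have dG := is_derive_gauss ((r - x) / Num.sqrt s).
have dC := @is_derive1_comp R gauss (fun x : R => (r - x) / Num.sqrt s) x _ _ dG dz.
have dM := is_deriveN (is_deriveM (is_deriveM dz dC)
  (is_derive_cst s^-1 x (1 : R))).
apply: (@is_derive_eq _ _ _ _ _ _ _ _ dM).
rewrite /heat3 /GRing.scale/= mulr0 add0r.
by field; rewrite q0 gt_eqF.
Qed.

Lemma is_derive_heat_time (r s x : R) : 0 < s ->
  is_derive s (1 : R) (fun s : R => heat r s x) (heat2 r s x / 2).
Proof.
move=> s0; have dz := is_derive_heat_arg_time r x s0.
have dG := is_derive_gauss_cdf ((r - x) / Num.sqrt s).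
have dC := @is_derive1_comp R gauss_cdf (fun s : R => (r - x) / Num.sqrt s) s _ _ dG dz.
apply: (@is_derive_eq _ _ _ _ _ _ _ _ dC).
rewrite /heat2; field.
by rewrite (gt_eqF s0) gt_eqF// sqrtr_gt0.
Qed.

Lemma is_derive_heat2_time (r s x : R) : 0 < s ->
  is_derive s (1 : R) (fun s : R => heat2 r s x / 2) (heat_ss r s x).
Proof.
move=> s0; have dz := is_derive_heat_arg_time r x s0.
have dG := is_derive_gauss ((r - x) / Num.sqrt s).
have dC := @is_derive1_comp R gauss (fun s : R => (r - x) / Num.sqrt s) s _ _ dG dz.
have dV := is_deriveV (lt0r_neq0 s0) (is_derive_id s (1 : R)).
have dM := is_deriveM (is_deriveN (is_deriveM (is_deriveM dz dC) dV))
  (is_derive_cst (2^-1 : R) s (1 : R)).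
apply: (@is_derive_eq _ _ _ _ _ _ _ _ dM).
rewrite /heat_ss /GRing.scale/= mulr0 add0r !fctE/=; field.
by rewrite (gt_eqF s0) gt_eqF// sqrtr_gt0.
Qed.


Lemma heat_bounds (e : R) : 0 < e -> exists C : R, 0 < C /\
  forall r s x, e <= s -> [/\ `|heat2 r s x| <= C, `|heat3 r s x| <= C &
    `|heat_ss r s x| <= C].
Proof.
(* Four times the constant of [gauss_poly_bound], because [3 * z - z ^+ 3] has to be rescaled by
   4. *)
move=> e0; pose c : R := 128 * normal_peak 1.
have c0 : 0 < c by rewrite mulr_gt0// normal_peak_gt0// oner_neq0.
have se0 : 0 < Num.sqrt e by rewrite sqrtr_gt0.
exists (c / e + c / (e * Num.sqrt e) + c / e ^+ 2).
have c1 : 0 < c / e by exact: divr_gt0.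
have c2 : 0 < c / (e * Num.sqrt e) by rewrite divr_gt0// mulr_gt0.
have c3 : 0 < c / e ^+ 2 by rewrite divr_gt0// exprn_gt0.
split=> [|r s x es]; first by rewrite addr_gt0// addr_gt0.
have s0 : 0 < s := lt_le_trans e0 es.
have ss : Num.sqrt e <= Num.sqrt s by rewrite ler_wsqrtr.
have bd u v w : `|u| <= c -> 0 < v -> v <= w -> `|u / w| <= c / v.
  move=> uc v0 vw; have w0 := lt_le_trans v0 vw.
  rewrite normrM normfV (gtr0_norm w0) ler_pM ?invr_ge0 ?(ltW w0)//.
  by rewrite lef_pV2.
have n1 : `|-1 : R| <= 1 by rewrite normrN normr1.
have n0 : `|0 : R| <= 1 by rewrite normr0.
have n11 : `|1 : R| <= 1 by rewrite normr1.
set z := (r - x) / Num.sqrt s.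
have cE : 32 * normal_peak 1 *+ 4 = c by rewrite /c; ring.
have p0 : 0 <= 32 * normal_peak 1 :> R by rewrite mulr_ge0// normal_peak_ge0.
split.
- rewrite /heat2 -/z -mulNr.
  apply: (@le_trans _ _ (c / e)); last by lra.
  apply: bd => //; have [+ _] := gauss_poly_bound z n1 n0.
  rewrite mul0r addr0 mulN1r mulNr => /le_trans; apply.
  by rewrite -cE; move: p0; lra.
- rewrite /heat3 -/z.
  apply: (@le_trans _ _ (c / (e * Num.sqrt e))); last by lra.
  apply: bd; [|by rewrite mulr_gt0|by rewrite ler_pM// ltW].
  have [_ +] := gauss_poly_bound z n11 n1.
  rewrite mulN1r => /le_trans; apply.
  by rewrite -cE; move: p0; lra.
- rewrite /heat_ss -/z.
  apply: (@le_trans _ _ (c / e ^+ 2)); last by lra.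
  apply: bd; [|by rewrite exprn_gt0|].
    have n34 : `|3 / 4 : R| <= 1 by rewrite ger0_norm; lra.
    have n14 : `|- 4^-1 : R| <= 1 by rewrite normrN ger0_norm; lra.
    have [+ _] := gauss_poly_bound z n34 n14.
    rewrite (_ : (3 * z - z ^+ 3) * gauss z =
      4 * ((3 / 4 * z + - 4^-1 * z ^+ 3) * gauss z)); last by field.
    rewrite (normrM 4) (ger0_norm (_ : 0 <= 4))// => h.
    by rewrite -cE; lra.
  have : e ^+ 2 <= s ^+ 2 by rewrite lerXn2r// nnegrE ltW.
  have := sqr_ge0 s; lra.
Qed.

(** Bounding the oscillation of [heat2] both by a constant and by a multiple of the increment gives
    the factor [min 1 |y|]. It is what makes second moments sufficient, where a cubic remainder
    would require third moments. In time, [heat2 / 2] is the derivative and is Lipschitz. *)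
Lemma heat_step (e : R) : 0 < e -> exists C : R, 0 < C /\
  forall r s x, e <= s ->
  (forall y, `|heat r s (x + y) - heat r s x - y * heat1 r s x -
      y ^+ 2 / 2 * heat2 r s x| <= C * (y ^+ 2 * Num.min 1 `|y|)) /\
  (forall a, 0 <= a ->
    `|heat r (s + a) x - heat r s x - a * (heat2 r s x / 2)| <= C * a ^+ 2).
Proof.
move=> e0; have [C [C0 HC]] := heat_bounds e0.
exists (C *+ 2); split=> [|r s x es]; first by rewrite mulrn_wgt0.
have s0 : 0 < s := lt_le_trans e0 es.
split=> [y|a a0].
  rewrite (mulrC (y ^+ 2) (Num.min _ _)) mulrA.
  apply: (@taylor2_le R (heat r s) (heat1 r s) (heat2 r s)).
  - by move=> t; exact: is_derive_heat.
  - by move=> t; exact: is_derive_heat1.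
  move=> t ty.
  have b1 : `|heat2 r s (x + t) - heat2 r s x| <= C *+ 2.
    have [h _ _] := HC r s x es; have [h' _ _] := HC r s (x + t) es.
    by rewrite (le_trans (ler_normB _ _))// mulr2n lerD.
  have b2 : `|heat2 r s (x + t) - heat2 r s x| <= C * `|y|.
    have sh u : is_derive u (1 : R) (fun t => heat2 r s (x + t))
        (heat3 r s (x + u)).
      have gt := is_derive_heat2 r (x + u) s0.
      have st : is_derive u (1 : R) (fun t : R => x + t) 1.
        by apply: is_derive_eq; ring.
      by have := @is_derive1_comp R (heat2 r s) _ u _ _ gt st; rewrite mulr1; apply.
    have := derive_le (a := `|t|) (B := C) (y := t) sh.
    rewrite addr0 => /(_ _ _)/le_trans; apply => //.
      by move=> u _; have [] := HC r s (x + u) es.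
    by rewrite ler_wpM2l// ltW.
  case: (leP 1 `|y|) => _; first by rewrite mulr1.
  by rewrite (le_trans b2)// ler_wpM2r// mulr2n lerDl ltW.
have sa : s <= s + a by rewrite lerDl.
have pos t : s <= t <= s + a -> 0 < t by move=> /andP[/(lt_le_trans s0)].
have d2 t : s <= t <= s + a -> `|heat2 r t x / 2 - heat2 r s x / 2| <= C * a.
  move=> /andP[st ta].
  have := @derive_le_itv R (fun t => heat2 r t x / 2) (fun t => heat_ss r t x) s t C st.
  move=> /(_ _ _)/le_trans; apply.
  - by move=> u /andP[su _]; apply: is_derive_heat2_time; exact: lt_le_trans su.
  - by move=> u /andP[su _]; have [] := HC r u x (le_trans es su).
  - by rewrite ler_wpM2l ?(ltW C0)// lerBlDl.
pose k t := heat r t x - t * (heat2 r s x / 2).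
have kd t : s <= t <= s + a ->
    is_derive t (1 : R) k (heat2 r t x / 2 - heat2 r s x / 2).
  move=> /pos t0; have dt := is_derive_heat_time r x t0.
  apply: is_derive_eq; rewrite /GRing.scale/=; ring.
have := derive_le_itv sa kd d2; rewrite (addrC s a) addrK.
rewrite (_ : k (a + s) - k s = heat r (a + s) x - heat r s x - a * (heat2 r s x / 2)).
  move=> /le_trans; apply; rewrite expr2 mulrA !ler_wpM2r// mulr2n lerDl.
  exact: ltW.
rewrite /k; ring.
Qed.

Lemma measurable_gauss_cdf : measurable_fun [set: R] gauss_cdf.
Proof.
apply: continuous_measurable_fun => x.
exact: is_derive_continuous (is_derive_gauss_cdf x).
Qed.

Lemma gauss_cdf_continuous : continuous gauss_cdf.
Proof. by move=> x; exact: is_derive_continuous (is_derive_gauss_cdf x). Qed.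

Lemma gauss_cdf_le x y : x <= y -> gauss_cdf x <= gauss_cdf y.
Proof.
move=> xy; rewrite -lee_fin -!gauss_cdfE le_measure ?inE//.
by apply: subset_itvl; rewrite bnd_simp.
Qed.

End Heat.

(** * Independence of weighted sums *)

Section Independence.
Context d (T : measurableType d) (R : realType) (P : probability T R).

(** Uniqueness of product measures, applied to the law of the pair restricted to [E], with the mass
    of [E] moved to the second factor. The event [E] carries the remaining independent variables
    through the induction for weighted sums. *)
Lemma independent_pair_law (X Y : {RV P >-> R}) (E : set T) : measurable E ->
  (forall A B : set R, measurable A -> measurable B ->
     P (X @^-1` A `&` Y @^-1` B `&` E) =
     (P (X @^-1` A) * P (Y @^-1` B) * P E)%E) ->
  forall C : set (R * R), measurable C ->
    P ((fun w => (X w, Y w)) @^-1` C `&` E) =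
    ((distribution P X \x distribution P Y)%E C * P E)%E.
Proof.
move=> mE XYE C mC.
have c0 : 0 <= fine (P E) by exact: fine_ge0.
pose c : {nonneg R} := NngNum c0.
have cE : P E = (c%:num)%:E by rewrite /= fineK// fin_num_measure.
have mxy : measurable_fun setT (fun w => (X w, Y w)).
  exact: measurable_fun_pair.
pose m' : {measure set (R * R) -> \bar R} :=
  measure_function_pushforward__canonical__measure_function_Measure
    (mrestr P mE) mxy.
have m'E A B : measurable A -> measurable B ->
    m' (A `*` B) = (distribution P X A * mscale c (distribution P Y) B)%E.
  move=> mA mB; transitivity (P (X @^-1` A `&` Y @^-1` B `&` E)) => //.
  by rewrite XYE// /mscale -cE [(P E * _)%E]muleC muleA.
transitivity (m' C) => //.
rewrite -(product_measure_unique m'E mC).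
rewrite /product_measure1 /= /mscale/=.
rewrite ge0_integralZl//; first by rewrite -cE muleC.
exact: measurable_fun_xsection.
Qed.

Lemma independent_integral (X Y : {RV P >-> R}) (F : R * R -> \bar R) :
  (forall A B : set R, measurable A -> measurable B ->
     P (X @^-1` A `&` Y @^-1` B) = (P (X @^-1` A) * P (Y @^-1` B))%E) ->
  measurable_fun setT F -> (forall z, (0 <= F z)%E) ->
  (\int[P]_w F (X w, Y w) = \int[P]_w \int[P]_v F (X w, Y v))%E.
Proof.
move=> XY mF F0.
have mxy : measurable_fun setT (fun w => (X w, Y w)).
  exact: measurable_fun_pair.
pose m1 : {measure set (R * R) -> \bar R} :=
  measure_function_pushforward__canonical__measure_function_Measure P mxy.
pose m2 : {measure set (R * R) -> \bar R} :=
  (distribution P X \x distribution P Y)%E.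
transitivity (\int[m1]_z F z)%E; first by rewrite ge0_integral_pushforward.
rewrite (eq_measure_integral m2); last first.
  move=> A mA _; rewrite -[RHS]mule1 -(@probability_setT _ _ _ P).
  rewrite -independent_pair_law ?setIT// => B C mB mC.
  by rewrite setIT probability_setT mule1 XY.
rewrite fubini_tonelli1// ge0_integral_distribution//=.
- apply: eq_integral => w _; rewrite /fubini_F ge0_integral_distribution//.
  exact: measurable_fun_pair2.
- exact: measurable_fun_fubini_tonelli_F.
- by move=> x; apply: integral_ge0.
Qed.

End Independence.

Section WeightedSums.
Context d (T : measurableType d) (R : realType) (P : probability T R).
Context (I : choiceType) (X : I -> {RV P >-> R}) (a : I -> R).

Definition weighted_sum (s : seq I) (w : T) : R := \sum_(i <- s) a i * X i w.

Let measurable_weighted_sum s : measurable_fun setT (weighted_sum s).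
Proof. by apply: measurable_sum => i; exact: measurable_funM. Qed.

HB.instance Definition _ s := isMeasurableFun.Build _ _ _ _ (weighted_sum s)
  (measurable_weighted_sum s).

Hypothesis indX : mutually_independent X.

Let event (J : {fset I}) (B : I -> set R) : set T :=
  \bigcap_(i in [set` J]) (X i @^-1` B i).

Let measurable_event J B : (forall i, measurable (B i)) ->
  measurable (event J B).
Proof.
move=> mB; apply: fin_bigcap_measurable => // i _.
by rewrite -[X in measurable X]setTI; exact: measurable_funPT.
Qed.

Let event_cons x J B B' : x \notin J ->
  X x @^-1` B' `&` event J B =
  event (x |` J)%fset (fun i => if i == x then B' else B i).
Proof.
move=> xJ; rewrite /event; apply/seteqP; split => w /=.
  move=> [xB JB] i /=; rewrite inE => /orP[/fset1P ->|iJ]; first by rewrite eqxx.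
  by rewrite ifN; [exact: JB|apply: contraNneq xJ => <-].
move=> H; split; first by have := H x (fset1U1 _ _); rewrite eqxx.
move=> i iJ; have := H i; rewrite /= inE iJ orbT => /(_ isT).
by rewrite ifN//; apply: contraNneq xJ => <-.
Qed.

Lemma independent_event_cons (x : I) J B B' : x \notin J ->
  (forall i, measurable (B i)) -> measurable B' ->
  P (X x @^-1` B' `&` event J B) = (P (X x @^-1` B') * P (event J B))%E.
Proof.
move=> xJ mB mB'; rewrite event_cons// indX; last by move=> i; case: ifP.
rewrite big_fsetU1//= eqxx indX//; congr (_ * _)%E.
rewrite big_seq [RHS]big_seq; apply: eq_bigr => i iJ.
by rewrite ifN//; apply: contraNneq xJ => <-.
Qed.

Lemma weighted_sum_independent (s : seq I) : uniq s ->
  forall (J : {fset I}) A B, (forall x, x \in s -> x \notin J) ->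
  measurable A -> (forall i, measurable (B i)) ->
  P (weighted_sum s @^-1` A `&` event J B) =
  (P (weighted_sum s @^-1` A) * P (event J B))%E.
Proof.
elim: s => [_ J A B _ mA mB|x s IH /=/andP[xs us] J A B sJ mA mB].
  have e w : weighted_sum [::] w = 0 by rewrite /weighted_sum big_nil.
  have [A0|A0] := pselect (A 0).
    rewrite (_ : _ @^-1` A = setT) ?setTI ?probability_setT ?mul1e//.
    by apply/seteqP; split => // w _ /=; rewrite e.
  rewrite (_ : _ @^-1` A = set0) ?set0I ?measure0 ?mul0e//.
  by apply/seteqP; split => // w /=; rewrite e.
pose C : set (R * R) := [set z | A (a x * z.2 + z.1)].
have mC : measurable C.
  rewrite -[C]setTI; apply: (_ : measurable_fun setT (fun z : R * R => _)) => //.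
  by apply: measurable_funD => //; exact: measurable_funM.
have WC : weighted_sum (x :: s) @^-1` A =
    (fun w => (weighted_sum s w, X x w)) @^-1` C.
  by apply/seteqP; split => w /=; rewrite /C/= /weighted_sum big_cons.
have law J' : (forall y, y \in x :: s -> y \notin J') ->
    P (weighted_sum (x :: s) @^-1` A `&` event J' B) =
    ((distribution P (weighted_sum s) \x distribution P (X x))%E C *
      P (event J' B))%E.
  move=> sJ'; rewrite WC; apply: independent_pair_law => //.
    exact: measurable_event.
  move=> A' B' mA' mB'.
  have xJ : x \notin J' by apply: sJ'; rewrite mem_head.
  rewrite -setIA -muleA -independent_event_cons//.
  rewrite event_cons//; apply: IH => //; last by move=> i; case: ifP.
  move=> y ys; rewrite !inE negb_or sJ' ?andbT ?inE ?ys ?orbT//.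
  by apply: contraNneq xs => <-.
(* The same law with the empty family of conditions identifies the first factor as the unrestricted
   probability. *)
rewrite law//; congr (_ * _)%E.
have ev0 : event fset0 B = setT.
  by rewrite /event; apply/seteqP; split => // w _ i /=; rewrite inE.
by have := law fset0; rewrite ev0 setIT probability_setT mule1 => <-.
Qed.

Lemma weighted_sum_cons_integral (x : I) (s : seq I) (F : R -> \bar R) :
  uniq (x :: s) -> measurable_fun setT F -> (forall z, (0 <= F z)%E) ->
  (\int[P]_w F (weighted_sum (x :: s) w) =
   \int[P]_w \int[P]_v F (weighted_sum s w + a x * X x v)%R)%E.
Proof.
move=> /= /andP[xs us] mF F0.
under eq_integral do rewrite /weighted_sum big_cons addrC.
apply: (independent_integral (X := weighted_sum s) (Y := X x)
  (F := fun z => F (z.1 + a x * z.2))) => //.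
- move=> A B mA mB.
  have ev : event [fset x]%fset (fun=> B) = X x @^-1` B.
    rewrite /event; apply/seteqP; split => w /=.
      by apply; rewrite /= inE.
    by move=> wB i /=; rewrite inE => /eqP ->.
  rewrite -ev; apply: weighted_sum_independent => // y ys.
  by rewrite inE; apply: contraNneq xs => <-.
- apply: measurableT_comp => //; apply: measurable_funD => //.
  exact: measurable_funM.
Qed.

End WeightedSums.

(** * Lindeberg replacement of the summands *)

Section OneStep.
Context d (T : measurableType d) (R : realType) (P : probability T R).

Lemma bounded_rv_integrable (f : T -> R) (M : R) : measurable_fun setT f ->
  (forall w, `|f w| <= M) -> P.-integrable setT (EFin \o f).
Proof.
move=> mf fM; apply: measurable_bounded_integrable => //.
  by apply: le_lt_trans (ltry 1); exact: probability_le1.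
exists M; split; first exact: num_real.
by move=> x Mx w _ /=; apply: le_trans (ltW Mx); exact: fM.
Qed.

Lemma dominated_integrable (f g : T -> R) : measurable_fun setT f ->
  P.-integrable setT (EFin \o g) -> (forall w, `|f w| <= g w) ->
  P.-integrable setT (EFin \o f).
Proof.
move=> mf ig fg; apply: le_integrable ig => //; first exact/measurable_EFinP.
by move=> w _ /=; rewrite lee_fin (le_trans (fg w))// ler_norm.
Qed.

(** A continuous version of Lindeberg's truncated second moment: [min 1 (c |Y|)] replaces the
    indicator that [|Y|] is large compared with [1 / c]. *)
Definition truncated_moment (Y : T -> R) (c : R) : R :=
  \int[P]_w (Y w ^+ 2 * Num.min 1 (c * `|Y w|)).

Lemma truncated_sqr_bound (y c : R) : 0 <= c ->
  `|y ^+ 2 * Num.min 1 (c * `|y|)| <= y ^+ 2.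
Proof.
move=> c0; have m0 : 0 <= Num.min 1 (c * `|y|) by rewrite le_min ler01 mulr_ge0.
rewrite ger0_norm; last by apply: mulr_ge0 => //; exact: sqr_ge0.
by rewrite ler_piMr ?sqr_ge0// ge_min lexx.
Qed.

Variable Y : {RV P >-> R}.
Hypotheses (iY : P.-integrable setT (EFin \o Y)) (mean0 : \int[P]_w Y w = 0)
  (iY2 : P.-integrable setT (EFin \o (fun w => Y w ^+ 2)))
  (var1 : \int[P]_w (Y w ^+ 2) = 1).

Let measurable_truncated c :
  measurable_fun setT (fun w => Y w ^+ 2 * Num.min 1 (c * `|Y w|)).
Proof.
apply: measurable_funM; first exact: measurable_funX.
apply: measurable_minr => //; apply: measurable_funM => //.
exact: measurableT_comp.
Qed.

Lemma truncated_integrable c : 0 <= c ->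
  P.-integrable setT (EFin \o (fun w => Y w ^+ 2 * Num.min 1 (c * `|Y w|))).
Proof.
move=> c0; apply: dominated_integrable iY2 _ => // w.
exact: truncated_sqr_bound.
Qed.

Lemma truncated_moment_le c c' : 0 <= c -> c <= c' ->
  truncated_moment Y c <= truncated_moment Y c'.
Proof.
move=> c0 cc'; apply: le_Rintegral => //.
- exact: truncated_integrable.
- by apply: truncated_integrable; exact: le_trans cc'.
move=> w _; rewrite ler_wpM2l ?sqr_ge0// le_min ge_min lexx/=.
by rewrite ge_min (ler_wpM2r _ cc') ?orbT.
Qed.

(** Dominated convergence along [c = 1 / n.+1], with [Y ^+ 2] as the dominating function. *)
Lemma truncated_moment_small (e : R) : 0 < e ->
  exists c, [/\ 0 < c, c <= 1 & truncated_moment Y c <= e].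
Proof.
move=> e0.
pose f n w := (Y w ^+ 2 * Num.min 1 (n.+1%:R^-1 * `|Y w|))%:E.
have h : (\int[P]_w f n w)%E @[n --> \oo] --> (\int[P]_w (0 : \bar R))%E.
  apply: (@dominated_cvg _ _ _ _ _ _ f _ (fun w => (Y w ^+ 2)%:E)) => //.
  - by move=> n; apply/measurable_EFinP; exact: measurable_truncated.
  - move=> w _; apply: cvg_EFin; first by near=> n.
    rewrite [X in _ --> X](_ : _ = Y w ^+ 2 * 0); last by rewrite mulr0.
    apply: cvgM; first exact: cvg_cst.
    apply: (@squeeze_cvgr _ _ _ _ (fun=> 0) (fun n => n.+1%:R^-1 * `|Y w|)).
    + near=> n; rewrite le_min ler01/= mulr_ge0//= ge_min lexx orbT//.
    + exact: cvg_cst.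
    + rewrite -[X in _ --> X](mul0r `|Y w|); apply: cvgMr_tmp => //.
      exact: cvg_harmonic.
  - move=> n w _ /=; rewrite lee_fin truncated_sqr_bound// invr_ge0//.
rewrite integral0 in h.
have : fine (\int[P]_w f n w)%E @[n --> \oo] --> (0 : R) by exact: fine_cvg h.
move=> /cvgrPdist_le/(_ _ e0)[n _ /(_ n (leqnn n))].
rewrite /= sub0r normrN => H; exists n.+1%:R^-1; split => //.
  by rewrite invf_le1// ler1n.
exact: le_trans (ler_norm _) H.
Unshelve. all: by end_near. Qed.

(** No Gaussian variable is introduced: its role is played by the extra time [a ^+ 2]. With mean 0
    and variance 1 the expansion in space averages to [heat + a ^+ 2 / 2 * heat2], and by the heat
    equation so does the expansion in time. The time remainder [C * a ^+ 4] yields the [c ^+ 2]. *)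
Lemma heat_swap (r s x a c C : R) : 0 < s -> 0 <= c -> `|a| <= c -> 0 <= C ->
  (forall y, `|heat r s (x + y) - heat r s x - y * heat1 r s x -
      y ^+ 2 / 2 * heat2 r s x| <= C * (y ^+ 2 * Num.min 1 `|y|)) ->
  (forall b, 0 <= b ->
    `|heat r (s + b) x - heat r s x - b * (heat2 r s x / 2)| <= C * b ^+ 2) ->
  `|\int[P]_w heat r s (x + a * Y w) - heat r (s + a ^+ 2) x| <=
    C * a ^+ 2 * (truncated_moment Y c + c ^+ 2).
Proof.
move=> s0 c0 ac C0 tx ts.
pose G w := heat r s (x + a * Y w) - heat r s x - a * Y w * heat1 r s x -
      (a * Y w) ^+ 2 / 2 * heat2 r s x.
pose K w := C * a ^+ 2 * (Y w ^+ 2 * Num.min 1 (c * `|Y w|)).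
have mH : measurable_fun setT (fun w => heat r s (x + a * Y w)).
  apply: (measurableT_comp measurable_gauss_cdf); apply: measurable_funM => //.
  by apply: measurable_funB => //; apply: measurable_funD => //; exact: measurable_funM.
have iH : P.-integrable setT (EFin \o (fun w => heat r s (x + a * Y w))).
  apply: (bounded_rv_integrable (M := 1)) => // w.
  by rewrite ger0_norm ?gauss_cdf_ge0 ?gauss_cdf_le1.
have iK : P.-integrable setT (EFin \o K).
  by apply: (integrableZl measurableT (C * a ^+ 2) (truncated_integrable c0)).
have GK w : `|G w| <= K w.
  apply: le_trans (tx _) _; rewrite exprMn /K -(mulrA C) ler_wpM2l//.
  rewrite -(mulrA (a ^+ 2)) !ler_wpM2l ?sqr_ge0// le_min !ge_min lexx/=.
  by rewrite normrM ler_wpM2r// ?orbT.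
have i0 : P.-integrable setT (EFin \o (fun=> heat r s x)).
  by apply: (bounded_rv_integrable (M := `|heat r s x|)) => //.
have i1 : P.-integrable setT (EFin \o (fun w => a * heat1 r s x * Y w)).
  exact: (integrableZl measurableT (a * heat1 r s x) iY).
have i2 : P.-integrable setT
    (EFin \o (fun w => a ^+ 2 / 2 * heat2 r s x * Y w ^+ 2)).
  exact: (integrableZl measurableT (a ^+ 2 / 2 * heat2 r s x) iY2).
have GE : G = fun w => heat r s (x + a * Y w) - heat r s x -
    a * heat1 r s x * Y w - a ^+ 2 / 2 * heat2 r s x * Y w ^+ 2.
  by apply/funext => w; rewrite /G; ring.
have i01 := integrableB measurableT iH i0.
have i012 := integrableB measurableT i01 i1.
have iG : P.-integrable setT (EFin \o G).
  rewrite GE; exact: (integrableB measurableT i012 i2).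
have intG : \int[P]_w G w =
    \int[P]_w heat r s (x + a * Y w) - heat r s x - a ^+ 2 / 2 * heat2 r s x.
  rewrite GE RintegralB// RintegralB// RintegralB// Rintegral_cst//.
  rewrite !RintegralZl// mean0 var1.
  rewrite (_ : fine _ = 1); last exact: (congr1 fine (probability_setT P)).
  ring.
have bG : `|\int[P]_w G w| <= C * a ^+ 2 * truncated_moment Y c.
  apply: le_trans (le_normr_Rintegral measurableT iG) _.
  rewrite /truncated_moment -RintegralZl//; last exact: truncated_integrable.
  apply: le_Rintegral => //; first exact: (integrable_norm iG).
set V := heat r (s + a ^+ 2) x; set W := \int[P]_w _.
have -> : W - V = (\int[P]_w G w) - (V - heat r s x - a ^+ 2 * (heat2 r s x / 2)).
  rewrite intG /W; lra.
apply: le_trans (ler_normB _ _) _; rewrite mulrDr lerD//.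
apply: le_trans (ts _ (sqr_ge0 a)) _.
rewrite -mulrA ler_wpM2l// expr2 ler_wpM2l ?sqr_ge0//.
by rewrite -(real_normK (num_real a)) lerXn2r ?nnegrE.
Qed.

End OneStep.

Section Lindeberg.
Context d (T : measurableType d) (R : realType) (P : probability T R).
Context (I : choiceType) (X : I -> {RV P >-> R}).
Hypothesis indX : mutually_independent X.
Hypotheses (iX : forall i, P.-integrable setT (EFin \o X i))
  (mean0 : forall i, \int[P]_w X i w = 0)
  (iX2 : forall i, P.-integrable setT (EFin \o (fun w => X i w ^+ 2)))
  (var1 : forall i, \int[P]_w (X i w ^+ 2) = 1).

Lemma measurable_heat r s : measurable_fun setT (@heat R r s).
Proof.
apply: (measurableT_comp measurable_gauss_cdf); apply: measurable_funM => //.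
exact: measurable_funB.
Qed.

Lemma heat_norm_le1 r s x : `|heat r s x| <= 1 :> R.
Proof. by rewrite ger0_norm ?gauss_cdf_ge0 ?gauss_cdf_le1. Qed.

Lemma measurable_shift_integral (Y : {RV P >-> R}) (a : R) (F : R -> \bar R) :
  measurable_fun setT F -> (forall z, (0 <= F z)%E) ->
  measurable_fun setT (fun x : R => \int[P]_v F (x + a * Y v)%R)%E.
Proof.
move=> mF F0; pose F2 (z : R * R) := F (z.1 + a * z.2).
have mF2 : measurable_fun setT F2.
  apply: measurableT_comp => //; apply: measurable_funD => //.
  exact: measurable_funM.
rewrite (_ : (fun x : R => _) = fubini_F (distribution P Y) F2).
  by apply: measurable_fun_fubini_tonelli_F => // z; exact: F0.
apply/funext => x; rewrite /fubini_F ge0_integral_distribution//.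
  exact: measurable_fun_pair2.
by move=> y; exact: F0.
Qed.

Lemma heat_shift_integral (Y : {RV P >-> R}) r s a x :
  (\int[P]_v (heat r s (x + a * Y v))%:E =
   (\int[P]_v heat r s (x + a * Y v))%:E)%E.
Proof.
rewrite /Rintegral fineK//; apply: integrable_fin_num => //.
apply: (bounded_rv_integrable P (M := 1)) => [|w]; last exact: heat_norm_le1.
apply: measurableT_comp (measurable_heat r s) _.
by apply: measurable_funD => //; exact: measurable_funM.
Qed.

Lemma lindeberg (e C c t r : R) (a : I -> R) (s : seq I) : 0 < e -> 0 <= C ->
  0 <= c -> 0 <= t -> uniq s ->
  (forall i, i \in s -> `|a i| <= c) ->
  (forall i, truncated_moment P (X i) c <= t) ->
  (forall r s x, e <= s ->
    (forall y, `|heat r s (x + y) - heat r s x - y * heat1 r s x -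
        y ^+ 2 / 2 * heat2 r s x| <= C * (y ^+ 2 * Num.min 1 `|y|)) /\
    (forall a, 0 <= a ->
      `|heat r (s + a) x - heat r s x - a * (heat2 r s x / 2)| <= C * a ^+ 2)) ->
  forall s0, e <= s0 ->
  `|\int[P]_w heat r s0 (weighted_sum X a s w) -
    heat r (s0 + \sum_(i <- s) a i ^+ 2) 0| <=
  C * (\sum_(i <- s) a i ^+ 2) * (t + c ^+ 2).
Proof.
move=> e0 C0 c0 t0 us ac tc HC; elim: s us ac => [_ _|x s IH us ac] s0 es.
  rewrite !big_nil addr0 mulr0 mul0r.
  under eq_Rintegral do rewrite /weighted_sum big_nil.
  rewrite Rintegral_cst// (_ : fine _ = 1); last first.
    exact: (congr1 fine (probability_setT P)).
  by rewrite mulr1 subrr normr0.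
have us' : uniq s by case/andP: us.
have ac' i : i \in s -> `|a i| <= c by move=> si; apply: ac; rewrite inE si orbT.
have ax : `|a x| <= c by apply: ac; rewrite mem_head.
have es' : e <= s0 + a x ^+ 2 by rewrite (le_trans es)// lerDl sqr_ge0.
have {}IH := IH us' ac' _ es'.
rewrite !big_cons addrA (mulrDr C) (mulrDl (C * _)).
have mH : measurable_fun setT (fun x => (heat r s0 x)%:E).
  by apply/measurable_EFinP; exact: measurable_heat.
have H0 z : (0 <= (heat r s0 z)%:E)%E by rewrite lee_fin gauss_cdf_ge0.
pose K z := \int[P]_v heat r s0 (z + a x * X x v).
have mK : measurable_fun setT K.
  apply/measurable_EFinP; rewrite /comp.
  rewrite (_ : (fun z => _) =
      fun z => (\int[P]_v (heat r s0 (z + a x * X x v))%:E)%E).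
    exact: measurable_shift_integral mH H0.
  by apply/funext => z; rewrite heat_shift_integral.
have KE : \int[P]_w heat r s0 (weighted_sum X a (x :: s) w) =
    \int[P]_w K (weighted_sum X a s w).
  rewrite /Rintegral; congr fine.
  rewrite (weighted_sum_cons_integral _ indX us mH H0).
  by apply: eq_integral => w _; rewrite heat_shift_integral.
have Kh z : `|K z - heat r (s0 + a x ^+ 2) z| <= C * a x ^+ 2 * (t + c ^+ 2).
  have [t1 t2] := HC r s0 z es.
  apply: le_trans (heat_swap (iX x) (mean0 x) (iX2 x) (var1 x)
    (lt_le_trans e0 es) c0 ax C0 t1 t2) _.
  by apply: ler_wpM2l; [rewrite mulr_ge0 ?sqr_ge0|rewrite lerD2r].
have iH : P.-integrable setT
    (EFin \o (fun w => heat r (s0 + a x ^+ 2) (weighted_sum X a s w))).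
  apply: (bounded_rv_integrable P (M := 1)) => [|w]; last exact: heat_norm_le1.
  by apply: measurableT_comp (measurable_heat _ _) _.
have mKW : measurable_fun setT (fun w => K (weighted_sum X a s w)).
  by apply: measurableT_comp mK _.
have iK : P.-integrable setT (EFin \o (fun w => K (weighted_sum X a s w))).
  apply: (bounded_rv_integrable P (M := 1 + C * a x ^+ 2 * (t + c ^+ 2))) => // w.
  set z := weighted_sum _ _ _ _.
  rewrite -[K z](subrK (heat r (s0 + a x ^+ 2) z)) addrC.
  by rewrite (le_trans (ler_normD _ _))// lerD// heat_norm_le1.
have iKH := integrableB measurableT iK iH.
rewrite KE -[X in `|X|](subrKA (\int[P]_w heat r (s0 + a x ^+ 2) (weighted_sum X a s w))).
apply: le_trans (ler_normD _ _) _; apply: lerD => //.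
rewrite -RintegralB//; apply: le_trans (le_normr_Rintegral measurableT iKH) _.
set B := C * _ * _.
apply: le_trans (_ : \int[P]_w (fun=> B) w <= _).
  apply: le_Rintegral => //; first exact: integrable_norm iKH.
  exact: (bounded_rv_integrable P (M := `|B|)).
rewrite Rintegral_cst// (_ : fine _ = 1) ?mulr1//.
exact: (congr1 fine (probability_setT P)).
Qed.

End Lindeberg.

(** * From smooth test functions to distribution functions *)

Section GaussTail.
Context (R : realType).

(** Under the normal law, the identity is a random variable with distribution function [gauss_cdf],
    so the general limits of distribution functions at infinity apply. *)
Let idR : measurableTypeR R -> R := idfun.

#[local] HB.instance Definition _ :=
  @isMeasurableFun.Build _ _ _ _ idR (@measurable_id _ _ setT).

Lemma gauss_cdf_tail (e : R) : 0 < e -> exists M, 0 < M /\ forall x, M <= x ->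
  1 - e <= gauss_cdf x /\ gauss_cdf (- x) <= e.
Proof.
move=> e0.
pose X := idR : {RV (normal_prob (0 : R) 1) >-> R}.
have cy : gauss_cdf x @[x --> +oo] --> (1 : R) by exact: fine_cvg (cvg_cdfy1 X).
have cNy : gauss_cdf x @[x --> -oo] --> (0 : R) by exact: fine_cvg (cvg_cdfNy0 X).
move/cvgrPdist_le : cy => /(_ _ e0)[M1 [M1r HM1]].
move/cvgrPdist_le : cNy => /(_ _ e0)[M2 [M2r HM2]].
exists (1 + `|M1| + `|M2|); split=> [|x Mx].
  by rewrite ltr_wpDr// ltr_wpDr.
have := ler_norm M1; have := ler_norm (- M2); rewrite normrN => h2 h1.
have := normr_ge0 M1; have := normr_ge0 M2 => n2 n1.
split.
  have /HM1 : M1 < x by lra.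
  by rewrite ler_norml => /andP[_]; lra.
have /HM2 : - x < M2 by lra.
by rewrite sub0r normrN ger0_norm// gauss_cdf_ge0.
Qed.

(** The smoothing time is [h ^+ 4], of standard deviation [h ^+ 2]: as [h] tends to 0 the shift [h]
    vanishes, yet it is [1 / h] standard deviations long, so the Gaussian tails vanish too. *)
Lemma smoothing_width (r e : R) : 0 < e -> exists h : R, [/\ 0 < h,
  `|heat (r + h) (h ^+ 4 + 1) 0 - gauss_cdf r| <= e,
  `|heat (r - h) (h ^+ 4 + 1) 0 - gauss_cdf r| <= e,
  1 - e <= gauss_cdf (h / Num.sqrt (h ^+ 4)) &
  gauss_cdf (- (h / Num.sqrt (h ^+ 4))) <= e].
Proof.
move=> e0; have [M [M0 HM]] := gauss_cdf_tail e0.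
have cont (b : R) : {for 0, continuous (fun h : R => heat (r + b * h) (h ^+ 4 + 1) 0)}.
  have c4 : h ^+ 4 + 1 @[h --> (0 : R)] --> (0 : R) ^+ 4 + 1.
    by apply: cvgD; [exact: exprn_continuous|exact: cvg_cst].
  have csq : Num.sqrt (h ^+ 4 + 1) @[h --> (0 : R)] --> Num.sqrt ((0 : R) ^+ 4 + 1).
    exact: (cvg_comp _ _ c4 (@sqrt_continuous R _)).
  have c1 : (r + b * h - 0) / Num.sqrt (h ^+ 4 + 1) @[h --> (0 : R)] -->
      (r + b * 0 - 0) / Num.sqrt (0 ^+ 4 + 1).
    apply: cvgM.
      apply: cvgB; last exact: cvg_cst.
      apply: cvgD; first exact: cvg_cst.
      by apply: cvgM; [exact: cvg_cst|exact: cvg_id].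
    apply: (cvgV _ csq); by rewrite expr0n/= add0r sqrtr1 oner_neq0.
  exact: (cvg_comp _ _ c1 (@gauss_cdf_continuous R _)).
have at0 b : heat (r + b * 0) (0 ^+ 4 + 1) 0 = gauss_cdf r.
  by rewrite /heat mulr0 addr0 subr0 expr0n/= add0r sqrtr1 divr1.
have near1 b : \forall h \near (0 : R),
  `|heat (r + b * h) (h ^+ 4 + 1) 0 - gauss_cdf r| <= e.
  by have /cvgrPdist_le/(_ _ e0) := cont b; rewrite at0;
    apply: filterS => h; rewrite distrC.
have : \forall h \near (0 : R)^'+, [/\ 0 < h,
  `|heat (r + 1 * h) (h ^+ 4 + 1) 0 - gauss_cdf r| <= e,
  `|heat (r + -1 * h) (h ^+ 4 + 1) 0 - gauss_cdf r| <= e & h < M^-1].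
  near=> h; split.
  - near: h; exact: nbhs_right_gt.
  - near: h; apply: cvg_within; exact: near1.
  - near: h; apply: cvg_within; exact: near1.
  - near: h; apply: nbhs_right_lt; rewrite invr_gt0//.
move=> /filter_ex[h [h0 h1 h2 hM]]; exists h; split => //.
- by rewrite mul1r in h1.
- by rewrite mulN1r in h2.
all: rewrite (_ : h / _ = h^-1); last first.
1,3: by rewrite (_ : h ^+ 4 = (h ^+ 2) ^+ 2) ?sqrtr_sqr ?ger0_norm ?sqr_ge0//;
  [field; rewrite gt_eqF|ring].
all: have [] // := HM h^-1 _; by rewrite -[M]invrK lef_pV2 ?ltW// posrE invr_gt0.
Unshelve. all: by end_near. Qed.

End GaussTail.

Section CentralLimit.
Context d (T : measurableType d) (R : realType) (P : probability T R).
Context (I : choiceType) (X : I -> {RV P >-> R}).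
Hypotheses (indX : mutually_independent X) (idX : identically_distributed X).
Hypotheses (iX : forall i, P.-integrable setT (EFin \o X i))
  (mean0 : forall i, \int[P]_w X i w = 0)
  (iX2 : forall i, P.-integrable setT (EFin \o (fun w => X i w ^+ 2)))
  (var1 : forall i, \int[P]_w (X i w ^+ 2) = 1).

Lemma truncated_moment_identical i j (c : R) : 0 <= c ->
  truncated_moment P (X i) c = truncated_moment P (X j) c.
Proof.
move=> c0; pose F (y : R) := (y ^+ 2 * Num.min 1 (c * `|y|))%:E.
have mF : measurable_fun setT F.
  apply/measurable_EFinP; apply: measurable_funM; first exact: measurable_funX.
  apply: measurable_minr => //; apply: measurable_funM => //.
have F0 y : (0 <= F y)%E.
  by rewrite lee_fin mulr_ge0 ?sqr_ge0// le_min ler01 mulr_ge0.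
have E k : truncated_moment P (X k) c = fine (\int[distribution P (X k)]_y F y)%E.
  by rewrite ge0_integral_distribution.
rewrite !E; congr fine; apply: eq_measure_integral => A mA _.
exact: idX.
Qed.

(** Pointwise comparison of the indicator of [W <= r] with the two shifted smooth steps: on the
    wrong side of [r], each is at least [h] away from its own threshold and errs by a Gaussian tail
    at most. *)
Lemma probability_cdf_bounds (W : {RV P >-> R}) (r h s : R) : 0 < h -> 0 < s ->
  \int[P]_w heat (r - h) s (W w) - gauss_cdf (- (h / Num.sqrt s)) <=
    fine (P (W @^-1` `]-oo, r])) <=
  \int[P]_w heat (r + h) s (W w) + (1 - gauss_cdf (h / Num.sqrt s)).
Proof.
move=> h0 s0.
have q0 : 0 < Num.sqrt s by rewrite sqrtr_gt0.
have mA : measurable (W @^-1` `]-oo, r]).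
  by rewrite -[X in measurable X]setTI; exact: measurable_funPT.
have mI : measurable_fun setT (\1_(W @^-1` `]-oo, r]) : T -> R).
  exact: measurable_indic.
have -> : fine (P (W @^-1` `]-oo, r])) = \int[P]_w \1_(W @^-1` `]-oo, r]) w.
  by rewrite /Rintegral integral_indic// setIT.
have iI : P.-integrable setT (EFin \o (\1_(W @^-1` `]-oo, r]) : T -> R)).
  apply: (bounded_rv_integrable P (M := 1)) => // w.
  by rewrite indicE; case: (_ \in _); rewrite ?normr1 ?normr0.
have iH r' : P.-integrable setT (EFin \o (fun w => heat r' s (W w))).
  apply: (bounded_rv_integrable P (M := 1)) => [|w]; last exact: heat_norm_le1.
  by apply: measurableT_comp (measurable_heat _ _) _.
have iC (c : R) : P.-integrable setT (EFin \o (fun=> c)).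
  exact: (bounded_rv_integrable P (M := `|c|)).
have int_cst (c : R) : \int[P]_w (fun=> c) w = c.
  rewrite Rintegral_cst// (_ : fine _ = 1) ?mulr1//.
  exact: (congr1 fine (probability_setT P)).
apply/andP; split.
  rewrite -[X in _ - X]int_cst -RintegralB//.
  apply: le_Rintegral => //; first exact: (integrableB measurableT (iH _) (iC _)).
  move=> w _; rewrite indicE; case: (boolP (w \in _)) => [_|].
    by rewrite lerBlDr (le_trans (gauss_cdf_le1 _))// lerDl gauss_cdf_ge0.
  rewrite notin_setE/= in_itv/= => /negP; rewrite -ltNge => rW.
  rewrite subr_le0 gauss_cdf_le// -mulNr ler_pM2r ?invr_gt0//; lra.
rewrite -[X in _ + X]int_cst -RintegralD//.
apply: le_Rintegral => //; first exact: (integrableD measurableT (iH _) (iC _)).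
move=> w _; rewrite indicE; case: (boolP (w \in _)) => [|_]; last first.
  by rewrite addr_ge0 ?subr_ge0 ?gauss_cdf_le1 ?gauss_cdf_ge0.
rewrite inE/= in_itv/= => Wr.
rewrite addrCA -[X in X <= _]addr0 lerD2l subr_ge0 gauss_cdf_le//.
rewrite ler_pM2r ?invr_gt0//; lra.
Qed.

(** The threshold [c] depends on [r] and [e] only, not on the weights or the number of summands, as
    is required for weights that change with the size of the system. *)
Lemma central_limit (i0 : I) (r e : R) : 0 < e -> exists c, 0 < c /\
  forall a (s : seq I), uniq s -> \sum_(i <- s) a i ^+ 2 = 1 ->
    (forall i, i \in s -> `|a i| <= c) ->
  `|fine (P (weighted_sum X a s @^-1` `]-oo, r])) - gauss_cdf r| <= e.
Proof.
have aux (p g A B a b u v q : R) : A - v <= p -> p <= B + (1 - u) ->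
    `|B - b| <= q -> `|A - a| <= q -> `|b - g| <= q -> `|a - g| <= q ->
    1 - q <= u -> v <= q -> `|p - g| <= q * 3.
  rewrite !ler_norml => ? ? /andP[? ?] /andP[? ?] /andP[? ?] /andP[? ?] ? ?.
  by apply/andP; split; lra.
move=> e0; have e3 : 0 < e / 3 by rewrite divr_gt0.
have [h [h0 h1 h2 h3 h4]] := smoothing_width r e3.
have s0 : 0 < h ^+ 4 by rewrite exprn_gt0.
have [C [C0 HC]] := heat_step s0.
(* The Lindeberg error is [C * (t + c ^+ 2)]; each of the two terms is given [e / (6 * C)], for a
   total of [e / 3]. *)
have t0 : 0 < e / (6 * C) by rewrite divr_gt0// mulr_gt0.
have [c1 [c10 c11 Hc1]] := truncated_moment_small (iX2 i0) t0.
pose c := Num.min c1 (e / (6 * C)).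
have c0 : 0 < c by rewrite lt_min c10.
exists c; split=> // a s us a1 ac.
have tc i : truncated_moment P (X i) c <= e / (6 * C).
  rewrite (@truncated_moment_identical i i0 _ (ltW c0)); apply: le_trans Hc1.
  by apply: truncated_moment_le => //; [exact: ltW|rewrite ge_min lexx].
have cc : c ^+ 2 <= e / (6 * C).
  have : c <= 1 by rewrite ge_min c11.
  have : c <= e / (6 * C) by rewrite ge_min lexx orbT.
  by rewrite expr2; nra.
have lin r' := lindeberg indX iX mean0 iX2 var1 r' s0 (ltW C0) (ltW c0) (ltW t0)
  us ac tc HC (lexx _).
have {}lin r' : `|\int[P]_w heat r' (h ^+ 4) (weighted_sum X a s w) -
    heat r' (h ^+ 4 + 1) 0| <= e / 3.
  have := lin r'; rewrite a1 mulr1 => /le_trans; apply.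
  apply: (@le_trans _ _ (C * (e / (6 * C) + e / (6 * C)))).
    by rewrite ler_wpM2l ?lerD2l// ltW.
  by rewrite le_eqVlt; apply/orP; left; apply/eqP; field; rewrite gt_eqF.
have /andP[lo up] := probability_cdf_bounds (weighted_sum X a s) r h0 s0.
rewrite -[leRHS](@divfK _ 3) ?pnatr_eq0//.
exact: aux lo up (lin _) (lin _) h1 h2 h3 h4.
Qed.

End CentralLimit.

(** * The Gibbs measure *)

Section Coupling.
Context {R : realType}.

Lemma nonneg_sum_sup (f : nat -> R) (M : R) : (forall k, 0 <= f k) ->
  (forall K, \sum_(1 <= k < K) f k <= M) -> exists L,
  (forall K, \sum_(1 <= k < K) f k <= L) /\
  (forall e, 0 < e -> exists K, L - \sum_(1 <= k < K) f k <= e).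
Proof.
move=> f0 fM; pose A := [set \sum_(1 <= k < K) f k | K in [set: nat]].
have hA : has_sup A.
  by split; [exists (\sum_(1 <= k < 0) f k); exists 0%N|exists M => _ [K _ <-]].
exists (sup A); split=> [K|e e0].
  by apply: ub_le_sup; [exact: hA.2|exists K].
have [_ [K _ <-] H] := sup_adherent e0 hA.
by exists K; lra.
Qed.

Lemma sum_powR_le (s : R) : 1 < s -> exists M : R, forall K,
  \sum_(1 <= k < K) (k%:R `^ s)^-1 <= M.
Proof.
move=> s1; pose q : R := 2 `^ (1 - s).
have q0 : 0 < q by rewrite powR_gt0.
have q1 : q < 1.
  rewrite /q -opprB powRN invf_lt1 ?powR_gt0//.
  have h : 1 `^ (s - 1) = 1 :> R by rewrite powR1.
  rewrite -[ltLHS]h gt0_ltr_powR ?nnegrE ?subr_gt0//.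
  by rewrite ltr1n.
have dy j : \sum_(2 ^ j <= k < 2 ^ j.+1) (k%:R `^ s)^-1 <= q ^+ j.
  apply: (@le_trans _ _ (\sum_(2 ^ j <= k < 2 ^ j.+1) ((2 ^ j)%:R `^ s)^-1)).
    apply: ler_sum_nat => k /andP[jk _].
    rewrite lef_pV2 ?posrE ?powR_gt0 ?ltr0n ?expn_gt0//; last first.
      by rewrite (leq_trans _ jk)// expn_gt0.
    rewrite ge0_ler_powR ?nnegrE ?ler_nat//; lra.
  have e1 : (2 ^ j)%:R = 2 `^ j%:R :> R by rewrite natrX powR_mulrn.
  rewrite sumr_const_nat expnS mul2n -addnn addnK -(mulr_natr (_^-1)) e1.
  rewrite -powRrM -powRN -powRD; last by rewrite pnatr_eq0 implybT.
  rewrite /q -powR_mulrn ?powR_ge0// -powRrM.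
  by rewrite le_eqVlt; apply/orP; left; apply/eqP; congr (_ `^ _); ring.
have sum2 m : \sum_(1 <= k < 2 ^ m) (k%:R `^ s)^-1 <= (1 - q)^-1.
  apply: (@le_trans _ _ (\sum_(0 <= j < m) q ^+ j)).
    elim: m => [|m IH]; first by rewrite expn0 !big_geq.
    rewrite (@big_cat_nat _ _ _ (2 ^ m))//= ?expn_gt0 ?leq_exp2l//.
    by rewrite big_nat_recr//= lerD.
  have -> : \sum_(0 <= j < m) q ^+ j = (1 - q ^+ m) / (1 - q).
    elim: m => [|m IH]; first by rewrite big_geq// expr0 subrr mul0r.
    rewrite big_nat_recr//= IH exprS; field.
    by rewrite subr_eq0 gt_eqF.
  rewrite -[leRHS]mul1r ler_pM2r ?invr_gt0 ?subr_gt0// lerBlDr lerDl.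
  exact: exprn_ge0 (ltW q0).
exists (1 - q)^-1 => K; apply: le_trans (sum2 K).
have [K0|K0] := posnP K.
  by rewrite K0 [leLHS]big_geq//; apply: sumr_ge0 => k _; rewrite invr_ge0 powR_ge0.
rewrite [leRHS](@big_cat_nat _ _ _ K)//=; last by rewrite ltnW// ltn_expl.
by rewrite lerDl; apply: sumr_ge0 => k _; rewrite invr_ge0 powR_ge0.
Qed.

Definition coupling (alpha : \bar R) (k : nat) : R :=
  match alpha with
  | a%:E => (k%:R `^ a)^-1
  | +oo%E => (k == 1)%N%:R
  | -oo%E => 0
  end.

Variables (alpha : \bar R) (alpha_gt : ((3 / 2)%:E < alpha)%E).
Local Notation J := (coupling alpha).

Lemma coupling_ge0 k : 0 <= J k.
Proof. by rewrite /coupling; case: alpha => [a||] //=; rewrite invr_ge0 powR_ge0. Qed.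

Lemma coupling_noninc k l : (0 < k <= l)%N -> J l <= J k.
Proof.
move=> /andP[k0 kl]; move: alpha_gt; rewrite /coupling.
case: alpha => [a||]//=.
  rewrite lte_fin => a32; have l0 := leq_trans k0 kl.
  rewrite lef_pV2 ?posrE ?powR_gt0 ?ltr0n//.
  rewrite ge0_ler_powR ?nnegrE ?ler_nat//; lra.
by move=> _; rewrite ler_nat; lia.
Qed.

Lemma coupling1 : J 1 = 1.
Proof.
move: alpha_gt; rewrite /coupling; case: alpha => [a||]//= _.
by rewrite powR1 invr1.
Qed.

(** The square root lowers the exponent [a] to [a - 1/2], which exceeds 1 exactly when [a > 3/2]. *)
Lemma coupling_sqrt_summable : exists M : R, forall K,
  \sum_(1 <= k < K) J k * Num.sqrt k%:R <= M.
Proof.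
move: alpha_gt; rewrite /coupling; case: alpha => [a||]//=.
  rewrite lte_fin => a32; have s1 : 1 < a - 2^-1 by lra.
  have [M HM] := sum_powR_le s1; exists M => K; apply: le_trans (HM K).
  apply: ler_sum_nat => k /andP[k0 _].
  rewrite -powR12_sqrt// -powRN -[leRHS]powRN -powRD; last first.
    by rewrite pnatr_eq0 -lt0n k0 implybT.
  by rewrite le_eqVlt; apply/orP; left; apply/eqP; congr (_ `^ _); lra.
move=> _; exists 1 => K.
apply: (@le_trans _ _ (\sum_(1 <= k < K) (k == 1)%N%:R)).
  apply: ler_sum_nat => k _; case: eqP => [->|_]; rewrite ?mul0r//.
  by rewrite sqrtr1 mulr1.
have [K1|K1] := leqP K 1; first by rewrite big_geq.
rewrite big_ltn// eqxx big_nat big1 ?addr0// => k /andP[k1 _].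
by rewrite gtn_eqF.
Qed.

End Coupling.

(** * The Hamiltonian as a Toeplitz form *)

Section Hamiltonian.
Context {R : realType} (N : nat).
Local Notation n := N.*2.+1.

Definition profile (phi : int -> int) (i : nat) : R :=
  (phi (i%:Z - N%:Z))%:~R.

Lemma profile_out (phi : Omega N) i : (n <= i)%N ->
  profile (height phi) i = 0.
Proof.
move=> ni; rewrite /profile /height (_ : \val phi _ = 0)//.
have := valP phi; rewrite inE; apply; rewrite /Lambda/=.
by move=> /andP[]; lia.
Qed.

Lemma esum_pairs (g : int -> int -> \bar R) : (forall x y, (0 <= g x y)%E) ->
  (\esum_(p in [set p : int * int | (p.1 < p.2)%R]) g p.1 p.2 =
   \esum_(k in [set k : nat | (0 < k)%N]) \esum_(x in [set: int])
     g x (x + k%:Z)%R)%E.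
Proof.
move=> g0; rewrite esum_esum//.
rewrite (@reindex_esum R _ _ ([set k : nat | (0 < k)%N] `*`` (fun=> [set: int]))
  _ (fun z => (z.2, z.2 + z.1%:Z)))//.
split.
- by move=> [k x] /= [k0 _]; lia.
- move=> [k x] [l y] _ _ /= [-> e]; congr (_, _).
  by move: e; lia.
- move=> [x y] /= xy; exists (absz (y - x), x) => /=.
    by split=> //; lia.
  by congr (_, _); lia.
Qed.

Lemma esum_shift_autocorr (phi : Omega N) (c : R) (k : nat) : 0 <= c ->
  (\esum_(x in [set: int]) (c *
     ((height phi x - height phi (x + k%:Z)) ^+ 2)%:~R)%:E =
   (c * (autocorr n (profile (height phi)) k *+ 2))%:E)%E.
Proof.
move=> c0; pose F := profile (height phi).
(* Left ends of the pairs at distance [k] that meet the interval, which number [n + k]. For [i < k]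
   the left end lies outside, which matches the second sum of [autocorrE]. *)
pose e (i : nat) : int := i%:Z - N%:Z - k%:Z.
have c20 x : 0 <= c * ((height phi x - height phi (x + k%:Z)) ^+ 2)%:~R.
  by rewrite mulr_ge0// ler0z sqr_ge0.
have out x : ~ Lambda N x -> height phi x = 0.
  by move=> Nx; have := valP phi; rewrite inE; apply.
have einj : set_inj `I_(n + k) e by move=> i j _ _; rewrite /e; lia.
transitivity (\esum_(x in e @` `I_(n + k)) (c *
     ((height phi x - height phi (x + k%:Z)) ^+ 2)%:~R)%:E)%E.
  rewrite [RHS]esum_mkcond; apply: eq_esum => x _; case: ifPn => //.
  rewrite notin_setE => xe.
  have xN : x < - N%:Z - k%:Z \/ N%:Z < x.
    have [xN|Nx] := ltP x (- N%:Z - k%:Z); first by left.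
    right; rewrite ltNge; apply/negP => xN; apply: xe.
    by exists (absz (x + N%:Z + k%:Z)); rewrite /e/=; lia.
  rewrite !out ?subr0 ?expr0n ?mulr0//= /Lambda/=; move=> /andP[]; lia.
rewrite esum_image// esum_fset//; last by move=> i _; rewrite lee_fin.
rewrite -fsbig_ord sumEFin; congr EFin.
rewrite -(big_mkord xpredT (fun i => c * ((height phi (e i) -
  height phi (e i + k%:Z)) ^+ 2)%:~R)) -mulr_sumr; congr (_ * _).
rewrite autocorrE; last by move=> i; exact: profile_out.
rewrite (@big_cat_nat _ _ _ k)//= ?leq_addl// addrC; congr (_ + _).
  rewrite -{1}[k]add0n big_addn addnK; apply: eq_bigr => i _.
  rewrite rmorphXn/= rmorphB/= /profile; congr ((_ - _) ^+ 2).
    by congr ((height phi _)%:~R); rewrite /e; lia.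
  by congr ((height phi _)%:~R); rewrite /e; lia.
rewrite big_nat [RHS]big_nat; apply: eq_bigr => i ik.
rewrite [height phi (e i)]out; last by rewrite /Lambda/= /e => /andP[]; lia.
rewrite sub0r sqrrN rmorphXn/= /profile; congr (_%:~R ^+ 2).
by congr (height phi _); rewrite /e; lia.
Qed.

Variables (alpha : \bar R) (alpha_gt : ((3 / 2)%:E < alpha)%E) (D : R).
Local Notation J := (coupling alpha).
Hypotheses
  (D_ge : forall K, \sum_(1 <= k < K) J k *+ 2 <= D)
  (D_le : forall e : R, 0 < e -> exists K, D - \sum_(1 <= k < K) J k *+ 2 <= e).

Let J_ge0 k : 0 <= J k. Proof. exact: coupling_ge0. Qed.

(** By [toeplitz_formE] the partial sums miss the form by the excess of [D] times the squared norm,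
    and [D_le] makes this excess vanish in the limit. *)
Lemma esum_toeplitz (F : nat -> R) : (forall i, (n <= i)%N -> F i = 0) ->
  (\esum_(k in [set k : nat | (0 < k)%N]) (J k * (autocorr n F k *+ 2))%:E =
   (toeplitz_form J D n F F)%:E)%E.
Proof.
move=> F0; pose c k := J k * (autocorr n F k *+ 2).
have c0 k : 0 <= c k.
  by rewrite /c mulr_ge0// mulrn_wge0// autocorr_ge0.
rewrite -(@nneseries_esum _ (fun k => (c k)%:E) (fun k => (0 < k)%N)); last first.
  by move=> k _; rewrite lee_fin.
apply/cvg_lim => //.
have E K : (\sum_(0 <= k < K | (0 < k)%N) (c k)%:E =
    (\sum_(1 <= k < K) c k)%:E)%E.
  rewrite sumEFin; congr EFin; case: K => [|K]; first by rewrite !big_geq.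
  rewrite big_ltn_cond//= [LHS]big_nat_cond [RHS]big_nat.
  by apply: eq_bigl => -[|k]; rewrite /= ?andbT ?andbF.
under eq_fun do rewrite E.
apply: cvg_EFin; first by near=> K.
apply/cvgrPdist_le => e e0.
pose S := \sum_(0 <= i < n) F i ^+ 2.
have S0 : 0 <= S by apply: sumr_ge0 => i _; exact: sqr_ge0.
have S1 : 0 < S + 1 by rewrite ltr_wpDl.
have [K0 HK0] := D_le (divr_gt0 e0 S1).
exists (maxn K0 n) => // K /=; rewrite geq_max => /andP[K0K nK].
have DK : 0 <= D - \sum_(1 <= k < K) J k *+ 2 by rewrite subr_ge0.
rewrite (toeplitz_formE J D nK F0) /= -/S addrC addKr.
rewrite ger0_norm ?mulr_ge0//.
apply: (@le_trans _ _ (e / (S + 1) * S)); last first.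
  by rewrite mulrAC ler_pdivrMr// ler_wpM2l ?ltW// ltrDl.
rewrite ler_wpM2r// (le_trans _ HK0)// lerD2l lerN2.
have [->|K00] := posnP K0.
  by rewrite [leLHS]big_geq//; apply: sumr_ge0 => k _; rewrite mulrn_wge0.
rewrite [leRHS](@big_cat_nat _ _ _ K0)//= lerDl.
by apply: sumr_ge0 => k _; rewrite mulrn_wge0.
Unshelve. all: by end_near. Qed.

Lemma H0_toeplitz (phi : Omega N) : H0 alpha phi =
  toeplitz_form J D n (profile (height phi)) (profile (height phi)) / 2.
Proof.
rewrite mulrC /H0; congr (_ * _).
suff : (\esum_(p in [set p : int * int | (p.1 < p.2)%R])
    (J (absz (p.2 - p.1)) * ((height phi p.1 - height phi p.2) ^+ 2)%:~R)%:E =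
    (toeplitz_form J D n (profile (height phi)) (profile (height phi)))%:E)%E.
  move=> H; move: alpha_gt H; rewrite /coupling; case: alpha => [a| |]//= _ H.
    rewrite -[RHS]/(fine _%:E) -H; congr fine; apply: eq_esum => p /= p12.
    have -> : (p.2 - p.1)%:~R = (absz (p.2 - p.1))%:R :> R.
      by rewrite -[RHS]/((absz _)%:Z%:~R) gez0_abs// subr_ge0 ltW.
    by rewrite mulrC.
  rewrite -[RHS]/(fine _%:E) -H; congr fine.
  rewrite esum_mkcond [RHS]esum_mkcond; apply: eq_esum => p _.
  case: ifPn; rewrite ?notin_setE ?inE/= => p1.
    by rewrite ifT ?inE/=; [rewrite p1 mul1r|lia].
  case: ifPn; rewrite ?notin_setE ?inE/= => p12 //.
  by rewrite (_ : (_ == _) = false) ?mul0r//; apply/eqP => H'; apply: p1; lia.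
rewrite (esum_pairs (g := fun x y => (J (absz (y - x)) *
  ((height phi x - height phi y) ^+ 2)%:~R)%:E)); last first.
  by move=> x y; rewrite lee_fin mulr_ge0// ler0z sqr_ge0.
rewrite -esum_toeplitz; last by move=> i; exact: profile_out.
apply: eq_esum => k _; rewrite -esum_shift_autocorr//.
apply: eq_esum => x _; congr ((J _ * _)%:E); lia.
Qed.

End Hamiltonian.

(** * Summability of Gaussian weights over integer configurations *)

Section EsumComplements.
Context {R : realType}.
Local Open Scope ereal_scope.

Lemma esumZl (T : choiceType) (S : set T) (c : R) (a : T -> \bar R) :
  (0 <= c)%R -> (forall i, 0 <= a i) ->
  \esum_(i in S) (c%:E * a i) = c%:E * \esum_(i in S) a i.
Proof.
move=> c0 a0.
have le (c' : R) (b : T -> \bar R) : (0 <= c')%R -> (forall i, 0 <= b i) ->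
    \esum_(i in S) (c'%:E * b i) <= c'%:E * \esum_(i in S) b i.
  move=> c'0 b0; apply: ge_ereal_sup => _ [A [finA AS] <-].
  rewrite -ge0_mule_fsumr//; apply: lee_wpmul2l; first by rewrite lee_fin.
  by apply: ereal_sup_ubound; exists A.
apply/eqP; rewrite eq_le le//=.
have [->|c0'] := eqVneq c 0%R.
  by rewrite mul0e; apply: esum_ge0 => i _; rewrite mul0e.
have cp : (0 < c)%R by rewrite lt_neqAle eq_sym c0'.
rewrite -(@lee_pmul2l _ c^-1%:E)//; last by rewrite lte_fin invr_gt0.
rewrite muleA -EFinM mulVf// mul1e.
have c1 : (0 <= c^-1)%R by rewrite invr_ge0.
have ca i : 0 <= c%:E * a i by rewrite mule_ge0.
apply: le_trans (le _ _ c1 ca).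
by apply: le_esum => i _; rewrite muleA -EFinM mulVf// mul1e.
Qed.

Lemma esum_subset (T : choiceType) (A B : set T) (a : T -> \bar R) :
  A `<=` B -> (forall i, 0 <= a i) ->
  \esum_(i in A) a i <= \esum_(i in B) a i.
Proof.
move=> AB a0; rewrite esum_mkcond [leRHS]esum_mkcond; apply: le_esum => i _.
case: ifPn => [|_]; last by case: ifPn.
by rewrite inE => /AB iB; rewrite ifT ?inE.
Qed.

Lemma esum_geometric (r : R) : (0 <= r < 1)%R ->
  \esum_(k in [set: nat]) (r ^+ k)%:E <= ((1 - r)^-1)%:E.
Proof.
move=> /andP[r0 r1]; rewrite -nneseries_esumT; last first.
  by move=> k; rewrite lee_fin exprn_ge0.
have E m : (\sum_(0 <= j < m) r ^+ j = (1 - r ^+ m) / (1 - r))%R.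
  elim: m => [|j IH]; first by rewrite big_geq// expr0 subrr mul0r.
  rewrite big_nat_recr//= IH exprS; field.
  by rewrite subr_eq0 gt_eqF.
apply: lime_le; first by apply: is_cvg_nneseries => k _ _; rewrite lee_fin exprn_ge0.
near=> m; rewrite sumEFin lee_fin.
rewrite E -[leRHS]mul1r ler_pM2r ?invr_gt0 ?subr_gt0// lerBlDr lerDl.
exact: exprn_ge0.
Unshelve. all: by end_near. Qed.

(** On integers [k ^+ 2 >= |k|], so two geometric series dominate, one for each sign. *)
Lemma esum_int_gauss_lty (b : R) : (0 < b)%R ->
  \esum_(k in [set: int]) (expR (- b * (k%:~R) ^+ 2))%:E < +oo.
Proof.
move=> b0; pose r := expR (- b); have r0 : (0 <= r)%R by exact: expR_ge0.
have r1 : (r < 1)%R by rewrite -[ltRHS]expR0 ltr_expR oppr_lt0.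
have hr (k : int) : (expR (- b * (k%:~R) ^+ 2) <= r ^+ (absz k))%R.
  rewrite -expRM_natl ler_expR [leRHS]mulrC ler_nM2l ?oppr_lt0//.
  rewrite -[leLHS]/((absz k)%:Z%:~R) -rmorphXn/= ler_int.
  by case: k => k; rewrite ?NegzE expr2; nia.
have split : [set: int] = Posz @` [set: nat] `|` Negz @` [set: nat].
  by apply/seteqP; split=> // -[k|k] _; [left|right]; exists k.
have q0 : forall k : int, 0 <= (r ^+ (absz k))%:E by move=> k; rewrite lee_fin exprn_ge0.
apply: (@le_lt_trans _ _ (\esum_(k in [set: int]) (r ^+ (absz k))%:E)).
  by apply: le_esum => k _; rewrite lee_fin.
rewrite (esumID (Posz @` [set: nat]))// setTI setTI lte_add_pinfty//.
  rewrite esum_image; last by move=> i j _ _ [].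
  apply: le_lt_trans (ltry (1 - r)^-1); apply: le_trans (esum_geometric _) => //.
  by rewrite r0.
apply: (@le_lt_trans _ _ (\esum_(k in Negz @` [set: nat]) (r ^+ (absz k))%:E)).
  apply: esum_subset => // -[k|k] /=; last by move=> _; exists k.
  by move=> H; exfalso; apply: H; exists k.
rewrite esum_image; last by move=> i j _ _ [].
apply: le_lt_trans (ltry (1 - r)^-1); apply: le_trans (esum_geometric (r := r) _).
  apply: le_esum => k _; rewrite lee_fin /= exprS ler_piMl ?exprn_ge0//.
  exact: ltW.
by rewrite r0.
Qed.

Definition supported (m : nat) : set (nat -> int) :=
  [set f | forall i, (m <= i)%N -> f i = 0%R].

(** Induction on the number of coordinates: the last one splits off, and the sum factors into a
    one-dimensional Gaussian sum and the previous one. *)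
Lemma esum_supported_lty (b : R) (m : nat) : (0 < b)%R ->
  \esum_(f in supported m)
    (\prod_(0 <= i < m) expR (- b * ((f i)%:~R) ^+ 2))%:E < +oo.
Proof.
move=> b0; pose q (k : int) : R := expR (- b * (k%:~R) ^+ 2).
have q0 k : (0 <= q k)%R by exact: expR_ge0.
elim: m => [|m IH].
  rewrite (_ : supported 0 = [set (fun=> 0%R)]).
    by rewrite esum_set1 ?big_geq ?ltry// lee_fin.
  apply/seteqP; split => [f f0|f -> //]; apply/funext => i; exact: f0.
pose e (z : (nat -> int) * int) (i : nat) : int := if i == m then z.2 else z.1 i.
rewrite (@reindex_esum R _ _ (supported m `*`` (fun=> [set: int])) _ e); last first.
  split.
  - move=> [f k] /= [f0 _] i mi; rewrite /e/= ifN ?f0//; first exact: ltnW.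
    by rewrite gtn_eqF.
  - move=> [f k] [g l]; rewrite !inE/= => -[f0 _] [g0 _] fg.
    have efg i : e (f, k) i = e (g, l) i by rewrite fg.
    congr (_, _); last by have := efg m; rewrite /e/= eqxx.
    apply/funext => i; have := efg i; rewrite /e/=; case: eqP => // -> _.
    by rewrite f0// g0.
  - move=> f /= f0; exists (fun i => if i == m then 0%R else f i, f m).
      split => // i /= mi; case: eqP => // im; apply: f0.
      by rewrite ltn_neqAle mi eq_sym; case: eqP im.
    by apply/funext => i; rewrite /e/=; case: eqP => [->|].
rewrite (eq_esum (b := fun z =>
   (\prod_(0 <= i < m) q (z.1 i))%:E * (q z.2)%:E)); last first.
  move=> [f k] _; rewrite big_nat_recr//= -EFinM; congr ((_ * _)%:E).
    rewrite big_nat [RHS]big_nat; apply: eq_bigr => i /andP[_ im].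
    by rewrite /e ltn_eqF.
  by rewrite /e eqxx.
have p0 f : (0 <= \prod_(0 <= i < m) q (f i))%R by apply: prodr_ge0 => i _.
rewrite -(esum_esum (a := fun f k => (\prod_(0 <= i < m) q (f i))%:E * (q k)%:E));
  last by move=> f k _ _; rewrite mule_ge0// lee_fin.
have Bfin : \esum_(k in [set: int]) (q k)%:E \is a fin_num.
  by rewrite ge0_fin_numE ?esum_int_gauss_lty// esum_ge0// => k _; rewrite lee_fin.
rewrite (eq_esum (b := fun f =>
    (fine (\esum_(k in [set: int]) (q k)%:E))%:E *
    (\prod_(0 <= i < m) q (f i))%:E)); last first.
  by move=> f _; rewrite esumZl// fineK// muleC.
have B0 : (0 <= fine (\esum_(k in [set: int]) (q k)%:E))%R.
  by apply: fine_ge0; apply: esum_ge0 => k _; rewrite lee_fin.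
by rewrite esumZl// lte_mul_pinfty.
Qed.

End EsumComplements.

(** * Finiteness of the partition function and integer translations *)

Section GibbsMeasure.
Context {R : realType} (N : nat) (alpha : \bar R)
  (alpha_gt : ((3 / 2)%:E < alpha)%E) (D : R).
Local Notation n := N.*2.+1.
Local Notation J := (coupling alpha).
Hypotheses
  (D_ge : forall K, \sum_(1 <= k < K) J k *+ 2 <= D)
  (D_le : forall e : R, 0 < e -> exists K, D - \sum_(1 <= k < K) J k *+ 2 <= e).
Variables (lambda beta : R) (h : int -> R).
Hypothesis beta_gt0 : 0 < beta.
Local Notation F phi := (profile (R := R) N (height phi)).
Local Notation Q := (toeplitz_form J D n).
Local Notation ham := (hamiltonian alpha lambda h).

Let J_ge0 k : 0 <= J k. Proof. exact: coupling_ge0. Qed.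
Let J1 : J 1 = 1. Proof. exact: coupling1. Qed.

Definition field_profile (i : nat) : R := h (i%:Z - N%:Z).

Lemma sum_Lambda (f : int -> R) :
  \sum_(x \in Lambda N) f x = \sum_(0 <= i < n) f (i%:Z - N%:Z).
Proof.
rewrite big_mkord (@reindex_fsbig _ _ _ _ _ (fun i : nat => i%:Z - N%:Z) `I_n).
  by rewrite -fsbig_ord.
split.
- by move=> i /= iN; rewrite /Lambda/=; lia.
- by move=> i j _ _ /=; lia.
- by move=> x /= /andP[x1 x2]; exists (absz (x + N%:Z)) => /=; lia.
Qed.

Lemma hamiltonianE (phi : Omega N) : ham phi =
  Q (F phi) (F phi) / 2 -
  lambda * \sum_(0 <= i < n) field_profile i * F phi i.
Proof. by rewrite /hamiltonian (H0_toeplitz alpha_gt D_ge D_le) sum_Lambda. Qed.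

Lemma hamiltonian_coercive : exists C b, 0 < b /\ forall phi : Omega N,
  b * \sum_(0 <= i < n) F phi i ^+ 2 - C <= ham phi.
Proof.
pose m : R := n%:R; have m0 : 0 < m by rewrite ltr0n.
exists (\sum_(0 <= i < n) m ^+ 2 * (lambda * field_profile i) ^+ 2), (m ^+ 2 * 4)^-1.
have m2 : 0 < m ^+ 2 by exact: exprn_gt0.
split=> [|phi]; first by rewrite invr_gt0 mulr_gt0.
have := toeplitz_form_coercive J_ge0 J1 D_ge (@profile_out R N phi).
rewrite -/m hamiltonianE; set S := \sum_(_ <= i < _) F phi i ^+ 2 => SQ.
have h1 : S / (m ^+ 2 * 2) <= Q (F phi) (F phi) / 2.
  by rewrite invfM mulrA ler_pM2r// ler_pdivrMr// mulrC.
have h2 : lambda * \sum_(0 <= i < n) field_profile i * F phi i <=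
    S / (m ^+ 2 * 4) + \sum_(0 <= i < n) m ^+ 2 * (lambda * field_profile i) ^+ 2.
  rewrite /S mulr_suml mulr_sumr -big_split/=; apply: ler_sum => i _.
  rewrite mulrA; move: (lambda * _) (F phi i) => u v.
  have := sqr_ge0 (v / (m * 2) - m * u).
  (* Completing the square spends half of the Poincare bound [S / (2 m ^+ 2)] on the linear term;
     the other half is the announced [b]. *)
  have -> : (v / (m * 2) - m * u) ^+ 2 =
    v ^+ 2 / (m ^+ 2 * 4) + m ^+ 2 * u ^+ 2 - u * v.
    by field; rewrite gt_eqF.
  by rewrite subr_ge0.
have -> : (m ^+ 2 * 4)^-1 * S = S / (m ^+ 2 * 2) - S / (m ^+ 2 * 4).
  by field; rewrite gt_eqF.
by rewrite -addrA -opprD lerB.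
Qed.

(** Coercivity bounds the Boltzmann weight by a product of one-site Gaussian weights. Together with
    [partition_gt0], this excludes the default branch of [mnormalize]. *)
Lemma partition_lty : (boltzmann alpha lambda beta h (@setT (Omega N)) < +oo)%E.
Proof.
have [C [b [b0 HC]]] := hamiltonian_coercive.
have bb : 0 < beta * b by rewrite mulr_gt0.
pose pz (phi : Omega N) (i : nat) : int :=
  if (i < n)%N then height phi (i%:Z - N%:Z) else 0.
have pzF phi i : (i < n)%N -> ((pz phi i)%:~R : R) = F phi i by rewrite /pz => ->.
pose q (f : nat -> int) : R := \prod_(0 <= i < n)
  expR (- (beta * b) * ((f i)%:~R) ^+ 2).
have q0 f : 0 <= q f by apply: prodr_ge0 => i _; exact: expR_ge0.
apply: (@le_lt_trans _ _ (\esum_(phi in @setT (Omega N))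
    ((expR (beta * C))%:E * (q (pz phi))%:E))%E).
  apply: le_esum => phi _; rewrite -EFinM lee_fin /q.
  rewrite (eq_big_nat _ _ (F2 := fun i => expR (- (beta * b) * F phi i ^+ 2))).
    rewrite -expR_sum -expRD ler_expR -mulr_sumr.
    by have := HC phi => /(ler_wpM2l (ltW beta_gt0)); lra.
  by move=> i /andP[_ iN]; rewrite pzF.
rewrite esumZl ?expR_ge0//; last by move=> phi; rewrite lee_fin.
rewrite lte_mul_pinfty ?lee_fin ?expR_ge0//.
rewrite -(@esum_image _ _ _ _ pz (fun f => (q f)%:E)); last first.
  move=> phi psi _ _ e; apply: Omega_code_inj; rewrite /Omega_code.
  congr choice.pickle; apply/eq_in_map => i; rewrite mem_iota add0n => /= iN.
  by have := congr1 (@^~ i) e; rewrite /pz iN.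
apply: le_lt_trans (esum_supported_lty n bb).
apply: esum_subset => [_ [phi _ <-] i ni|f]; last by rewrite lee_fin.
by rewrite /pz ltnNge ni.
Qed.

Lemma partition_gt0 : (0 < boltzmann alpha lambda beta h (@setT (Omega N)))%E.
Proof.
apply: (@lt_le_trans _ _ (expR (- beta * ham point))%:E).
  by rewrite lte_fin expR_gt0.
rewrite -(@esum_set1 _ _ point (fun phi => (expR (- beta * ham phi))%:E)).
  by apply: esum_subset => // phi; rewrite lee_fin expR_ge0.
by rewrite lee_fin expR_ge0.
Qed.

Definition partition : R := fine (boltzmann alpha lambda beta h (@setT (Omega N))).

Lemma partitionE : boltzmann alpha lambda beta h (@setT (Omega N)) = partition%:E.
Proof.
by rewrite /partition fineK// ge0_fin_numE ?partition_lty// ltW// partition_gt0.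
Qed.

Lemma partition_pos : 0 < partition.
Proof. by rewrite -lte_fin -partitionE partition_gt0. Qed.

Lemma gibbs_set1 (phi : Omega N) : gibbs N alpha lambda beta h [set phi] =
  (partition^-1 * expR (- beta * ham phi))%:E.
Proof.
rewrite /gibbs/= /mnormalize; case: ifPn => [/orP[/eqP Z|/eqP Z]|_].
- have := partition_gt0.
  by rewrite (Z : boltzmann alpha lambda beta h (@setT (Omega N)) = 0%E) ltxx.
- have := partition_lty.
  by rewrite (Z : boltzmann alpha lambda beta h (@setT (Omega N)) = +oo%E) ltxx.
rewrite EFinM muleC; congr (_ * _)%E.
by rewrite /= /boltzmann esum_set1 ?lee_fin ?expR_ge0.
Qed.

(** [Omega_code] is injective, so its fibres split the space into countably many pieces, each a
    singleton or empty. *)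
Lemma integral_Omega (m : {measure set (Omega N) -> \bar R})
    (f : Omega N -> \bar R) : (forall phi, (0 <= f phi)%E) ->
  (\int[m]_phi f phi = \esum_(phi in setT) (f phi * m [set phi]))%E.
Proof.
move=> f0; pose B (i : nat) : set (Omega N) := [set phi | Omega_code phi = i].
have BT : \bigcup_i B i = setT.
  by apply/seteqP; split=> // phi _; exists (Omega_code phi).
have tB : trivIset setT B.
  by move=> i j _ _ [phi [<- <-]].
have mf (A : set (Omega N)) : measurable_fun A f by move=> _ Y _.
rewrite -BT ge0_integral_bigcup// nneseries_sum_bigcup//; last first.
  by move=> phi; exact: mule_ge0.
apply: eq_eseriesr => i _.
have [[phi Bphi]|/forallNP B0] := pselect (exists phi, B i phi).
  have -> : B i = [set phi].
    apply/seteqP; split=> [psi|_ ->//]; rewrite /B/= => e.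
    by apply: Omega_code_inj; rewrite e Bphi.
  rewrite esum_set1 ?mule_ge0// -integral_cst//.
  by apply: eq_integral => psi; rewrite inE => ->.
have -> : B i = set0 by apply/seteqP; split=> // phi /B0.
by rewrite integral_set0 esum_set0.
Qed.

Lemma integral_gibbs (f : Omega N -> R) : (forall phi, 0 <= f phi) ->
  (\int[gibbs N alpha lambda beta h]_phi (f phi)%:E =
   (partition^-1)%:E *
   \esum_(phi in setT) (f phi * expR (- beta * ham phi))%:E)%E.
Proof.
move=> f0; rewrite integral_Omega; last by move=> phi; rewrite lee_fin.
rewrite -esumZl ?invr_ge0 ?(ltW partition_pos)//; last first.
  by move=> phi; rewrite lee_fin mulr_ge0// expR_ge0.
apply: eq_esum => phi _.
transitivity ((f phi)%:E * (partition^-1 * expR (- beta * ham phi))%:E)%E.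
  by congr (_ * _)%E; exact: gibbs_set1.
by rewrite -!EFinM; congr EFin; ring.
Qed.

Definition translate_val (psi phi : Omega N) (x : int) : int :=
  height phi x + height psi x.

Lemma translate_subproof psi phi : translate_val psi phi \in Omega_set N.
Proof.
rewrite inE => x Lx; rewrite /translate_val /height.
by have := valP phi; have := valP psi; rewrite !inE => -> // ->.
Qed.

Definition translate psi phi : Omega N :=
  exist _ (translate_val psi phi) (translate_subproof psi phi).

Lemma reflect_subproof (psi : Omega N) : (fun x => - height psi x) \in Omega_set N.
Proof.
rewrite inE => x Lx; rewrite /height; have := valP psi.
by rewrite inE => -> //; rewrite oppr0.
Qed.

Definition reflect_field psi : Omega N :=
  exist _ (fun x => - height psi x) (reflect_subproof psi).

Lemma translateK psi : cancel (translate psi) (translate (reflect_field psi)).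
Proof.
move=> phi; apply: val_inj; apply/funext => x.
by rewrite /= /translate_val /height/= /translate_val addrK.
Qed.

Lemma profile_translate psi phi i : F (translate psi phi) i = F phi i + F psi i.
Proof. by rewrite /profile /height/= /translate_val rmorphD. Qed.

Lemma profile_reflect psi i : F (reflect_field psi) i = - F psi i.
Proof. by rewrite /profile /height/= rmorphN. Qed.

(** Derivative of the Hamiltonian at [phi] in the direction [V]; for [V] the indicator of a box it
    is the [X_l] of the overview. *)
Definition force (phi : Omega N) (V : nat -> R) : R :=
  \sum_(0 <= i < n) V i *
    (toeplitz_op J D n (F phi) i - lambda * field_profile i).

Lemma hamiltonian_translate (psi phi : Omega N) :
  ham (translate psi phi) =
  ham phi + force phi (F psi) + Q (F psi) (F psi) / 2.
Proof.
rewrite !hamiltonianE.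
have -> : Q (F (translate psi phi)) (F (translate psi phi)) =
    Q (F phi) (F phi) + Q (F psi) (F phi) *+ 2 + Q (F psi) (F psi).
  transitivity (Q (F phi) (F phi) + Q (F psi) (F phi) + Q (F phi) (F psi) +
    Q (F psi) (F psi)).
    rewrite /toeplitz_form -!big_split/=; apply: eq_bigr => i _.
    rewrite -!big_split/=; apply: eq_bigr => j _.
    by rewrite !profile_translate; ring.
  by rewrite (toeplitz_formC J D n (F phi)); ring.
have -> : force phi (F psi) = Q (F psi) (F phi) -
    lambda * \sum_(0 <= i < n) field_profile i * F psi i.
  rewrite toeplitz_op_form mulr_sumr -sumrB; apply: eq_bigr => i _; ring.
under eq_bigr do rewrite profile_translate mulrDr.
by rewrite big_split/= mulrDr; field.
Qed.

Lemma gibbs_exp_force (psi : Omega N) :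
  (\int[gibbs N alpha lambda beta h]_phi (expR (- beta * force phi (F psi)))%:E =
   (expR (beta * Q (F psi) (F psi) / 2))%:E)%E.
Proof.
rewrite integral_gibbs; last by move=> phi; exact: expR_ge0.
set c := expR _.
(* The Hamiltonian being quadratic, the exponential of the force turns the weight of [phi] into that
   of the translated configuration, up to a constant; resumming restores the partition function. *)
rewrite (eq_esum (b := fun phi =>
  c%:E * (expR (- beta * ham (translate psi phi)))%:E))%E; last first.
  move=> phi _; rewrite -EFinM /c -!expRD hamiltonian_translate.
  by congr (expR _)%:E; ring.
have c0 : 0 <= c by exact: expR_ge0.
have e0 phi : (0 <= (expR (- beta * ham (translate psi phi)))%:E)%E.
  by rewrite lee_fin expR_ge0.
rewrite (esumZl _ c0 e0) -(@reindex_esum _ _ _ setT setT (translate psi)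
  (fun phi => (expR (- beta * ham phi))%:E)).
  rewrite [X in (_ * (_ * X))%E](_ : _ = partition%:E); last exact: partitionE.
  rewrite -!EFinM mulrCA mulVf ?mulr1// gt_eqF//; exact: partition_pos.
split=> //.
- by move=> phi phi' _ _ /(can_inj (translateK psi)).
- move=> phi _; exists (translate (reflect_field psi) phi) => //.
  apply: val_inj; apply/funext => x.
  by rewrite /= /translate_val /height/= /translate_val subrK.
Qed.

End GibbsMeasure.

(** * Thermal fluctuations around the linear response *)

Section ThermalBound.
Context {R : realType} (N : nat) (alpha : \bar R)
  (alpha_gt : ((3 / 2)%:E < alpha)%E) (D : R).
Local Notation n := N.*2.+1.
Local Notation J := (coupling alpha).
Hypotheses
  (D_ge : forall K, \sum_(1 <= k < K) J k *+ 2 <= D)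
  (D_le : forall e : R, 0 < e -> exists K, D - \sum_(1 <= k < K) J k *+ 2 <= e).
Variables (lambda beta : R) (h : int -> R).
Hypothesis beta_gt0 : 0 < beta.
Local Notation F phi := (profile (R := R) N (height phi)).
Local Notation Q := (toeplitz_form J D n).
Local Notation P := (perimeter J D N).
Local Notation pull := (force alpha D lambda h).

Let J_ge0 k : 0 <= J k. Proof. exact: coupling_ge0. Qed.
Let J1 : J 1 = 1. Proof. exact: coupling1. Qed.
Let J_noninc k l : (0 < k <= l)%N -> J l <= J k.
Proof. exact: coupling_noninc. Qed.

Variable g : nat -> R.
Hypothesis g_out : forall i, (n <= i)%N -> g i = 0.
Hypothesis g_green :
  forall i, (i < n)%N -> toeplitz_op J D n g i = (i == N)%:R.

Definition box_val (l : nat) (x : int) : int :=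
  ((absz x <= l) && (absz x <= N))%N.

Lemma box_subproof l : box_val l \in Omega_set N.
Proof.
rewrite inE => x; rewrite /Lambda/= /box_val => xN.
by rewrite (_ : (_ && _) = false)//; apply/negP => /andP[_ H]; apply: xN; lia.
Qed.

Definition box_field l : Omega N := exist _ (box_val l) (box_subproof l).

Lemma profile_box l i : (l <= N)%N -> F (box_field l) i = box R N l i.
Proof.
move=> lN; rewrite /profile /height/= /box_val /box.
rewrite -[LHS]/((_ : nat)%:R); congr (_%:R); congr nat_of_bool; lia.
Qed.

Lemma exp_box_force (l : nat) (b : bool) : (l <= N)%N ->
  (\int[gibbs N alpha lambda beta h]_phi
     (expR ((-1) ^+ b * beta * pull phi (box R N l)))%:E =
   (expR (beta * P l / 2))%:E)%E.
Proof.
move=> lN; pose psi := if b then box_field l else reflect_field (box_field l).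
have Fpsi i : F psi i = - (-1) ^+ b * box R N l i.
  rewrite /psi; case: b {psi} => /=.
    by rewrite profile_box// expr1 opprK mul1r.
  by rewrite profile_reflect profile_box// expr0 mulN1r.
have <- : Q (F psi) (F psi) = P l.
  apply: eq_bigr => i _; apply: eq_bigr => j _; rewrite !Fpsi.
  by case: b {psi Fpsi} => /=; rewrite ?expr1 ?expr0; ring.
rewrite -(gibbs_exp_force alpha_gt D_ge D_le lambda h beta_gt0).
apply: eq_integral => phi _; congr (expR _)%:E.
rewrite /force !mulr_sumr; apply: eq_bigr => i _; rewrite Fpsi; ring.
Qed.

(** The threshold [p / 2] is the point: with [p = P l], the factor [exp (- beta p / 2)] cancels the
    exponential moments [exp (beta P l / 2)] exactly, so the second moment is of order [p ^+ 2 + 1]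
    rather than exponential in [p]. Beyond the threshold, a square is bounded by an exponential
    through [1 + v <= exp v]. *)
Lemma sqr_le_exp (X p : R) : 0 <= p -> X ^+ 2 <= p ^+ 2 / 2 +
  8 / beta ^+ 2 * expR (- (beta * p / 2)) *
   (expR (beta * X) + expR (- (beta * X))).
Proof.
move=> p0; pose Y := `|X| - p / 2.
have b2 : 0 < beta ^+ 2 by rewrite exprn_gt0.
have e1 : expR (beta * `|X|) <= expR (beta * X) + expR (- (beta * X)).
  have [X0|X0] := leP 0 X; first by rewrite ger0_norm// lerDl expR_ge0.
  by rewrite ltr0_norm// mulrN lerDr expR_ge0.
have XY : X ^+ 2 <= p ^+ 2 / 2 + 2 * Y ^+ 2.
  have -> : X ^+ 2 = `|X| ^+ 2 by rewrite real_normK// num_real.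
  have -> : `|X| = Y + p / 2 by rewrite /Y subrK.
  have := sqr_ge0 (Y - p / 2).
  rewrite (_ : (Y - p / 2) ^+ 2 =
    Y ^+ 2 * 2 + p ^+ 2 / 2 - (Y + p / 2) ^+ 2); last by field.
  lra.
have eY : expR (beta * Y) <= expR (- (beta * p / 2)) *
    (expR (beta * X) + expR (- (beta * X))).
  rewrite (_ : beta * Y = - (beta * p / 2) + beta * `|X|); last by rewrite /Y; ring.
  by rewrite expRD ler_wpM2l ?expR_ge0.
rewrite -mulrA; have [Y0|Y0] := leP 0 Y.
  have YE : Y ^+ 2 <= 4 / beta ^+ 2 * expR (beta * Y).
    have u0 : 0 <= beta * Y by rewrite mulr_ge0// ltW.
    have e2 : 1 + beta * Y / 2 <= expR (beta * Y / 2) by exact: expR_ge1Dx.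
    have -> : beta * Y = beta * Y / 2 + beta * Y / 2 by field.
    rewrite expRD mulrAC ler_pdivlMr//.
    move: (expR _) e2 => E e2.
    rewrite (_ : Y ^+ 2 * beta ^+ 2 = 4 * (beta * Y / 2) ^+ 2); last by field.
    have u2 : 0 <= beta * Y / 2 by rewrite divr_ge0.
    move: (beta * Y / 2) u2 e2 => u u2 e2.
    by rewrite -expr2 ler_wpM2l// lerXn2r ?nnegrE//; lra.
  apply: (le_trans XY); rewrite lerD2l.
  apply: (@le_trans _ _ (2 * (4 / beta ^+ 2 * expR (beta * Y)))).
    by rewrite ler_wpM2l.
  rewrite (_ : 2 * _ = 8 / beta ^+ 2 * expR (beta * Y)); last by field; rewrite gt_eqF.
  by rewrite ler_wpM2l// divr_ge0// ltW.
have Xp : X ^+ 2 <= p ^+ 2 / 4.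
  have -> : X ^+ 2 = `|X| ^+ 2 by rewrite real_normK// num_real.
  have -> : p ^+ 2 / 4 = (p / 2) ^+ 2 by field.
  by rewrite lerXn2r ?nnegrE ?divr_ge0//; rewrite /Y in Y0; lra.
apply: (le_trans Xp); apply: (@le_trans _ _ (p ^+ 2 / 2)).
  by have := sqr_ge0 p; lra.
rewrite lerDl; apply: mulr_ge0; first by rewrite divr_ge0// ltW.
by rewrite mulr_ge0 ?addr_ge0 ?expR_ge0.
Qed.

Definition linear_response : R :=
  lambda * \sum_(0 <= i < n) field_profile N h i * g i.

Lemma height_layers (phi : Omega N) :
  (height phi 0)%:~R - linear_response =
  \sum_(0 <= l < N.+1) jump N g l * pull phi (box R N l).
Proof.
have -> : \sum_(0 <= l < N.+1) jump N g l * pull phi (box R N l) = pull phi g.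
  rewrite /force; under eq_bigr do rewrite mulr_sumr.
  rewrite exchange_big/= big_nat [RHS]big_nat; apply: eq_bigr => i /andP[_ iN].
  rewrite (green_layers J_ge0 J1 D_ge g_out g_green iN) mulr_suml.
  by apply: eq_bigr => l _; rewrite mulrA.
have -> : pull phi g = toeplitz_form J D n g (F phi) - linear_response.
  rewrite toeplitz_op_form /linear_response mulr_sumr -sumrB.
  by apply: eq_bigr => i _; ring.
rewrite toeplitz_formC toeplitz_op_form big_mkord.
rewrite (bigD1 (Ordinal (_ : N < n)%N))//=; first by rewrite ltnS -addnn leq_addr.
move=> Nn; rewrite g_green// eqxx mulr1 big1 ?addr0.
  by rewrite /profile subrr.
move=> i iN; rewrite g_green// (_ : (i == N :> nat) = false) ?mulr0//.
exact/negbTE.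
Qed.

(** Cauchy-Schwarz with weights [c l * P l], whose sum is the total perimeter, leaves
    [\sum_l (c l / P l) * X_l ^+ 2]. The second moment of [X_l] is at most
    [P l ^+ 2 / 2 + 16 / beta ^+ 2], and [P l >= 1] turns the constant into a multiple of the
    perimeter. *)
Lemma thermal_bound :
  (\int[gibbs N alpha lambda beta h]_phi
    (((height phi 0)%:~R - linear_response) ^+ 2)%:E <=
  ((1 / 2 + 16 / beta ^+ 2) * total_perimeter J D N g ^+ 2)%:E)%E.
Proof.
pose T := total_perimeter J D N g; pose c := jump N g.
have c0 l : 0 <= c l by exact: (jump_ge0 J_ge0 J_noninc J1 D_ge g_out g_green).
have P1 l : (l < N.+1)%N -> 1 <= P l.
  by move=> lN; exact: (perimeter_ge1 J_ge0 J1 D_ge).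
have b2 : 0 < beta ^+ 2 by rewrite exprn_gt0.
have T0 : 0 <= T.
  rewrite /T /total_perimeter big_nat; apply: sumr_ge0 => l /P1 lP.
  by rewrite mulr_ge0// (le_trans ler01).
pose k l := T * (c l / P l) * (8 / beta ^+ 2 * expR (- (beta * P l / 2))).
pose A l := T * (c l / P l) * (P l ^+ 2 / 2).
pose G (phi : Omega N) (l : 'I_N.+1) := A l +
   (k l * expR (beta * pull phi (box R N l)) +
    k l * expR (- (beta * pull phi (box R N l)))).
have Pp (l : 'I_N.+1) : 0 < P l by rewrite (lt_le_trans ltr01)// P1.
have cP (l : 'I_N.+1) : 0 <= c l / P l by rewrite divr_ge0// ltW.
have k0 (l : 'I_N.+1) : 0 <= k l.
  apply: mulr_ge0; first exact: mulr_ge0.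
  by apply: mulr_ge0; [rewrite divr_ge0// ltW|exact: expR_ge0].
have A0 (l : 'I_N.+1) : 0 <= A l.
  by apply: mulr_ge0; [exact: mulr_ge0|rewrite divr_ge0// sqr_ge0].
have G0 phi l : 0 <= G phi l.
  by rewrite /G addr_ge0// addr_ge0// mulr_ge0// expR_ge0.
have mD (f : Omega N -> \bar R) : measurable_fun setT f by move=> _ Y _.
apply: (@le_trans _ _ (\int[gibbs N alpha lambda beta h]_phi
    \sum_(l < N.+1) (G phi l)%:E)%E).
  apply: ge0_le_integral => //.
  - by move=> phi _; rewrite lee_fin sqr_ge0.
  move=> phi _; rewrite sumEFin lee_fin height_layers big_mkord.
  have -> : \sum_(l < N.+1) jump N g l * pull phi (box R N l) =
      \sum_(l < N.+1) (c l * P l) * (1 * (pull phi (box R N l) / P l)).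
    by apply: eq_bigr => l _; rewrite /c; field; rewrite gt_eqF.
  have cs := cauchy_schwarz_weighted (index_enum 'I_N.+1) (c := fun l : 'I_N.+1 => c l * P l)
    (fun=> 1) (fun l : 'I_N.+1 => pull phi (box R N l) / P l).
  apply: le_trans (cs _) _; first by move=> l; rewrite mulr_ge0// ltW.
  under eq_bigr do rewrite expr1n mulr1.
  rewrite -[X in X * _](_ : T = _); last by rewrite /T /total_perimeter big_mkord.
  rewrite mulr_sumr; apply: ler_sum => l _.
  have := sqr_le_exp (pull phi (box R N l)) (ltW (Pp l)).
  rewrite /G /A /k; move: (pull _ _) => X HX.
  rewrite (_ : T * (c l * P l * (X / P l) ^+ 2) = T * (c l / P l) * X ^+ 2); last first.
    by field; rewrite gt_eqF.
  apply: le_trans (ler_wpM2l (mulr_ge0 T0 (cP l)) HX) _.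
  by rewrite le_eqVlt; apply/orP; left; apply/eqP; ring.
rewrite ge0_integral_sum//; last by move=> l phi _; rewrite lee_fin.
rewrite /T -/T; apply: (@le_trans _ _ (\sum_(l < N.+1)
    (T * (c l * P l) * (1 / 2 + 16 / beta ^+ 2))%:E)%E); last first.
  rewrite sumEFin lee_fin -mulr_suml -mulr_sumr.
  rewrite -[X in T * X](_ : T = _); last by rewrite /T /total_perimeter big_mkord.
  by rewrite mulrC expr2.
apply: lee_sum => l _.
have lN : (l <= N)%N by rewrite -ltnS.
rewrite /G; under eq_integral do rewrite 2!EFinD.
have e0 (b : R) : (0 <= (k l * expR b)%:E)%E.
  by rewrite lee_fin mulr_ge0 ?expR_ge0.
rewrite ge0_integralD//; last 2 first.
- by move=> phi _; rewrite lee_fin.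
- by move=> phi _; apply: adde_ge0; exact: e0.
rewrite ge0_integralD//.
under [X in (_ + (X + _))%E]eq_integral do rewrite EFinM.
under [X in (_ + (_ + X))%E]eq_integral do rewrite EFinM.
rewrite !ge0_integralZl//; try (by move=> phi _; rewrite lee_fin expR_ge0);
  try by rewrite lee_fin.
have E0 := exp_box_force false lN; have E1 := exp_box_force true lN.
rewrite (_ : (\int[_]_x (expR (beta * pull x (box R N l)))%:E)%E =
    (expR (beta * P l / 2))%:E); last first.
  by rewrite -E0; apply: eq_integral => phi _; rewrite expr0 mul1r.
rewrite (_ : (\int[_]_x (expR (- (beta * pull x (box R N l))))%:E)%E =
    (expR (beta * P l / 2))%:E); last first.
  by rewrite -E1; apply: eq_integral => phi _; rewrite expr1 mulN1r mulNr.
rewrite integral_cst// [X in ((A l)%:E * X)%E](_ : _ = 1%E); last first.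
  exact: probability_setT.
rewrite mule1 -!EFinM -!EFinD lee_fin.
have ee : expR (- (beta * P l / 2)) * expR (beta * P l / 2) = 1.
  by rewrite -expRD addNr expR0.
rewrite /A /k.
rewrite (_ : _ + _ = T * c l * (P l / 2 + 16 / beta ^+ 2 / P l *
  (expR (- (beta * P l / 2)) * expR (beta * P l / 2)))); last first.
  by field; rewrite !gt_eqF.
rewrite ee mulr1 (_ : T * (c l * P l) * _ =
  T * c l * (P l / 2 + 16 / beta ^+ 2 * P l)); last by ring.
apply: ler_wpM2l; first exact: mulr_ge0.
rewrite lerD2l; apply: ler_wpM2l; first by rewrite divr_ge0// ltW.
by rewrite (le_trans _ (P1 l (ltn_ord l)))// invf_le1// P1.
Qed.

End ThermalBound.

(** * The annealed law *)

Lemma integral_affine d (T : measurableType d) (R : realType)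
    (m : probability T R) (a b : R) (f : T -> \bar R) : 0 <= a -> 0 <= b ->
  measurable_fun setT f -> (forall w, 0 <= f w)%E ->
  (\int[m]_w (a%:E + b%:E * f w) = a%:E + b%:E * \int[m]_w f w)%E.
Proof.
move=> a0 b0 mf f0.
have mbf : measurable_fun setT (fun w => b%:E * f w)%E by exact: measurable_funeM.
have bf0 w : (0 <= b%:E * f w)%E by rewrite mule_ge0.
rewrite ge0_integralD// integral_cst// ge0_integralZl//.
by rewrite [X in (_ * X)%E](_ : _ = 1%E) ?mule1//; exact: probability_setT.
Qed.

(** * Consequences of a mean square bound around a constant *)

Section MeanSquareConcentration.
Context d (T : measurableType d) (R : realType) (m : probability T R).
Variables (X : T -> R) (u B : R).
Hypotheses (mX : measurable_fun setT X)
  (XB : (\int[m]_w ((X w - u) ^+ 2)%:E <= B%:E)%E).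

Let mXu : measurable_fun setT (fun w => (X w - u) ^+ 2).
Proof. by apply: measurable_funX; exact: measurable_funB. Qed.

Let far (e : R) : set T := [set w | e <= `|X w - u|].

Let measurable_far e : measurable (far e).
Proof.
have mf : measurable_fun setT (fun w => `|X w - u|).
  by apply: measurableT_comp => //; exact: measurable_funB.
rewrite (_ : far e = (fun w => `|X w - u|) @^-1` `[e, +oo[).
  by rewrite -[X in measurable X]setTI; exact: mf.
by apply/seteqP; split => w /=; rewrite in_itv/= andbT.
Qed.

Lemma deviation_le (e : R) : 0 < e ->
  (m [set w | (e <= `|X w - u|)%R] <= (B / e ^+ 2)%R%:E)%E.
Proof.
move=> e0; have e2 : 0 < e ^+ 2 by exact: exprn_gt0.
rewrite -/(far e); set A := far e; have mA : measurable A := measurable_far e.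
rewrite mulrC EFinM lee_pdivlMl//; apply: le_trans XB.
have -> : m A = (\int[m]_w (\1_A w)%:E)%E by rewrite integral_indic// setIT.
have m1A : measurable_fun setT (EFin \o (\1_A : T -> R)) by exact/measurable_EFinP.
rewrite -ge0_integralZl//; last by rewrite lee_fin ltW.
apply: ge0_le_integral => //.
- by move=> w _; rewrite -EFinM lee_fin mulr_ge0// ltW.
- exact: emeasurable_funM.
- exact/measurable_EFinP.
move=> w _; rewrite -EFinM lee_fin indicE; have [wA|wA] := boolP (w \in A).
  move: wA; rewrite inE /A/= => ew; rewrite mulr1.
  by rewrite -(real_normK (num_real (X w - u))) lerXn2r ?nnegrE// ltW.
by rewrite mulr0 sqr_ge0.
Qed.

Let B0 : 0 <= B.
Proof.
rewrite -lee_fin; apply: le_trans XB; apply: integral_ge0 => w _.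
by rewrite lee_fin sqr_ge0.
Qed.

Let measurable_le t : measurable [set w | X w <= t].
Proof.
rewrite -[X in measurable X]setTI.
rewrite (_ : [set w | _] = X @^-1` `]-oo, t]); first exact: mX.
by apply/seteqP; split => w /=; rewrite in_itv.
Qed.

(** Either the indicator is already 1, or [u > t + e] and then [X <= t] forces a deviation of at
    least [e]. *)
Lemma cdf_le_shift (t e : R) : 0 < e ->
  (m [set w | (X w <= t)%R] <= ((u <= t + e)%R%:R + B / e ^+ 2)%R%:E)%E.
Proof.
move=> e0; have [ut|tu] := leP u (t + e).
  apply: le_trans (probability_le1 m (measurable_le t)) _.
  by rewrite lee_fin lerDl divr_ge0// sqr_ge0.
rewrite add0r; apply: le_trans (deviation_le e0); apply: le_measure.
- by rewrite inE.
- by rewrite inE; exact: measurable_far.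
by move=> w /= Xt; rewrite ler_normr; apply/orP; right; lra.
Qed.

Lemma cdf_ge_shift (t e : R) : 0 < e ->
  (((u <= t - e)%R%:R)%R%:E <= m [set w | (X w <= t)%R] + (B / e ^+ 2)%R%:E)%E.
Proof.
move=> e0; have [ut|tu] := leP u (t - e); last first.
  by rewrite adde_ge0// lee_fin divr_ge0 ?sqr_ge0.
rewrite -[leLHS](probability_setT m).
apply: le_trans (leeD2l _ (deviation_le e0)).
have mA := measurable_far e.
apply: le_trans (measureU2 _ (measurable_le t) mA).
apply: le_measure; rewrite ?inE//; first exact: measurableU.
move=> w _ /=; have [Xt|tX] := leP (X w) t; [by left|right].
by rewrite /far/= ler_normr; apply/orP; left; lra.
Qed.

Let dist : T -> \bar R := fun w => ((X w - u) ^+ 2)%:E.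

Let dist_ge0 w : (0 <= dist w)%E.
Proof. by rewrite lee_fin sqr_ge0. Qed.

Let mdist : measurable_fun setT dist.
Proof. exact/measurable_EFinP. Qed.

Let sqr : T -> \bar R := fun w => (X w ^+ 2)%:E.

Let sqr_ge0 w : (0 <= sqr w)%E.
Proof. by rewrite lee_fin sqr_ge0. Qed.

Let msqr : measurable_fun setT sqr.
Proof. by apply/measurable_EFinP; exact: measurable_funX. Qed.

(** Young's inequality with parameter [a], pointwise. The relative error [1 + a] suits a [B] that is
    small only in comparison with the variance of the centre. *)
Lemma second_moment_le (a : R) : 0 < a ->
  (\int[m]_w (X w ^+ 2)%:E <= ((1 + a) * u ^+ 2 + (1 + a^-1) * B)%:E)%E.
Proof.
move=> a0; have ai : 0 < a^-1 by rewrite invr_gt0.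
have a1 : 0 <= (1 + a) * u ^+ 2 by rewrite mulr_ge0 ?exprn_even_ge0//; lra.
have b1 : 0 <= 1 + a^-1 by lra.
have mg : measurable_fun setT
    (fun w => ((1 + a) * u ^+ 2)%:E + (1 + a^-1)%:E * dist w)%E.
  by apply: emeasurable_funD => //; exact: measurable_funeM.
apply: (@le_trans _ _
    (\int[m]_w (((1 + a) * u ^+ 2)%:E + (1 + a^-1)%:E * dist w))%E).
  apply: ge0_le_integral => //; first by move=> w _; exact: sqr_ge0.
  move=> w _; rewrite lee_fin; have := Num.Theory.sqr_ge0 (a * u - (X w - u)).
  rewrite -(pmulr_rge0 _ ai) (_ : a^-1 * _ = (1 + a) * u ^+ 2 +
    (1 + a^-1) * (X w - u) ^+ 2 - X w ^+ 2).
    by rewrite subr_ge0.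
  by field; rewrite gt_eqF.
by rewrite integral_affine// [leRHS]EFinD leeD2l// [leRHS]EFinM lee_wpmul2l// lee_fin.
Qed.

Lemma second_moment_ge (a : R) : 0 < a ->
  ((u ^+ 2)%:E <=
   (1 + a)%:E * \int[m]_w (X w ^+ 2)%:E + ((1 + a^-1) * B)%:E)%E.
Proof.
move=> a0; have ai : 0 < a^-1 by rewrite invr_gt0.
have a1 : 0 <= 1 + a by lra.
have b1 : 0 <= 1 + a^-1 by lra.
have m1 : measurable_fun setT (fun w => (1 + a)%:E * sqr w)%E.
  exact: measurable_funeM.
have m2 : measurable_fun setT (fun w => (1 + a^-1)%:E * dist w)%E.
  exact: measurable_funeM.
have p1 w : (0 <= (1 + a)%:E * sqr w)%E by rewrite mule_ge0.
have p2 w : (0 <= (1 + a^-1)%:E * dist w)%E by rewrite mule_ge0.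
apply: (@le_trans _ _
    (\int[m]_w ((1 + a)%:E * sqr w + (1 + a^-1)%:E * dist w))%E).
  have -> : (u ^+ 2)%:E = (\int[m]_w cst (u ^+ 2)%:E w)%E.
    rewrite integral_cst// [X in (_ * X)%E](_ : _ = 1%E) ?mule1//.
    exact: probability_setT.
  apply: ge0_le_integral => //.
  - by move=> w _; rewrite lee_fin exprn_even_ge0.
  - exact: emeasurable_funD.
  move=> w _; rewrite lee_fin.
  have := Num.Theory.sqr_ge0 (a * X w + (X w - u)).
  rewrite -(pmulr_rge0 _ ai) (_ : a^-1 * _ = (1 + a) * X w ^+ 2 +
    (1 + a^-1) * (X w - u) ^+ 2 - u ^+ 2).
    by rewrite subr_ge0.
  by field; rewrite gt_eqF.
rewrite ge0_integralD// !ge0_integralZl//.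
by rewrite leeD2l// [leRHS]EFinM lee_wpmul2l// lee_fin.
Qed.

End MeanSquareConcentration.

(** * Averaging over the disorder *)

Section Mixture.
Context d d' (T : measurableType d) (Y : measurableType d') (R : realType)
  (P : probability T R) (k : T -> probability Y R).
Hypothesis mk : forall U, measurable U ->
  measurable_fun [set: T] (fun w => k w U).
Variables (X : Y -> R) (u : T -> R) (B : R).
Hypotheses (mX : measurable_fun setT X) (mu : measurable_fun setT u)
  (XB : forall w, (\int[k w]_y ((X y - u w) ^+ 2)%:E <= B%:E)%E).

Let below t : set Y := [set y | X y <= t].

Let measurable_below t : measurable (below t).
Proof.
rewrite (_ : below t = X @^-1` `]-oo, t]); last first.
  by apply/seteqP; split => y /=; rewrite in_itv.
by rewrite -[X in measurable X]setTI; exact: mX.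
Qed.

Let u_below t : set T := u @^-1` `]-oo, t].

Let measurable_u_below t : measurable (u_below t).
Proof. by rewrite -[X in measurable X]setTI; exact: mu. Qed.

Let indic_u_below t w : \1_(u_below t) w = (u w <= t)%R%:R :> R.
Proof.
by rewrite indicE; congr (nat_of_bool _)%:R; apply/idP/idP;
  rewrite inE /u_below/= in_itv.
Qed.

Let integral_u_below t :
  (\int[P]_w ((u w <= t)%R%:R%:E) = P (u_below t))%E.
Proof.
rewrite -[in RHS](setIT (u_below t)) -integral_indic//.
by apply: eq_integral => w _; rewrite indic_u_below.
Qed.

Let measurable_indic_u t : measurable_fun setT (fun w => (u w <= t)%R%:R%:E : \bar R).
Proof.
under eq_fun do rewrite -indic_u_below.
exact/measurable_EFinP/measurable_indic.
Qed.

Let integral_addc (f : T -> \bar R) (c : R) : 0 <= c ->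
  measurable_fun setT f -> (forall w, 0 <= f w)%E ->
  (\int[P]_w (f w + c%:E) = \int[P]_w f w + c%:E)%E.
Proof.
move=> c0 mf f0; under eq_integral do rewrite addeC -[X in (_ + X)%E]mul1e.
by rewrite integral_affine// mul1e addeC.
Qed.

Let B0 : 0 <= B.
Proof.
rewrite -lee_fin; apply: le_trans (XB point); apply: integral_ge0 => y _.
by rewrite lee_fin sqr_ge0.
Qed.

Lemma mixture_cdf_le (t e : R) : 0 < e ->
  (\int[P]_w k w [set y | (X y <= t)%R] <=
   P (u @^-1` `]-oo, (t + e)%R]) + (B / e ^+ 2)%R%:E)%E.
Proof.
move=> e0; have Be : 0 <= B / e ^+ 2 by rewrite divr_ge0// sqr_ge0.
rewrite -/(u_below _) -integral_u_below -integral_addc//.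
apply: ge0_le_integral => //.
- by apply: mk; exact: measurable_below.
- by apply: emeasurable_funD => //; exact: measurable_indic_u.
by move=> w _; rewrite -EFinD; apply: cdf_le_shift.
Qed.

Lemma mixture_cdf_ge (t e : R) : 0 < e ->
  (P (u @^-1` `]-oo, (t - e)%R]) <=
   \int[P]_w k w [set y | (X y <= t)%R] + (B / e ^+ 2)%R%:E)%E.
Proof.
move=> e0; have Be : 0 <= B / e ^+ 2 by rewrite divr_ge0// sqr_ge0.
have mb : measurable_fun setT (fun w => k w (below t)).
  by apply: mk; exact: measurable_below.
rewrite -/(u_below _) -integral_u_below -integral_addc//.
apply: ge0_le_integral => //.
- by apply: emeasurable_funD.
by move=> w _; apply: cdf_ge_shift.
Qed.

Let inner w : \bar R := \int[k w]_y (X y ^+ 2)%:E.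

Let measurable_inner : measurable_fun setT inner.
Proof.
apply: measurable_fun_integral_kernel => //.
  by move=> y; rewrite lee_fin sqr_ge0.
by apply/measurable_EFinP; exact: measurable_funX.
Qed.

Let inner_ge0 w : (0 <= inner w)%E.
Proof. by apply: integral_ge0 => y _; rewrite lee_fin sqr_ge0. Qed.

Let usqr w : \bar R := (u w ^+ 2)%:E.

Let usqr_ge0 w : (0 <= usqr w)%E.
Proof. by rewrite lee_fin sqr_ge0. Qed.

Let measurable_usqr : measurable_fun setT usqr.
Proof. by apply/measurable_EFinP; exact: measurable_funX. Qed.

Lemma mixture_second_moment_le (a : R) : 0 < a ->
  (\int[P]_w \int[k w]_y (X y ^+ 2)%:E <=
   (1 + a)%:E * \int[P]_w (u w ^+ 2)%:E + ((1 + a^-1) * B)%:E)%E.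
Proof.
move=> a0; have ai : 0 < a^-1 by rewrite invr_gt0.
have a1 : 0 <= 1 + a by lra.
have b1 : 0 <= (1 + a^-1) * B by rewrite mulr_ge0//; lra.
rewrite addeC -(integral_affine P b1 a1 measurable_usqr usqr_ge0).
apply: ge0_le_integral => //.
- by move=> w _; exact: inner_ge0.
- by apply: emeasurable_funD => //; exact: measurable_funeM.
by move=> w _; rewrite addeC -EFinM -EFinD; apply: second_moment_le.
Qed.

Lemma mixture_second_moment_ge (a : R) : 0 < a ->
  (\int[P]_w (u w ^+ 2)%:E <=
   (1 + a)%:E * \int[P]_w \int[k w]_y (X y ^+ 2)%:E + ((1 + a^-1) * B)%:E)%E.
Proof.
move=> a0; have ai : 0 < a^-1 by rewrite invr_gt0.
have a1 : 0 <= 1 + a by lra.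
have b1 : 0 <= (1 + a^-1) * B by rewrite mulr_ge0//; lra.
rewrite addeC -(integral_affine P b1 a1 measurable_inner inner_ge0).
apply: ge0_le_integral => //.
- by move=> w _; exact: usqr_ge0.
- by apply: emeasurable_funD => //; exact: measurable_funeM.
by move=> w _; rewrite addeC; apply: second_moment_ge.
Qed.

End Mixture.

Section WeightedSumVariance.
Context d (T : measurableType d) (R : realType) (P : probability T R).
Context (I : choiceType) (X : I -> {RV P >-> R}) (a : I -> R).
Hypotheses (indX : mutually_independent X)
  (iX : forall i, P.-integrable setT (EFin \o X i))
  (mean0 : forall i, \int[P]_w X i w = 0)
  (iX2 : forall i, P.-integrable setT (EFin \o (fun w => X i w ^+ 2)))
  (var1 : forall i, \int[P]_w (X i w ^+ 2) = 1).

(** The cross term has mean zero. The right side is kept in the affine form that [integral_affine]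
    consumes in the induction on the sequence. *)
Let integral_shifted_sqr (i : I) (b c : R) :
  (\int[P]_w ((b + c * X i w) ^+ 2)%:E = ((c ^+ 2)%:E + 1%:E * (b ^+ 2)%:E))%E.
Proof.
have iC (r : R) : P.-integrable setT (EFin \o (fun=> r)).
  exact: (bounded_rv_integrable P (M := `|r|)).
have i1 : P.-integrable setT (EFin \o (fun w => 2 * b * c * X i w)).
  by have := integrableZl measurableT (2 * b * c) (iX i).
have i2 : P.-integrable setT (EFin \o (fun w => c ^+ 2 * X i w ^+ 2)).
  by have := integrableZl measurableT (c ^+ 2) (iX2 i).
have i12 := integrableD measurableT i1 i2.
have e : (fun w => (b + c * X i w) ^+ 2) =
    (fun w => b ^+ 2 + (2 * b * c * X i w + c ^+ 2 * X i w ^+ 2)).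
  by apply/funext => w; ring.
have : \int[P]_w ((b + c * X i w) ^+ 2) = c ^+ 2 + b ^+ 2.
  rewrite e (RintegralD measurableT (iC (b ^+ 2)) i12).
  rewrite (RintegralD measurableT i1 i2) !RintegralZl// mean0 var1 Rintegral_cst//.
  rewrite (_ : fine _ = 1); last exact: (congr1 fine (probability_setT P)).
  by ring.
rewrite /Rintegral mul1e -EFinD => <-; rewrite fineK//.
apply: integrable_fin_num => //.
rewrite (_ : (fun w => _) = (fun w => (EFin \o (fun=> (b ^+ 2)%R)) w +
    (EFin \o (fun w => (2 * b * c * X i w + c ^+ 2 * X i w ^+ 2)%R)) w)%E).
  exact: (integrableD measurableT (iC _) i12).
by apply/funext => w /=; rewrite -EFinD; congr EFin; ring.
Qed.

Lemma weighted_sum_variance (s : seq I) : uniq s ->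
  (\int[P]_w (weighted_sum X a s w ^+ 2)%:E = (\sum_(i <- s) a i ^+ 2)%:E)%E.
Proof.
elim: s => [_|x s IH xs].
  rewrite big_nil; under eq_integral do rewrite /weighted_sum big_nil expr0n/=.
  exact: integral0.
have us : uniq s by case/andP: xs.
rewrite (weighted_sum_cons_integral a indX (F := fun z => (z ^+ 2)%:E))//; last 2 first.
- by apply/measurable_EFinP; exact: measurable_funX.
- by move=> z; rewrite lee_fin sqr_ge0.
under eq_integral do rewrite integral_shifted_sqr.
rewrite integral_affine ?sqr_ge0//; last 2 first.
- by apply/measurable_EFinP; exact: measurable_funX.
- by move=> w; rewrite lee_fin sqr_ge0.
by rewrite IH// mul1e -EFinD big_cons.
Qed.

End WeightedSumVariance.

(** * Change of normalisation *)

Section NormalisedLimit.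
Context {R : realType}.
Implicit Types tau S B F r h del : R.

(** The error [(1 + h^-1) * B] is at most [(h ^+ 2 + h) * tau ^+ 2], which completes the upper bound
    to the square of [(1 + h) * tau]. For [h <= 1/4], the lower bound dominates the square of
    [(1 - 2 * h) * tau]. *)
Lemma sqrt_ratio_close tau S B h : 0 < tau -> 0 < h <= 1 / 4 ->
  B <= h ^+ 2 * tau ^+ 2 ->
  S <= (1 + h) * tau ^+ 2 + (1 + h^-1) * B ->
  tau ^+ 2 <= (1 + h) * S + (1 + h^-1) * B ->
  0 < Num.sqrt S /\ `|Num.sqrt S / tau - 1| <= 2 * h.
Proof.
move=> tau0 /andP[h0 h1] Bh Sle Sge.
have hi : 0 <= 1 + h^-1 by rewrite addr_ge0// invr_ge0 ltW.
have tau2 : 0 < tau ^+ 2 by rewrite exprn_gt0.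
have hB : (1 + h^-1) * B <= (h ^+ 2 + h) * tau ^+ 2.
  apply: le_trans (ler_wpM2l hi Bh) _; rewrite le_eqVlt; apply/orP; left.
  by apply/eqP; field; rewrite gt_eqF.
have up : S <= ((1 + h) * tau) ^+ 2 by rewrite exprMn; lra.
have low : ((1 - 2 * h) * tau) ^+ 2 <= S.
  rewrite exprMn -(ler_pM2l (_ : 0 < 1 + h)); last by lra.
  have : (1 + h) * ((1 - 2 * h) ^+ 2 * tau ^+ 2) <= (1 - h - h ^+ 2) * tau ^+ 2.
    rewrite mulrA ler_pM2r//.
    rewrite -subr_ge0 (_ : _ - _ = h * (2 - h - 4 * h ^+ 2)); last by ring.
    by rewrite mulr_ge0//; [exact: ltW|nra].
  by lra.
have S0 : 0 < S by apply: lt_le_trans low; rewrite exprn_gt0// mulr_gt0//; lra.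
split; first by rewrite sqrtr_gt0.
have s1 : Num.sqrt S <= (1 + h) * tau.
  have q : 0 <= (1 + h) * tau by rewrite mulr_ge0//; lra.
  by rewrite -(ger0_norm q) -sqrtr_sqr ler_wsqrtr.
have s2 : (1 - 2 * h) * tau <= Num.sqrt S.
  have q : 0 <= (1 - 2 * h) * tau by rewrite mulr_ge0//; lra.
  by rewrite -(ger0_norm q) -sqrtr_sqr ler_wsqrtr.
rewrite ler_norml lerBrDr lerBlDr ler_pdivrMr// ler_pdivlMr//.
apply/andP; split; first by apply: le_trans s2; rewrite ler_pM2r//; lra.
by apply: le_trans s1 _; rewrite ler_pM2r//; lra.
Qed.

(** Two displacements of size [del] add up: replacing [s] by [tau] moves the threshold [r] by one,
    and the thermal deviation [del * tau] costs the other. *)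
Lemma cdf_sandwich (K : R -> R) tau s B F r del (eps p : R) :
  {homo K : x y / x <= y} -> 0 < tau -> 0 < del ->
  `|r| * `|s / tau - 1| <= del -> B <= eps * del ^+ 2 * tau ^+ 2 ->
  F <= K ((r * s + del * tau) / tau) + B / (del * tau) ^+ 2 ->
  K ((r * s - del * tau) / tau) <= F + B / (del * tau) ^+ 2 ->
  `|K (r + 2 * del) - p| <= eps -> `|K (r - 2 * del) - p| <= eps ->
  `|F - p| <= 2 * eps.
Proof.
move=> Khom tau0 del0 rs Ble Fle Fge Kp Km.
have Beps : B / (del * tau) ^+ 2 <= eps.
  by rewrite ler_pdivrMr ?exprn_gt0 ?mulr_gt0// exprMn mulrA.
have : `|r * s / tau - r| <= del.
  by rewrite (_ : _ - r = r * (s / tau - 1)) ?normrM//; ring.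
rewrite ler_norml => /andP[rl rr].
have t0 : tau != 0 by rewrite gt_eqF.
have up : K ((r * s + del * tau) / tau) <= K (r + 2 * del).
  by apply: Khom; rewrite mulrDl mulfK//; lra.
have low : K (r - 2 * del) <= K ((r * s - del * tau) / tau).
  by apply: Khom; rewrite mulrBl mulfK//; lra.
move: Kp Km; rewrite !ler_norml => /andP[? ?] /andP[? ?].
by apply/andP; split; lra.
Qed.

End NormalisedLimit.

Section GreenWeights.
Context {R : realType} (N : nat) (lambda : R) (g : nat -> R).

Definition sites : seq int := [seq i%:Z - N%:Z | i <- index_iota 0 N.*2.+1].

Definition green_weight (x : int) : R :=
  g (absz (x + N%:Z)) / Num.sqrt (green_sqr N g).

Lemma uniq_sites : uniq sites.
Proof. by rewrite map_inj_uniq ?iota_uniq// => i j /addIr[]. Qed.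

Lemma green_weight_sqr : 0 < green_sqr N g ->
  \sum_(x <- sites) green_weight x ^+ 2 = 1.
Proof.
move=> G0; rewrite big_map.
under eq_bigr do rewrite /green_weight subrK/= expr_div_n sqr_sqrtr ?ltW//.
by rewrite -mulr_suml divff// gt_eqF.
Qed.

Lemma linear_response_weighted_sum d (T : measurableType d)
    (P : probability T R) (eta : int -> {RV P >-> R}) w : 0 < green_sqr N g ->
  linear_response N lambda (fun x => eta x w) g =
  lambda * Num.sqrt (green_sqr N g) * weighted_sum eta green_weight sites w.
Proof.
move=> G0; rewrite /linear_response -mulrA; congr (_ * _).
rewrite /weighted_sum big_map mulr_sumr; apply: eq_bigr => i _.
rewrite /green_weight /field_profile subrK/= mulrC mulrA mulrCA divff ?mulr1//.
by rewrite gt_eqF ?sqrtr_gt0.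
Qed.

End GreenWeights.

(** * Comparison of the annealed law with the weighted sum *)

Section AnnealedLaw.
Context {R : realType} d (T : measurableType d) (P : probability T R)
  (eta : int -> {RV P >-> R}) (N : nat) (alpha : \bar R)
  (alpha_gt : ((3 / 2)%:E < alpha)%E) (D : R) (lambda beta : R).
Hypotheses (beta_gt0 : 0 < beta) (lambda_gt0 : 0 < lambda).
Local Notation J := (coupling alpha).
Hypotheses
  (D_ge : forall K, \sum_(1 <= k < K) J k *+ 2 <= D)
  (D_le : forall e : R, 0 < e -> exists K, D - \sum_(1 <= k < K) J k *+ 2 <= e).
Variable g : nat -> R.
Hypotheses (g_out : forall i, (N.*2 < i)%N -> g i = 0)
  (g_green : forall i, (i < N.*2.+1)%N ->
     toeplitz_op J D N.*2.+1 g i = (i == N)%:R)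
  (g_sqr_gt0 : 0 < green_sqr N g).
Hypotheses (indX : mutually_independent eta)
  (iX : forall i, P.-integrable setT (EFin \o eta i))
  (mean0 : forall i, \int[P]_w eta i w = 0)
  (iX2 : forall i, P.-integrable setT (EFin \o (fun w => eta i w ^+ 2)))
  (var1 : forall i, \int[P]_w (eta i w ^+ 2) = 1).

Let mu w : probability (Omega N) R :=
  gibbs N alpha lambda beta (fun x => eta x w).

Let X (phi : Omega N) : R := (height phi 0)%:~R.

Let W := weighted_sum eta (green_weight N g) (sites N).

Let tau := lambda * Num.sqrt (green_sqr N g).

Let tau_gt0 : 0 < tau.
Proof. by rewrite mulr_gt0// sqrtr_gt0. Qed.

Definition thermal_variance : R :=
  (1 / 2 + 16 / beta ^+ 2) * total_perimeter J D N g ^+ 2.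

Let measurable_mu U : measurable U -> measurable_fun setT (fun w => mu w U).
Proof.
by move=> mU; exact: (measurable_kernel (gibbs_ker N alpha lambda beta eta) _ mU).
Qed.

Let measurable_X : measurable_fun setT X.
Proof. by move=> _ B _; rewrite setTI. Qed.

Let measurable_W : measurable_fun setT (fun w => tau * W w).
Proof. by apply: measurable_funM => //; exact: measurable_funPT. Qed.

Let thermal w :
  (\int[mu w]_phi ((X phi - tau * W w) ^+ 2)%:E <= thermal_variance%:E)%E.
Proof.
rewrite -linear_response_weighted_sum//.
exact: (thermal_bound alpha_gt D_ge D_le lambda _ beta_gt0 g_out g_green).
Qed.

Let weights1 : (\int[P]_w ((tau * W w) ^+ 2)%:E = (tau ^+ 2)%:E)%E.
Proof.
under eq_integral do rewrite exprMn EFinM.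
rewrite ge0_integralZl//; last 3 first.
- by apply/measurable_EFinP; apply: measurable_funX; exact: measurable_funPT.
- by move=> w _; rewrite lee_fin sqr_ge0.
- by rewrite lee_fin sqr_ge0.
rewrite (weighted_sum_variance _ indX iX mean0 iX2 var1 (uniq_sites N)).
by rewrite green_weight_sqr// mule1.
Qed.

Let S : \bar R := \int[P]_w \int[mu w]_phi (X phi ^+ 2)%:E.

Let scaled s : {RV annealed N alpha lambda beta eta >-> R} := scaled_field s 0.

Let F s r : R := fine (cdf (scaled s) r).

Lemma annealed_second_moment h : 0 < h ->
  fine S <= (1 + h) * tau ^+ 2 + (1 + h^-1) * thermal_variance /\
  tau ^+ 2 <= (1 + h) * fine S + (1 + h^-1) * thermal_variance.
Proof.
move=> h0.
have := mixture_second_moment_le P measurable_mu measurable_X measurable_W thermal h0.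
have := mixture_second_moment_ge P measurable_mu measurable_X measurable_W thermal h0.
rewrite weights1 -/S -EFinM -EFinD => ge le.
have S0 : (0 <= S)%E.
  apply: integral_ge0 => w _; apply: integral_ge0 => phi _.
  by rewrite lee_fin sqr_ge0.
have Sfin : S \is a fin_num by rewrite ge0_fin_numE// (le_lt_trans le)// ltry.
by move: ge le; rewrite -(fineK Sfin) -EFinM -EFinD !lee_fin.
Qed.

Lemma annealed_cdf s r : 0 < s ->
  cdf (scaled s) r =
  (\int[P]_w mu w [set phi | (X phi <= r * s)%R])%E.
Proof.
move=> s0; rewrite /cdf/= /distribution/= /pushforward /annealed.
apply: eq_integral => w _; congr (gibbs_ker _ _ _ _ _ _ _).
apply/seteqP; split => phi; rewrite /xsection/= inE/= in_itv/= /scaled_field/=;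
  by rewrite ler_pdivrMr.
Qed.

Let cdf_fin s r : cdf (scaled s) r \is a fin_num.
Proof. exact: fin_num_measure. Qed.

Let K x := fine (P (W @^-1` `]-oo, x])).

Let K_fin x : P (W @^-1` `]-oo, x]) = (K x)%:E.
Proof.
rewrite fineK// fin_num_measure//.
by rewrite -[X in measurable X]setTI; exact: measurable_funPT.
Qed.

Let scaled_below t : (fun w => tau * W w) @^-1` `]-oo, t] = W @^-1` `]-oo, t / tau].
Proof.
by apply/seteqP; split => w /=; rewrite !in_itv/= ler_pdivlMr// mulrC.
Qed.

Lemma annealed_cdf_le s r del : 0 < s -> 0 < del ->
  F s r <= K ((r * s + del * tau) / tau) + thermal_variance / (del * tau) ^+ 2.
Proof.
move=> s0 del0; have dt : 0 < del * tau by rewrite mulr_gt0.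
have := mixture_cdf_le P measurable_mu measurable_X measurable_W thermal (r * s) dt.
by rewrite -annealed_cdf// scaled_below K_fin -EFinD -(fineK (cdf_fin s r)) lee_fin.
Qed.

Lemma annealed_cdf_ge s r del : 0 < s -> 0 < del ->
  K ((r * s - del * tau) / tau) <= F s r + thermal_variance / (del * tau) ^+ 2.
Proof.
move=> s0 del0; have dt : 0 < del * tau by rewrite mulr_gt0.
have := mixture_cdf_ge P measurable_mu measurable_X measurable_W thermal (r * s) dt.
by rewrite -annealed_cdf// scaled_below K_fin -(fineK (cdf_fin s r)) -EFinD lee_fin.
Qed.

Let K_homo : {homo K : x y / x <= y}.
Proof.
move=> x y xy; rewrite -lee_fin -!K_fin; apply: le_measure.
- by rewrite inE -[X in measurable X]setTI; exact: measurable_funPT.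
- by rewrite inE -[X in measurable X]setTI; exact: measurable_funPT.
by move=> w /=; rewrite !in_itv/= => /le_trans; exact.
Qed.

(** [h] controls the ratio of the normaliser to [tau], [del] the thermal displacement at scale
    [tau]; this is why the thermal variance has to be small in two senses. *)
Lemma annealed_cdf_close r h del eps p : 0 < h <= 1 / 4 -> 0 < del ->
  `|r| * (2 * h) <= del ->
  thermal_variance <= h ^+ 2 * tau ^+ 2 ->
  thermal_variance <= eps * del ^+ 2 * tau ^+ 2 ->
  `|K (r + 2 * del) - p| <= eps -> `|K (r - 2 * del) - p| <= eps ->
  `|F (Num.sqrt (fine S)) r - p| <= 2 * eps.
Proof.
move=> /[dup] h01 /andP[h0 _] del0 rh Bh Beps Kp Km.
have [S1 S2] := annealed_second_moment h0.
have [s0 sr] := sqrt_ratio_close tau_gt0 h01 Bh S1 S2.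
apply: (cdf_sandwich (s := Num.sqrt (fine S)) K_homo tau_gt0 del0 _ Beps _ _ Kp Km).
- by apply: le_trans rh; rewrite ler_wpM2l.
- exact: annealed_cdf_le.
- exact: annealed_cdf_ge.
Qed.

End AnnealedLaw.

Section DisorderMoments.
Context {R : realType} d (T : measurableType d) (P : probability T R)
  (X : {RV P >-> R}).
Hypotheses (mean : ('E_P[X] = 0)%E)
  (variance : ('E_P[fun w => (X w ^+ 2)%R] = 1)%E).

Let variance_def : (\int[P]_w (X w ^+ 2)%:E = 1)%E.
Proof. by move: variance; rewrite unlock. Qed.

Lemma integrable_sqr_rv : P.-integrable setT (EFin \o (fun w => X w ^+ 2)).
Proof.
apply/integrableP; split.
  by apply/measurable_EFinP; apply: measurable_funX; exact: measurable_funPT.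
under eq_integral do rewrite /= ger0_norm ?sqr_ge0//.
by rewrite variance_def ltry.
Qed.

Lemma integrable_rv : P.-integrable setT (EFin \o X).
Proof.
have iC : P.-integrable setT (EFin \o (fun=> 1 : R)).
  exact: (bounded_rv_integrable P (M := `|1|)).
apply: (dominated_integrable (g := fun w => 1 + X w ^+ 2)).
- exact: measurable_funPT.
- exact: (integrableD measurableT iC integrable_sqr_rv).
move=> w; rewrite -(real_normK (num_real (X w))).
by have := sqr_ge0 (`|X w| - 1); have := normr_ge0 (X w); nra.
Qed.

Lemma Rintegral_rv : \int[P]_w X w = 0.
Proof. by move: mean; rewrite unlock /Rintegral => ->. Qed.

Lemma Rintegral_sqr_rv : \int[P]_w (X w ^+ 2) = 1.
Proof. by rewrite /Rintegral variance_def. Qed.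

End DisorderMoments.

Lemma interaction_sums {R : realType} (alpha : \bar R)
    (alpha_gt : ((3 / 2)%:E < alpha)%E) : exists D Q : R,
  [/\ forall K, \sum_(1 <= k < K) coupling alpha k *+ 2 <= D,
      forall e, 0 < e -> exists K, D - \sum_(1 <= k < K) coupling alpha k *+ 2 <= e,
      forall K, \sum_(1 <= k < K) coupling alpha k * Num.sqrt k%:R <= Q &
      forall e, 0 < e ->
        exists K, Q - \sum_(1 <= k < K) coupling alpha k * Num.sqrt k%:R <= e].
Proof.
have [M JM] := coupling_sqrt_summable alpha_gt.
have J0 k : 0 <= coupling alpha k := coupling_ge0 alpha k.
have [Q [Q_ge Q_le]] := nonneg_sum_sup
  (f := fun k => coupling alpha k * Num.sqrt k%:R)
  (fun k => mulr_ge0 (J0 k) (sqrtr_ge0 _)) JM.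
have J2 K : \sum_(1 <= k < K) coupling alpha k *+ 2 <= M *+ 2.
  rewrite sumrMnl lerMn2r; apply: le_trans (JM K).
  rewrite big_nat [leRHS]big_nat; apply: ler_sum => k /andP[k1 _].
  by rewrite ler_peMr// -[leLHS]sqrtr1 ler_wsqrtr// ler1n.
have [D [D_ge D_le]] := nonneg_sum_sup
  (f := fun k => coupling alpha k *+ 2) (fun k => mulrn_wge0 2 (J0 k)) J2.
by exists D, Q.
Qed.

Theorem theorem1p9 (R : realType) (d : measure_display) (T : measurableType d)
    (P : probability T R) (eta : int -> {RV P >-> R})
    (eta_independent : mutually_independent eta)
    (eta_identical : identically_distributed eta)
    (eta_mean : forall x : int, ('E_P[eta x] = 0)%E)
    (eta_variance : forall x : int, ('E_P[fun w => (eta x w ^+ 2)%R] = 1)%E)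
    (alpha : \bar R) (alpha_gt : ((3 / 2)%:E < alpha)%E)
    (beta : R) (beta_gt0 : 0 < beta) (lambda : R) (lambda_gt0 : 0 < lambda) :
  let second_moment (N : nat) : \bar R :=
    (\int[P]_w 'E_(gibbs N alpha lambda beta (fun x => eta x w))
                  [fun phi : Omega N => ((height phi 0)%:~R ^+ 2)%R])%E in
  cvg_in_distribution
    (P := fun N : nat => annealed N alpha lambda beta eta)
    (fun N : nat => scaled_field (Num.sqrt (fine (second_moment N))) 0)
    (normal_prob 0 1).
Proof.
move=> second_moment r _.
have iX2 i := integrable_sqr_rv (eta_variance i).
have iX i := integrable_rv (eta_variance i).
have mean0 i := Rintegral_rv (eta_mean i).
have var1 i := Rintegral_sqr_rv (eta_variance i).
have [D [Q [D_ge D_le Q_ge Q_le]]] := interaction_sums alpha_gt.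
have J0 := coupling_ge0 alpha.
have J1 := coupling1 alpha_gt.
have Jdec := coupling_noninc alpha_gt.
have /choice[g gP] : forall N, exists g : nat -> R,
    (forall i, (N.*2 < i)%N -> g i = 0) /\
    (forall i, (i < N.*2.+1)%N ->
      toeplitz_op (coupling alpha) D N.*2.+1 g i = (i == N)%:R).
  by move=> N; exact: (toeplitz_op_surj J0 J1 D_ge N.*2.+1 (fun i => (i == N)%:R)).
rewrite [X in _ --> X](gauss_cdfE r); apply: cvg_EFin.
  by apply: nearW => N; exact: fin_num_measure.
apply/cvgrPdist_le => e e0.
(* The final bound is [2 * (e / 2)], where [e / 2] splits into [e / 4] for the central limit theorem
   at a nearby point and [e / 4] for the continuity of [gauss_cdf]. *)
have e4 : 0 < e / 4 by rewrite divr_gt0.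
have [del [del0 gdel]] : exists del, 0 < del /\ forall x,
    `|x - r| <= del -> `|gauss_cdf x - gauss_cdf r| <= e / 4.
  have /cvgrPdist_le/(_ _ e4)/nbhs_ballP[del /= del0 rdel] :=
    @gauss_cdf_continuous R r.
  exists (del / 2); split; first by rewrite divr_gt0.
  move=> x xr; rewrite distrC; apply: rdel; rewrite /ball/= distrC.
  by apply: le_lt_trans xr _; rewrite ltr_pdivrMr// ltr_pMr// ltr1n.
(* The comparison looks at [r + 2 * del2] and [r - 2 * del2], which are then at distance [del] from
   [r]. *)
pose del2 := del / 2.
have del20 : 0 < del2 by rewrite divr_gt0.
have [c1 [c10 clt1]] := central_limit eta_independent eta_identical iX mean0 iX2 var1
  (0 : int) (r + 2 * del2) e4.
have [c2 [c20 clt2]] := central_limit eta_independent eta_identical iX mean0 iX2 var1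
  (0 : int) (r - 2 * del2) e4.
pose h := Num.min (1 / 4) (del2 / (2 * (`|r| + 1))).
have r1 : 0 < `|r| + 1 by rewrite ltr_wpDl.
have h0 : 0 < h.
  by rewrite /h lt_min; apply/andP; split; rewrite divr_gt0// mulr_gt0.
have h1 : h <= 1 / 4 by rewrite /h ge_min lexx.
have rh : `|r| * (2 * h) <= del2.
  have : h <= del2 / (2 * (`|r| + 1)) by rewrite /h ge_min lexx orbT.
  by rewrite ler_pdivlMr ?mulr_gt0// => ?; nra.
pose C := 1 / 2 + 16 / beta ^+ 2.
have C0 : 0 < C by rewrite addr_gt0// divr_gt0// exprn_gt0.
(* One threshold for four demands: weights below [c1] and [c2], as the central limit theorem
   requires at the two points, and a thermal variance below [h ^+ 2 * tau ^+ 2] and below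
   [e / 2 * del2 ^+ 2 * tau ^+ 2]. *)
pose kap := Num.min (Num.min (c1 ^+ 2) (c2 ^+ 2))
  (Num.min (h ^+ 2 * lambda ^+ 2 / C) (e / 2 * del2 ^+ 2 * lambda ^+ 2 / C)).
have kap0 : 0 < kap.
  have q0 q : 0 < q -> 0 < q * lambda ^+ 2 / C.
    by move=> q0; rewrite divr_gt0// mulr_gt0// exprn_gt0.
  rewrite /kap !lt_min !exprn_gt0//= !q0 ?exprn_gt0//.
  by rewrite mulr_gt0 ?exprn_gt0// divr_gt0.
have [N0 asym] := green_asymptotics J0 Jdec J1 D_ge D_le Q_ge Q_le kap0.
near=> N.
have [g_out g_green] := gP N.
have N1 : (0 < 1 <= N)%N by rewrite /=; near: N; exact: nbhs_infty_ge.
have NN0 : (N0 <= N)%N by near: N; exact: nbhs_infty_ge.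
have G0 : 0 < green_sqr N (g N).
  (* A tent of height 1 already excludes a vanishing norm. *)
  rewrite lt_neqAle green_sqr_ge0 andbT; apply/eqP => G0.
  have := green_sqr_lower J0 J1 D_ge g_out g_green N1.
  by rewrite -G0 mulr0 mul0rn ler10.
have [TG gG] := asym N (g N) NN0 g_out g_green.
have weight_le c : 0 < c -> kap <= c ^+ 2 ->
    forall x, x \in sites N -> `|green_weight N (g N) x| <= c.
  move=> c0 kc x /mapP[i]; rewrite mem_index_iota => /andP[_ iN] ->.
  rewrite /green_weight subrK/=.
  have gi0 : 0 <= g N i := green_ge0 J0 J1 D_ge g_out g_green i.
  (* All weights are controlled by the one at the centre: [g] decreases to the right of it, and
     symmetry covers the left. *)
  have giN : g N i <= g N N.
    have [Ni|Ni] := leqP N i.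
      have := green_noninc J0 Jdec J1 D_ge g_out g_green (leq0n (i - N)).
      by rewrite addn0 subnKC.
    have := green_noninc J0 Jdec J1 D_ge g_out g_green (leq0n (N - i)).
    rewrite addn0 (_ : (N + (N - i) = N.*2 - i)%N); last first.
      by rewrite -addnn addnBA// ltnW.
    by rewrite (green_sym J0 J1 D_ge g_green).
  rewrite ger0_norm ?divr_ge0 ?sqrtr_ge0// ler_pdivrMr ?sqrtr_gt0//.
  rewrite -ler_sqr ?nnegrE//; last by rewrite mulr_ge0 ?sqrtr_ge0// ltW.
  rewrite exprMn (sqr_sqrtr (ltW G0)); apply: (@le_trans _ _ (g N N ^+ 2)).
    by rewrite ler_sqr ?nnegrE// (le_trans gi0).
  by apply: le_trans gG _; rewrite ler_wpM2r// ltW.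
have W1 := green_weight_sqr G0.
have kc1 : kap <= c1 ^+ 2 by rewrite /kap !ge_min lexx.
have kc2 : kap <= c2 ^+ 2 by rewrite /kap !ge_min lexx !orbT.
have clt1N := clt1 _ _ (uniq_sites N) W1 (weight_le _ c10 kc1).
have clt2N := clt2 _ _ (uniq_sites N) W1 (weight_le _ c20 kc2).
have thermal_le (q : R) : kap <= q * lambda ^+ 2 / C ->
    thermal_variance N alpha D beta (g N) <=
    q * (lambda * Num.sqrt (green_sqr N (g N))) ^+ 2.
  move=> kq; rewrite /thermal_variance exprMn (sqr_sqrtr (ltW G0)).
  rewrite -/C -(ler_pdivlMl _ _ C0); apply: le_trans TG _.
  rewrite [leRHS](_ : _ = q * lambda ^+ 2 / C * green_sqr N (g N)); last by ring.
  by rewrite (ler_wpM2r (ltW G0)).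
have two_del x : `|fine (P (weighted_sum eta (green_weight N (g N)) (sites N)
      @^-1` `]-oo, x])) - gauss_cdf x| <= e / 4 -> `|x - r| <= del ->
    `|fine (P (weighted_sum eta (green_weight N (g N)) (sites N)
      @^-1` `]-oo, x])) - gauss_cdf r| <= e / 2.
  move=> cltx /gdel xr; apply: le_trans (ler_distD (gauss_cdf x) _ _) _.
  by apply: le_trans (lerD cltx xr) _; lra.
have S_eq : second_moment N = (\int[P]_w
    \int[gibbs N alpha lambda beta (fun x => eta x w)]_phi
      (((height phi 0)%:~R : R) ^+ 2)%:E)%E.
  by rewrite /second_moment; apply: eq_integral => w _; rewrite unlock.
rewrite distrC (_ : e = 2 * (e / 2)); last by lra.
rewrite /= S_eq.
apply: (annealed_cdf_close alpha_gt beta_gt0 lambda_gt0 D_ge D_le g_out g_green G0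
  eta_independent iX mean0 iX2 var1 (h := h) (del := del2)) => //.
- by rewrite h0.
- by apply: thermal_le; rewrite /kap !ge_min lexx !orbT.
- by apply: thermal_le; rewrite /kap !ge_min lexx !orbT.
- apply: two_del => //; rewrite addrAC subrr add0r ger0_norm; last by lra.
  by rewrite /del2; lra.
- apply: two_del => //; rewrite addrAC subrr add0r normrN ger0_norm; last by lra.
  by rewrite /del2; lra.
Unshelve. all: by end_near.
Qed.
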